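(* Let $x\in\mathbb{R}^d$ be fixed and let $\delta=\delta_m>0$ be arbitrary temporal mesh sizes. The method-of-moments estimator $$\hat\vartheta_{\mathrm{te},m}=\left(\frac{C_{\mathrm{te},\mathbb{E}}}{m^{-2}\delta^{\beta-3}\mathbf{V}_{\mathrm{te}}}\right)^{2/\beta}$$ satisfies $$\sqrt{m}\,(\hat\vartheta_{\mathrm{te},m}-\vartheta)\xrightarrow{d}N\left(0,\vartheta^2\frac{4\,C_{\mathrm{te},\mathbb{V}}}{\beta^2C_{\mathrm{te},\mathbb{E}}^2}\right),\qquad m\to\infty.$$
   Context: Let $d\in\mathbb{N}$, $\beta\in(0,\min(2,d))$ and $\vartheta>0$. $u=(u(t,x))_{t\ge0,x\in\mathbb{R}^d}$ denotes the solution of the stochastic wave equation $\partial_{tt}^2u=\vartheta\Delta u+\dot W_\beta$ on $\mathbb{R}^d$ with $u(0,\cdot)=\partial_tu(0,\cdot)\equiv0$, driven by centred Gaussian noise that is white in time and has Riesz-kernel spatial covariance (proportional to $|x-y|^{-\beta}$) with spectral density $|\xi|^{\beta-d}$. That is, $u$ is the centred Gaussian process with covariance $$\mathbb{E}[u(t,x)u(s,y)]=\frac{1}{(2\pi)^d}\int_0^{t\wedge s}\int_{\mathbb{R}^d}e^{\mathrm{i}(x-y)\cdot\xi}\,\frac{\sin((t-r)\sqrt\vartheta|\xi|)}{\sqrt\vartheta|\xi|}\,\frac{\sin((s-r)\sqrt\vartheta|\xi|)}{\sqrt\vartheta|\xi|}\,|\xi|^{\beta-d}\,d\xi\,dr.$$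 Observation times: $t_i=\delta i$, $i=0,\dots,m+1$. Define $\mathbf{I}_{\mathrm{te},i}=u(t_{i+1},x)+u(t_{i-1},x)-2u(t_i,x)$ for $i=1,\dots,m$ and $\mathbf{V}_{\mathrm{te}}=\sum_{i=1}^m\mathbf{I}_{\mathrm{te},i}^2$. Constants: with $g_{\mathrm{te}}(\omega)=\sin^4(|\omega|/2)|\omega|^{\beta-d-2}$ and $\mathcal{F}_c^+(f)(\xi)=\int_{\mathbb{R}^d}f(\omega)\cos(|\omega|\xi)\,d\omega$ for $\xi\in\mathbb{R}$, $$C_{\mathrm{te},\mathbb{E}}=\frac{4}{(2\pi)^d}\|g_{\mathrm{te}}\|_{L^1(\mathbb{R}^d)},\qquad C_{\mathrm{te},\mathbb{V}}=\frac{128}{3(2\pi)^{2d}}\sum_{j\in\mathbb{Z}}\big(\mathcal{F}_c^+(g_{\mathrm{te}})(j)\big)^2.$$ *)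

(* Defs.v *)
From HB Require Import structures.
From mathcomp Require Import all_boot all_order all_algebra.
From mathcomp Require Import complex.
From mathcomp Require Import all_classical all_reals all_analysis.

Set Implicit Arguments.
Unset Strict Implicit.
Unset Printing Implicit Defensive.

Import Order.TTheory GRing.Theory Num.Theory.
Import numFieldNormedType.Exports.

Local Open Scope classical_set_scope.
Local Open Scope ring_scope.
Local Open Scope complex_scope.

(* R^d is [d.-tuple R]: this type carries the product sigma-algebra, which row
   vectors do not have in the library. *)

Section lebesgue_measure_tuple.
Context {R : realType} (n : nat).

Definition tuple_cons (z : R * n.-tuple R) :
  n.+1.-tuple R := [tuple of z.1 :: z.2].

Lemma measurable_tuple_cons : measurable_fun setT tuple_cons.
Proof. by apply: measurable_cons. Qed.

Definition lebesgue_cons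
    (mu : {measure set (n.-tuple R) -> \bar R}) :
  set (n.+1.-tuple R) -> \bar R :=
  pushforward (@lebesgue_measure R \x^ mu)%E tuple_cons.

Variable mu : {measure set (n.-tuple R) -> \bar R}.

Let lebesgue_cons0 : lebesgue_cons mu set0 = 0%E.
Proof. by rewrite /lebesgue_cons /pushforward preimage_set0 measure0. Qed.

Let measurable_preimage (A : set (n.+1.-tuple R)) :
  measurable A -> measurable (tuple_cons @^-1` A).
Proof.
by move=> mA; rewrite -[X in measurable X]setTI; apply: measurable_tuple_cons.
Qed.

Let lebesgue_cons_ge0 A : (0 <= lebesgue_cons mu A)%E.
Proof. by rewrite /lebesgue_cons /pushforward; apply: measure_ge0. Qed.

Let lebesgue_cons_sigma_additive : semi_sigma_additive (lebesgue_cons mu).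
Proof.
move=> F mF tF mUF; rewrite /lebesgue_cons /pushforward preimage_bigcup.
apply: measure_semi_sigma_additive.
- by move=> i; apply: measurable_preimage.
- apply/trivIsetP => /= i j _ _ ij; rewrite -preimage_setI.
  by move/trivIsetP : tF => /(_ _ _ _ _ ij) ->//; rewrite preimage_set0.
- by rewrite -preimage_bigcup; apply: measurable_preimage.
Qed.

HB.instance Definition _ := isMeasure.Build _ _ _ (lebesgue_cons mu)
  lebesgue_cons0 lebesgue_cons_ge0 lebesgue_cons_sigma_additive.

End lebesgue_measure_tuple.

Fixpoint lebesgue_tuple {R : realType} (d : nat) :
    {measure set (d.-tuple R) -> \bar R} :=
  match d with
  | 0 => \d_([tuple])
  | d'.+1 => lebesgue_cons (lebesgue_tuple d')
  end.

Lemma measurable_box {R : realType} (d : nat) (A : 'I_d -> set R) :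
  (forall k, measurable (A k)) ->
  measurable [set z : d.-tuple R | forall k, A k (tnth z k)].
Proof.
move=> mA.
have -> : [set z : d.-tuple R | forall k, A k (tnth z k)] =
  \bigcap_(k in [set: 'I_d]) ((fun z : d.-tuple R => tnth z k) @^-1` A k).
  by apply/seteqP; split => z /= h k *; apply: h.
apply: fin_bigcap_measurable; first exact: finite_finset.
move=> k _; rewrite -[X in measurable X]setTI.
by apply: measurable_tnth.
Qed.

Lemma lebesgue_tuple_box {R : realType} (d : nat) (A : 'I_d -> set R) :
  (forall k, measurable (A k)) ->
  lebesgue_tuple d [set z : d.-tuple R | forall k, A k (tnth z k)] =
  (\big[*%E/1%E]_(k < d) lebesgue_measure (A k)).
Proof.
elim: d A => [|d IH] A mA /=.
  rewrite big_ord0 diracE mem_set//= => -[].  by [].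
rewrite big_ord_recl -IH; last by move=> k; exact: mA.
have mB := @measurable_box R d (fun k => A (lift ord0 k)) (fun k => mA _).
have /= <- := @product_measure2E _ _ _ _ R (@lebesgue_measure R)
  (lebesgue_tuple d) _ _ (mA ord0) mB.
rewrite /lebesgue_cons /pushforward; congr ((_ \x^ _)%E _).
apply/seteqP; split=> -[a z] /=.
  move=> h; split; first exact: (h ord0).
  by move=> k; have := h (lift ord0 k); rewrite /tuple_cons/= tnthS.
move=> [h0 h] k; case: (unliftP ord0 k) => [j ->|->] //.
by rewrite /tuple_cons /= tnthS.
Qed.

Definition dotp {R : realType} {d : nat} (x y : d.-tuple R) : R :=
  \sum_(k < d) tnth x k * tnth y k.

Definition subt {R : realType} {d : nat} (x y : d.-tuple R) : d.-tuple R :=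
  [tuple tnth x k - tnth y k | k < d].

Definition enorm {R : realType} {d : nat} (x : d.-tuple R) : R :=
  Num.sqrt (dotp x x).

Definition expi {R : realType} (t : R) : R[i] := cos t +i* sin t.

Definition Cintegral {d} {T : measurableType d} {R : realType}
    (mu : {measure set T -> \bar R}) (D : set T) (f : T -> R[i]) : R[i] :=
  (\int[mu]_(z in D) complex.Re (f z)) +i* (\int[mu]_(z in D) complex.Im (f z)).

(* N(m, v) for a variance v >= 0; the library's [normal_prob] takes a standard
   deviation and is not the Dirac mass when that deviation is 0. *)
Definition gaussian_prob {R : realType} (m v : R) :
    probability (measurableTypeR R) R :=
  if v == 0 then (\d_(m : measurableTypeR R) : probability _ R)
  else (normal_prob m (Num.sqrt v) : probability _ R).

Definition gaussian_process {d} {T : measurableType d} {R : realType}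
    (P : probability T R) (I : Type) (X : I -> {RV P >-> R}) : Prop :=
  forall (n : nat) (i : 'I_n -> I) (c : 'I_n -> R),
  exists m v : R, 0 <= v /\
    forall A : set R, measurable A ->
      pushforward P (fun w => \sum_(k < n) c k * X (i k) w) A =
      gaussian_prob m v A.

Definition centred_gaussian_process {d} {T : measurableType d} {R : realType}
    (P : probability T R) (I : Type) (X : I -> {RV P >-> R}) : Prop :=
  gaussian_process X /\ forall i, ('E_P[X i] = 0)%E.

Definition wave_kernel {R : realType} {d : nat} (theta t : R) (xi : d.-tuple R)
    : R :=
  sin (t * Num.sqrt theta * enorm xi) / (Num.sqrt theta * enorm xi).

Definition wave_covariance {R : realType} (d : nat) (beta theta t s : R)
    (x y : d.-tuple R) : R[i] :=
  (((2 * pi) ^+ d)^-1)%:C *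
  Cintegral (@lebesgue_measure R) `[0, Num.min t s] (fun r =>
    Cintegral (lebesgue_tuple d) setT (fun xi =>
      expi (dotp (subt x y) xi) *
      (wave_kernel theta (t - r) xi * wave_kernel theta (s - r) xi *
       enorm xi `^ (beta - d%:R))%:C)).

(* The solution of the stochastic wave equation with zero initial data, given
   through its law as a centred Gaussian field.  Taking [fine] loses nothing:
   Gaussian variables are square integrable. *)
Definition wave_solution {d'} {T : measurableType d'} {R : realType}
    (P : probability T R) (d : nat) (beta theta : R)
    (u : {nonneg R} -> d.-tuple R -> {RV P >-> R}) : Prop :=
  centred_gaussian_process (fun p : {nonneg R} * d.-tuple R => u p.1 p.2) /\
  forall (t s : {nonneg R}) (x y : d.-tuple R),
    (fine 'E_P[(u t x \* u s y)%R]%E)%:C =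
    wave_covariance beta theta t%:num s%:num x y.

Definition g_te {R : realType} (d : nat) (beta : R) (omega : d.-tuple R) : R :=
  sin (enorm omega / 2) ^+ 4 * enorm omega `^ (beta - d%:R - 2).

Definition cos_transform {R : realType} (d : nat) (f : d.-tuple R -> R) (xi : R)
    : R :=
  \int[lebesgue_tuple d]_omega (f omega * cos (enorm omega * xi)).

Definition C_te_E {R : realType} (d : nat) (beta : R) : R :=
  4 / (2 * pi) ^+ d *
  fine ('N[lebesgue_tuple d]_1 [EFin \o @g_te R d beta])%E.

Definition C_te_V {R : realType} (d : nat) (beta : R) : R :=
  128 / (3 * (2 * pi) ^+ (2 * d)) *
  fine (\esum_(j in [set: int])
          ((cos_transform (@g_te R d beta) j%:~R) ^+ 2)%:E)%E.

Definition obs_time {R : realType} (delta : {posnum R}) (i : nat)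
    : {nonneg R} := (delta%:num * i%:R)%:nng.

Definition I_te {R : realType} {d : nat} {T : Type}
    (u : {nonneg R} -> d.-tuple R -> T -> R) (x : d.-tuple R)
    (delta : {posnum R}) (i : nat) (w : T) : R :=
  u (obs_time delta i.+1) x w + u (obs_time delta i.-1) x w
  - 2 * u (obs_time delta i) x w.

Definition V_te {R : realType} {d : nat} {T : Type}
    (u : {nonneg R} -> d.-tuple R -> T -> R) (x : d.-tuple R)
    (delta : {posnum R}) (m : nat) (w : T) : R :=
  \sum_(1 <= i < m.+1) I_te u x delta i w ^+ 2.

Definition theta_hat_te {R : realType} {d : nat} {T : Type} (beta : R)
    (u : {nonneg R} -> d.-tuple R -> T -> R) (x : d.-tuple R)
    (delta : {posnum R}) (m : nat) (w : T) : R :=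
  (C_te_E d beta /
     (m%:R ^- 2 * delta%:num `^ (beta - 3) * V_te u x delta m w))
  `^ (2 / beta).

Definition cvg_in_distribution {d} {T : measurableType d} {R : realType}
    (P : probability T R) (X : nat -> T -> R)
    (nu : probability (measurableTypeR R) R) : Prop :=
  (forall m, measurable_fun setT (X m)) /\
  forall f : R -> R, continuous f -> (exists M, forall y, `|f y| <= M) ->
    (\int[P]_w f (X m w)) @[m --> \oo] --> \int[nu]_y f y.

(* Main.v *)
Require Import Defs.
From HB Require Import structures.
From mathcomp Require Import all_boot all_order all_algebra.
From mathcomp Require Import ring lra.
From mathcomp Require Import complex.
From mathcomp Require Import all_classical all_reals all_analysis.
From mathcomp Require Import measurable_realfun.

Set Implicit Arguments.
Unset Strict Implicit.
Unset Printing Implicit Defensive.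

Import Order.TTheory GRing.Theory Num.Theory.
Import numFieldNormedType.Exports.

Local Open Scope classical_set_scope.
Local Open Scope ring_scope.

(* The increments [I_te] are a linear image of a Gaussian process, so [V_te] is a
   Gaussian quadratic form.  Integrating the spectral representation shows that,
   up to the factor [delta `^ (3 - beta)], the covariance of the increments [i] and
   [j] is [kappa * (i + j) * rho (i - j)] plus a bounded term, where [rho] is
   the cosine transform of [g_te], a fourth difference of [|s| `^ (2 - beta)],
   which decays quadratically.  Hence the trace of the covariance matrix is
   [mean_limit * m ^ 2] up to [O(m)], its row sums are [O(m)], and its squared
   Frobenius norm is asymptotic to a multiple of [m ^ 3] by a weighted Cesaro
   argument.

   Gaussian integration by parts gives a recursion for the moments of the centred
   and rescaled quadratic form; as the row sums are small compared with the scale,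
   the fluctuation of the quadratic form of the covariance is negligible, and the
   recursion becomes in the limit the recursion of the moments of a centred normal
   law.  Convergence of moments implies convergence in law: the Taylor expansion of
   the cosine controls the means of trigonometric functions, and a bounded
   continuous function is approximated by polynomials in [sin (x / L)] away from an
   event of small probability.  The delta method transfers the limit to the
   estimator. *)

(** * Gaussian moments *)

(** The mesh may be arbitrary because the field is self-similar: multiplied by [delta] to the power
    [(beta - 3) / 2], the increments have the covariance [gam], in which [delta] no longer occurs,
    so one fixed array governs every limit.

    The constant [128 / 3] arises as follows. The variance of a Gaussian quadratic form is twice the
    squared Frobenius norm of the covariance matrix; near the diagonal the squared weight is about
    [4 * i ^+ 2], whose sum is about [4 / 3 * m ^+ 3]; and [kappa ^+ 2] contributes 16.

    No spherical integral is ever computed. The covariance and both constants involve the same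
    integral [cos_potential d beta 1], of which only finiteness and strict positivity matter.
    Finiteness comes from a scaling contraction; positivity keeps the limit of the mean away from 0,
    as the delta method requires.

    Gaussianity enters through moments alone, without joint densities: the one-dimensional moment
    recursion, valid for all linear combinations, is polarised into integration by parts. *)

Lemma exprn_le_fact_expR {R : realType} n (y : R) : 0 <= y -> y ^+ n <= n`!%:R * expR y.
Proof.
move=> y0; case: n => [|n].
  by rewrite fact0 mul1r expr0 -expR0 ler_expR.
have := expR_ge1Dxn n y0; have f0 : (0 : R) < n.+1`!%:R by rewrite ltr0n fact_gt0.
rewrite -ler_pdivrMl// [_^-1 * _]mulrC; lra.
Qed.

(** The fundamental theorem of calculus on [[c - n, c + n]], followed by dominated convergence in
    [n]. This is the integration by parts behind the recursion of the normal moments. *)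
Lemma integral_derive_eq0 {R : realType} (F f : R -> R) (c : R) :
  (forall x : R, is_derive x 1 F (f x)) -> continuous f ->
  (@lebesgue_measure R).-integrable setT (EFin \o f) ->
  F (c + n%:R) @[n --> \oo] --> 0 -> F (c - n%:R) @[n --> \oo] --> 0 ->
  (\int[@lebesgue_measure R]_x (f x)%:E = 0)%E.
Proof.
move=> dF cf fi F0 FN0; set mu := @lebesgue_measure R.
pose g (n : nat) : R -> \bar R := fun x => ((f \_ `[c - n%:R, c + n%:R]) x)%:E.
have mf : measurable_fun setT f by exact: continuous_measurable_fun.
have [_ _ h] : [/\ mu.-integrable setT (EFin \o f),
   [sequence (\int[mu]_x (`|g n x - (f x)%:E|))%E]_n @ \oo --> 0%E
  & [sequence (\int[mu]_x (g n x))%E]_n @ \oo --> (\int[mu]_x (f x)%:E)%E].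
  apply: (@dominated_convergence _ _ _ mu _ _ g (EFin \o f) (fun x => `|f x|%:E)).
  - exact: measurableT.
  - move=> n; apply/measurable_EFinP.
    by apply/(measurable_restrictT _ _).1 => //; exact: measurable_funS mf.
  - exact/measurable_EFinP.
  - apply: aeW => x _; apply: cvg_near_cst.
    apply: filterS (nbhs_infty_ger `|x - c|) => n hn.
    by rewrite /g patchE mem_set//= in_itv/= -ler_distl.
  - exact: integrable_norm.
  - by apply: aeW => x n _; rewrite /g patchE lee_fin; case: ifPn; rewrite ?normr0.
apply: (cvg_unique _ h); first exact: ereal_hausdorff.
rewrite /= -[X in _ --> X]/(0%R%:E) -[X in X%:E](subrr 0).
have : (F (c + n%:R) - F (c - n%:R))%:E @[n --> \oo] --> (0 - 0)%:E.
  by apply: cvg_EFin; [exact: nearW|exact: cvgB].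
apply: cvg_trans; apply: near_eq_cvg.
apply: filterS (nbhs_infty_gt 0) => n n0 /=.
have -> : (\int[mu]_x g n x = \int[mu]_(x in [set` `[(c - n%:R)%R, (c + n%:R)%R]%R]) (f x)%:E)%E.
  by rewrite [RHS]integral_mkcond -/(EFin \o f) restrict_EFin.
rewrite (@continuous_FTC2 _ f F)//.
- by rewrite ltrD2l -subr_gt0 opprK -natrD ltr0n addn_gt0 n0.
- exact: continuous_subspaceT.
- have cF : continuous F by move=> x; exact/differentiable_continuous/derivable1_diffP.
  split.
  + by move=> x _; case: (dF x).
  + exact/cvg_at_right_filter/cF.
  + exact/cvg_at_left_filter/cF.
- by move=> x _; rewrite derive1E; case: (dF x).
Qed.

Section normal_moments.
Context {R : realType}.
Notation mu := (@lebesgue_measure R).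
Variables (m s : R).
Hypothesis s0 : s != 0.

(** The Radon-Nikodym derivative and the density have the same integral over every measurable set,
    hence agree almost everywhere. This version assumes no integrability, so it can serve to prove
    that the moments are finite. *)
Lemma ge0_integral_normal_prob (f : R -> \bar R) : (forall x, (0 <= f x)%E) ->
  measurable_fun setT f ->
  (\int[normal_prob m s]_x f x = \int[mu]_x (f x * (normal_pdf m s x)%:E))%E.
Proof.
move=> f0 mf.
have dom := normal_prob_dominates m s.
rewrite -(Radon_Nikodym_SigmaFinite.change_of_variables dom f0)//.
apply: ae_eq_integral => //.
- apply: emeasurable_funM => //.
  exact: measurable_int (Radon_Nikodym_SigmaFinite.f_integrable dom).
- apply: emeasurable_funM => //; apply/measurable_EFinP.
  exact: measurable_normal_pdf.
- apply: ae_eqe_mul2l; apply: integral_ae_eq => //.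
  + exact: Radon_Nikodym_SigmaFinite.f_integrable.
  + by apply/measurable_EFinP; exact: measurable_normal_pdf.
  + move=> E _ mE; rewrite -Radon_Nikodym_SigmaFinite.f_integral//.
Qed.

Lemma integral_normal_prob (f : R -> \bar R) :
  (normal_prob m s).-integrable setT f ->
  (\int[normal_prob m s]_x f x = \int[mu]_x (f x * (normal_pdf m s x)%:E))%E.
Proof.
move=> fi; have mf := measurable_int _ fi; have dom := normal_prob_dominates m s.
rewrite -(Radon_Nikodym_change_of_variables dom)//.
apply: ae_eq_integral => //.
- by apply: emeasurable_funM => //; apply: (measurable_int mu).
- by apply: emeasurable_funM => //; apply/measurable_EFinP; exact: measurable_normal_pdf.
- apply: ae_eqe_mul2l; rewrite Radon_NikodymE//=.
  case: cid => /= h [h1 h2 h3]; apply: integral_ae_eq => //.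
  + by apply/measurable_EFinP; exact: measurable_normal_pdf.
  + by move=> E _ mE; rewrite -h3.
Qed.

(** Half of the exponent pays for the power: with [y] as below the Gaussian factor is [expR (- y)]
    squared, and [y ^+ n] is at most [n!] times [expR y]. The half that remains is a Gaussian of
    deviation [s * Num.sqrt 2], hence integrable. *)
Lemma exprn_expR_le n (x : R) :
  `|x| ^+ n * expR (- x ^+ 2 / (s ^+ 2 *+ 2)) <=
  (1 + n`!%:R * (s ^+ 2 *+ 4) ^+ n) * expR (- x ^+ 2 / ((s * Num.sqrt 2) ^+ 2 *+ 2)).
Proof.
have s2 : 0 < s ^+ 2 by rewrite exprn_even_gt0.
set y := x ^+ 2 / (s ^+ 2 *+ 4).
have y0 : 0 <= y by rewrite divr_ge0 ?sqr_ge0// mulrn_wge0// ltW.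
have -> : - x ^+ 2 / (s ^+ 2 *+ 2) = - y + - y.
  rewrite /y; by field.
have -> : - x ^+ 2 / ((s * Num.sqrt 2) ^+ 2 *+ 2) = - y.
  rewrite exprMn sqr_sqrtr// /y; by field.
rewrite expRD mulrA ler_pM2r ?expR_gt0// expRN ler_pdivrMr ?expR_gt0//.
have h1 : `|x| ^+ n <= 1 + x ^+ 2 ^+ n.
  rewrite -(real_normK (num_real x)) exprAC.
  set z := `|x| ^+ n; have := sqr_ge0 (z - 1); have : 0 <= z by rewrite exprn_ge0.
  by rewrite sqrrB mulr1 expr1n; nra.
have e1 : 1 <= expR y by rewrite -expR0 ler_expR.
have h2 : x ^+ 2 ^+ n <= n`!%:R * (s ^+ 2 *+ 4) ^+ n * expR y.
  have -> : x ^+ 2 = s ^+ 2 *+ 4 * y.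
    by rewrite /y mulrCA divff ?mulr1// mulrn_eq0/= gt_eqF.
  rewrite exprMn (mulrC n`!%:R) -[leRHS]mulrA.
  apply: ler_wpM2l; first by rewrite exprn_ge0// mulrn_wge0// ltW.
  exact: exprn_le_fact_expR.
rewrite mulrDl mul1r; lra.
Qed.

Let pdf := normal_pdf m s.

Let pdfE x : pdf x = normal_peak s * expR (- (x - m) ^+ 2 / (s ^+ 2 *+ 2)).
Proof. by rewrite /pdf normal_pdfE// /normal_fun. Qed.

Lemma normal_moment_le n : exists C, forall x,
  `|x - m| ^+ n * normal_pdf m s x <= C * normal_pdf m (s * Num.sqrt 2) x.
Proof.
have s2 : s * Num.sqrt 2 != 0 by rewrite mulf_neq0// sqrtr_eq0 -ltNge.
exists (normal_peak s * (1 + n`!%:R * (s ^+ 2 *+ 4) ^+ n) / normal_peak (s * Num.sqrt 2)) => x.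
rewrite -/pdf pdfE normal_pdfE// /normal_fun.
rewrite [leRHS]mulrA divfK ?gt_eqF ?normal_peak_gt0// mulrCA -mulrA.
by rewrite ler_wpM2l ?normal_peak_ge0//; exact: exprn_expR_le.
Qed.

Lemma normal_moment_ub n : exists C, forall x, `|x - m| ^+ n * normal_pdf m s x <= C.
Proof.
have s2 : s * Num.sqrt 2 != 0 by rewrite mulf_neq0// sqrtr_eq0 -ltNge.
have [C hC] := normal_moment_le n; exists (`|C| * normal_peak (s * Num.sqrt 2)) => x.
apply: le_trans (hC x) _; apply: le_trans (_ : `|C| * normal_pdf m (s * Num.sqrt 2) x <= _).
  by rewrite ler_wpM2r ?normal_pdf_ge0// ler_norm.
by rewrite ler_wpM2l// normal_pdf_ub.
Qed.

Lemma integrable_normal_moment n :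
  mu.-integrable setT (fun x => ((x - m) ^+ n * normal_pdf m s x)%:E).
Proof.
have [C hC] := normal_moment_le n.
apply: (@le_integrable _ _ _ mu setT measurableT _
  (fun x => (C * normal_pdf m (s * Num.sqrt 2) x)%:E)).
- apply/measurable_EFinP; apply: measurable_funM; first by apply: measurable_funX; exact: measurable_funB.
  exact: measurable_normal_pdf.
- move=> x _ /=; rewrite lee_fin normrM normrX [`|normal_pdf _ _ _|]ger0_norm ?normal_pdf_ge0//.
  by apply: le_trans (hC x) _; exact: ler_norm.
- under eq_fun do rewrite EFinM.
  by apply: integrableZl => //; exact: integrable_normal_pdf.
Qed.

Lemma is_derive_normal_pdf (x : R) :
  is_derive x 1 (normal_pdf m s) (- ((x - m) / s ^+ 2) * normal_pdf m s x).
Proof.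
rewrite -/pdf; have -> : pdf = fun x => normal_peak s * expR (- (x - m) ^+ 2 / (s ^+ 2 *+ 2)).
  by apply/funext => y; rewrite pdfE.
have h : is_derive x 1 (fun y : R => - (y - m) ^+ 2 / (s ^+ 2 *+ 2)) (- ((x - m) / s ^+ 2)).
  apply: is_derive_eq; rewrite /GRing.scale/=.
  by field.
have := is_derive1_comp (is_derive_expR _) h => h'.
apply: is_derive_eq.
by rewrite /GRing.scale/=; ring.
Qed.

(** The derivative of [- s ^+ 2 * (x - m) ^+ n] times the density is the difference of the two
    integrands. At [n = 0] the truncated exponent [n.-1] is harmless, since its coefficient
    vanishes. *)
Lemma normal_moment_rec n :
  (\int[mu]_x ((x - m) ^+ n.+1 * normal_pdf m s x)%:E =
   (n%:R * s ^+ 2)%:E * \int[mu]_x ((x - m) ^+ n.-1 * normal_pdf m s x)%:E)%E.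
Proof.
have s2 : s ^+ 2 != 0 by rewrite expf_eq0.
pose F x := - s ^+ 2 * ((x - m) ^+ n * normal_pdf m s x).
pose f x := (x - m) ^+ n.+1 * normal_pdf m s x - (n%:R * s ^+ 2) * ((x - m) ^+ n.-1 * normal_pdf m s x).
have cpdf : continuous (normal_pdf m s) by exact: continuous_normal_pdf.
have cX k : continuous (fun x : R => (x - m) ^+ k).
  move=> x; apply: (@continuous_comp _ _ _ (fun x => x - m) (fun x => x ^+ k)).
    by apply: cvgB; [exact: cvg_id|exact: cvg_cst].
  exact: exprn_continuous.
have cf : continuous f.
  move=> x; apply: cvgB; first by apply: cvgM; [exact: cX|exact: cpdf].
  by apply: cvgM; [exact: cvg_cst|apply: cvgM; [exact: cX|exact: cpdf]].
have dF (x : R) : is_derive x 1 F (f x).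
  have h := is_derive_normal_pdf x.
  have hX : is_derive x 1 (fun y : R => (y - m) ^+ n) (n%:R * (x - m) ^+ n.-1).
    by have := is_deriveX n (is_deriveB (is_derive_id x 1) (is_derive_cst m x 1)); rewrite exprfctE /GRing.scale/= subr0 mulr1.
  apply: (is_derive_eq (is_deriveZ (- s ^+ 2) (is_deriveM hX h))).
  rewrite /f (exprS (x - m)) /GRing.scale/=.
  by field.
have int_f k c : mu.-integrable setT (fun x => (c * ((x - m) ^+ k * normal_pdf m s x))%:E).
  by under eq_fun do rewrite EFinM; apply: integrableZl => //; exact: integrable_normal_moment.
have fi : mu.-integrable setT (EFin \o f).
  rewrite (_ : _ \o _ = (fun x => (1 * ((x - m) ^+ n.+1 * normal_pdf m s x))%:E) \-
    (fun x => ((n%:R * s ^+ 2) * ((x - m) ^+ n.-1 * normal_pdf m s x))%:E))%E.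
    exact: integrableB.
  by apply/funext => x /=; rewrite mul1r -EFinB.
(* The bound on the moment of order [n.+1] gives [k] times the value of [F] at distance [k] from [m]
   bounded, so [F] tends to 0 in both directions; [e] carries the sign. *)
have F0 (e : nat -> R) : (forall k, `|e k| = 1) -> F (m + e k * k%:R) @[k --> \oo] --> 0.
  move=> e1; have [C hC] := normal_moment_ub n.+1.
  apply/cvgr0Pnorm_lt => eps eps0.
  have h := nbhs_infty_gtr (s ^+ 2 * `|C| / eps).
  apply: filterS2 h (nbhs_infty_gt 0) => k hk k0.
  rewrite /F normrM normrN (normrX 2) (real_normK (num_real s)) normrM.
  rewrite (ger0_norm (normal_pdf_ge0 _ _ _)) normrX.
  have kp : (0 : R) < k%:R by rewrite ltr0n.
  have nk : `|m + e k * k%:R - m| = k%:R by rewrite addrAC subrr add0r normrM e1 mul1r gtr0_norm.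
  have hq := hC (m + e k * k%:R); move: hq; rewrite nk exprS -mulrA.
  set q := k%:R ^+ n * _ => hq.
  move: hk; rewrite ltr_pdivrMr// => hk.
  rewrite -(ltr_pM2l kp); have := ler_norm C; have : 0 < s ^+ 2 by rewrite exprn_even_gt0.
  nra.
have h0 : (\int[mu]_x (f x)%:E = 0)%E.
  apply: (@integral_derive_eq0 _ F f m) => //.
    by have := F0 (fun=> 1); under eq_fun do rewrite mul1r; apply => _; rewrite normr1.
  by have := F0 (fun=> -1); under eq_fun do rewrite mulN1r; apply => _; rewrite normrN1.
have := h0; under eq_integral do rewrite EFinB.
rewrite integralB//; last exact: integrable_normal_moment.
under [X in (_ - X)%E]eq_integral do rewrite EFinM.
rewrite integralZl//; last exact: integrable_normal_moment.
have fk k := fineK (integrable_fin_num measurableT (integrable_normal_moment k)).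
rewrite -(fk n.+1) -(fk n.-1) -EFinM -EFinB => -[/eqP]; rewrite subr_eq0 => /eqP -> //.
Qed.

End normal_moments.

(** * Calculus of random variables with finite moments of all orders *)

Section finite_moments.
Context {d} {T : measurableType d} {R : realType} (P : probability T R).
Implicit Types f g h : T -> R.

(** This class is stable under sums and products, so every polynomial expression in such variables
    is integrable without further estimates. *)
Definition has_moments f := measurable_fun setT f /\
  forall n, P.-integrable setT (fun w => (`|f w| ^+ n)%:E).

Local Notation E f := (Rintegral P setT f).

Lemma has_moments_integrable f : has_moments f -> P.-integrable setT (EFin \o f).
Proof.
move=> [mf /(_ 1%N)]; apply: le_integrable => //; first exact/measurable_EFinP.
by move=> w _ /=; rewrite expr1 normr_id.
Qed.

Lemma has_moments_le f g (c : R) : measurable_fun setT f -> has_moments g ->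
  (forall w, `|f w| <= c + `|g w|) -> has_moments f.
Proof.
move=> mf [mg ig] fg; split=> // n.
have c0 : forall w, 0 <= `|c| + `|g w| by move=> w; rewrite addr_ge0.
have h : P.-integrable setT (fun w => ((2 ^+ n * `|c| ^+ n)%:E + (2 ^+ n)%:E * (`|g w| ^+ n)%:E)%E).
  apply: integrableD => //; last exact: integrableZl.
  exact: finite_measure_integrable_cst.
apply: le_integrable h => //.
  by apply/measurable_EFinP/measurable_funX/measurableT_comp.
move=> w _; rewrite -EFinM -EFinD !abse_EFin lee_fin.
rewrite ger0_norm ?exprn_ge0//.
apply: le_trans (ler_norm _).
apply: (@le_trans _ _ ((`|c| + `|g w|) ^+ n)).
  by apply: lerXn2r; rewrite ?nnegrE//; apply: le_trans (fg w) _; rewrite lerD2r ler_norm.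
rewrite -mulrDr.
have h2 (a b : R) : 0 <= a -> 0 <= b -> a <= b -> (a + b) ^+ n <= 2 ^+ n * (a ^+ n + b ^+ n).
  move=> a0 b0 ab; apply: (@le_trans _ _ ((2 * b) ^+ n)).
    by apply: lerXn2r; rewrite ?nnegrE ?addr_ge0 ?mulr_ge0//; lra.
  by rewrite exprMn ler_pM2l ?exprn_gt0// lerDr exprn_ge0.
have [cg|/ltW cg] := leP `|c| `|g w|; first exact: h2.
by rewrite addrC [X in _ * X]addrC; exact: h2.
Qed.

Lemma has_moments_cst (c : R) : has_moments (fun=> c).
Proof.
split=> [|n]; first exact: measurable_cst.
exact: finite_measure_integrable_cst.
Qed.

Lemma has_moments_norm f : has_moments f -> has_moments (fun w => `|f w|).
Proof.
move=> [mf fi]; split; first exact: measurableT_comp.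
by move=> n; under eq_fun do rewrite normr_id.
Qed.

Lemma has_momentsX f k : has_moments f -> has_moments (fun w => f w ^+ k).
Proof.
move=> [mf fi]; split; first exact: measurable_funX.
by move=> n; under eq_fun do rewrite normrX -exprM.
Qed.

Lemma has_momentsD f g : has_moments f -> has_moments g ->
  has_moments (fun w => f w + g w).
Proof.
move=> [mf fi] [mg gi]; split; first exact: measurable_funD.
move=> n.
have h : P.-integrable setT (fun w => ((2 ^+ n)%:E * ((`|f w| ^+ n)%:E + (`|g w| ^+ n)%:E))%E).
  by apply: integrableZl => //; exact: integrableD.
apply: le_integrable h => //.
  by apply/measurable_EFinP/measurable_funX/measurableT_comp => //; exact: measurable_funD.
move=> w _; rewrite -EFinD -EFinM !abse_EFin lee_fin ger0_norm ?exprn_ge0//.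
apply: le_trans (ler_norm _).
apply: (@le_trans _ _ ((`|f w| + `|g w|) ^+ n)).
  by apply: lerXn2r; rewrite ?nnegrE ?addr_ge0//; exact: ler_normD.
have h2 (a b : R) : 0 <= a -> 0 <= b -> a <= b -> (a + b) ^+ n <= 2 ^+ n * (a ^+ n + b ^+ n).
  move=> a0 b0 ab; apply: (@le_trans _ _ ((2 * b) ^+ n)).
    by apply: lerXn2r; rewrite ?nnegrE ?addr_ge0 ?mulr_ge0//; lra.
  by rewrite exprMn ler_pM2l ?exprn_gt0// lerDr exprn_ge0.
have [cg|/ltW cg] := leP `|f w| `|g w|; first exact: h2.
by rewrite addrC [X in _ * X]addrC; exact: h2.
Qed.

Lemma has_momentsM f g : has_moments f -> has_moments g ->
  has_moments (fun w => f w * g w).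
Proof.
move=> mf mg.
have /(has_momentsD (has_momentsX 2 mf)) h := has_momentsX 2 mg.
apply: (has_moments_le (c := 0)) h _ => [|w].
  by apply: measurable_funM; [case: mf|case: mg].
rewrite add0r normrM [leRHS]ger0_norm ?addr_ge0 ?sqr_ge0//.
have := sqr_ge0 (`|f w| - `|g w|); rewrite sqrrB !real_normK ?num_real//.
have := sqr_ge0 (f w); have := sqr_ge0 (g w).
set p := `|f w| * `|g w|; rewrite -mulr_natl; lra.
Qed.

Lemma has_momentsZ (c : R) f : has_moments f -> has_moments (fun w => c * f w).
Proof. by move=> mf; apply: has_momentsM => //; exact: has_moments_cst. Qed.

Lemma has_momentsN f : has_moments f -> has_moments (fun w => - f w).
Proof. by move=> mf; under eq_fun do rewrite -mulN1r; exact: has_momentsZ. Qed.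

Lemma has_momentsB f g : has_moments f -> has_moments g ->
  has_moments (fun w => f w - g w).
Proof. by move=> mf mg; apply: has_momentsD => //; exact: has_momentsN. Qed.

Lemma has_moments_sum I (s : seq I) (A : pred I) (F : I -> T -> R) :
  (forall i, A i -> has_moments (F i)) -> has_moments (fun w => \sum_(i <- s | A i) F i w).
Proof.
move=> mF; elim: s => [|i s IH].
  rewrite (_ : (fun _ => _) = fun=> 0); first exact: has_moments_cst.
  by apply/funext => w; rewrite big_nil.
rewrite (_ : (fun _ => _) = fun w => if A i then F i w + \sum_(j <- s | A j) F j w
    else \sum_(j <- s | A j) F j w); last by apply/funext => w; rewrite big_cons.
case: (A i) (mF i) => [/(_ isT) mFi|_] //.
exact: has_momentsD.
Qed.

Lemma mean_cst (c : R) : E (fun=> c) = c.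
Proof. by rewrite Rintegral_cst// [X in fine X]probability_setT mulr1. Qed.

Lemma meanD f g : has_moments f -> has_moments g ->
  E (fun w => f w + g w) = E f + E g.
Proof. by move=> /has_moments_integrable ? /has_moments_integrable ?; exact: RintegralD. Qed.

Lemma meanB f g : has_moments f -> has_moments g ->
  E (fun w => f w - g w) = E f - E g.
Proof. by move=> /has_moments_integrable ? /has_moments_integrable ?; exact: RintegralB. Qed.

Lemma meanZ (c : R) f : has_moments f -> E (fun w => c * f w) = c * E f.
Proof. by move=> /has_moments_integrable ?; exact: RintegralZl. Qed.

Lemma mean_sum I (s : seq I) (A : pred I) (F : I -> T -> R) :
  (forall i, A i -> has_moments (F i)) ->
  E (fun w => \sum_(i <- s | A i) F i w) = \sum_(i <- s | A i) E (F i).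
Proof.
move=> mF; elim: s => [|i s IH].
  rewrite big_nil -[RHS]mean_cst; apply: eq_Rintegral => w _.
  by rewrite big_nil.
rewrite big_cons.
transitivity (E (fun w => if A i then F i w + \sum_(j <- s | A j) F j w
    else \sum_(j <- s | A j) F j w)).
  by apply: eq_Rintegral => w _; rewrite big_cons.
case: (A i) (mF i) => [/(_ isT) mFi|_] //.
by rewrite meanD ?IH//; exact: has_moments_sum.
Qed.

Lemma le_mean f g : has_moments f -> has_moments g ->
  (forall w, f w <= g w) -> E f <= E g.
Proof.
by move=> /has_moments_integrable ? /has_moments_integrable ? fg; exact: le_Rintegral.
Qed.

Lemma mean_ge0 f : (forall w, 0 <= f w) -> 0 <= E f.
Proof. by move=> f0; exact: Rintegral_ge0. Qed.

Lemma le_norm_mean f : has_moments f -> `|E f| <= E (fun w => `|f w|).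
Proof. by move=> /has_moments_integrable ?; exact: le_normr_Rintegral. Qed.

Lemma mean_CauchySchwarz f g : has_moments f -> has_moments g ->
  E (fun w => f w * g w) ^+ 2 <= E (fun w => f w ^+ 2) * E (fun w => g w ^+ 2).
Proof.
move=> mf mg.
set a := E (fun w => f w ^+ 2); set b := E (fun w => f w * g w).
set c := E (fun w => g w ^+ 2).
have a0 : 0 <= a by apply: mean_ge0 => w; exact: sqr_ge0.
have h (t : R) : 0 <= a - 2 * t * b + t ^+ 2 * c.
  have -> : a - 2 * t * b + t ^+ 2 * c = E (fun w => (f w - t * g w) ^+ 2).
    have m1 := has_momentsX 2 mf; have m2 := has_momentsX 2 mg.
    have m3 := has_momentsM mf mg.
    rewrite -!meanZ// -meanB//; last exact: has_momentsZ.
    rewrite -meanD; [|by apply: has_momentsB => //; exact: has_momentsZ|exact: has_momentsZ].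
    by apply: eq_Rintegral => w _; ring.
  by apply: mean_ge0 => w; exact: sqr_ge0.
have c0 : 0 <= c by apply: mean_ge0 => w; exact: sqr_ge0.
have [c00|cn0] := eqVneq c 0.
  have [b0|bn0] := eqVneq b 0; first by rewrite b0 expr0n/= mulr_ge0.
  (* For [c = 0] the quadratic polynomial in [t] is affine with slope [- 2 * b]; at this point it
     takes the value [-1], which contradicts its nonnegativity. *)
  have := h ((a + 1) / (2 * b)); rewrite c00 mulr0 addr0.
  have -> : a - 2 * ((a + 1) / (2 * b)) * b = -1 by field.
  by rewrite oppr_ge0 ler10.
have cp : 0 < c by rewrite lt_neqAle eq_sym cn0.
have := h (b / c).
have -> : a - 2 * (b / c) * b + (b / c) ^+ 2 * c = (a * c - b ^+ 2) / c by field.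
by rewrite pmulr_lge0 ?invr_gt0// subr_ge0.
Qed.

End finite_moments.

Section gaussian_moments.
Context {R : realType}.

(** The Dirac mass satisfies the recursion as well, both sides being 0, so a vanishing variance
    needs no separate treatment later. *)
Lemma gaussian_prob_moments (m v : R) (G := @gaussian_prob R m v) : 0 <= v ->
  has_moments G (fun x => x - m) /\
  forall n, \int[G]_x (x - m) ^+ n.+1 = n%:R * v * \int[G]_x (x - m) ^+ n.-1.
Proof.
move=> v0; rewrite /G /gaussian_prob {G}.
have mX : measurable_fun [set: measurableTypeR R] (fun x : R => x - m).
  exact: measurable_funB.
have [->|vn0] := eqVneq v 0.
  have e (h : R -> R) : measurable_fun setT h ->
      (\int[\d_(m : measurableTypeR R)]_x (h x)%:E = (h m)%:E)%E.
    by move=> mh; rewrite integral_dirac ?diracT ?mul1e//; exact/measurable_EFinP.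
  split.
    split=> // n; apply/integrableP; split.
      by apply/measurable_EFinP/measurable_funX/measurableT_comp.
    under eq_integral do rewrite gee0_abs ?lee_fin ?exprn_ge0//.
    rewrite e ?ltry//.
    by apply/measurable_funX/measurableT_comp.
  move=> n; rewrite /Rintegral e; last exact: measurable_funX.
  by rewrite mulr0 mul0r subrr expr0n.
have s0 : Num.sqrt v != 0 by rewrite sqrtr_eq0 -ltNge lt_neqAle eq_sym vn0.
have s2 : Num.sqrt v ^+ 2 = v by rewrite sqr_sqrtr.
set s := Num.sqrt v in s0 s2 *.
have key (h : R -> R) : measurable_fun setT h -> (forall x, 0 <= h x) ->
   (\int[normal_prob m s]_x (h x)%:E = \int[@lebesgue_measure R]_x (h x * normal_pdf m s x)%:E)%E.
  move=> mh h0; apply: (@ge0_integral_normal_prob _ m s (EFin \o h)).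
    by move=> x; rewrite lee_fin.
  exact/measurable_EFinP.
have hm : has_moments (normal_prob m s) (fun x => x - m).
  split=> // n; apply/integrableP; split.
    by apply/measurable_EFinP/measurable_funX/measurableT_comp.
  under eq_integral do rewrite gee0_abs ?lee_fin ?exprn_ge0//.
  rewrite key// ?exprn_ge0//.
    have /integrableP[_] := integrable_normal_moment m s0 n.
    under eq_integral do rewrite abse_EFin normrM normrX (ger0_norm (normal_pdf_ge0 _ _ _)).
    by [].
  by apply/measurable_funX/measurableT_comp.
split=> // n.
have e k : \int[normal_prob m s]_x (x - m) ^+ k =
    fine (\int[@lebesgue_measure R]_x ((x - m) ^+ k * normal_pdf m s x)%:E).
  rewrite /Rintegral integral_normal_prob//; first exact: has_moments_integrable (has_momentsX k hm).
rewrite !e normal_moment_rec// s2 fineM//.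
exact: integrable_fin_num (integrable_normal_moment _ _ _).
Qed.

End gaussian_moments.

(** * Gaussian integration by parts *)

(** The difference would vanish at [0, 1, 2, ...], at more points than its degree allows. This turns
    identities valid for every real [t] into identities between the coefficients of [t]. *)
Lemma poly_eq_horner {R : numFieldType} (p q : {poly R}) :
  (forall t, p.[t] = q.[t]) -> p = q.
Proof.
move=> pq; apply/eqP; rewrite -subr_eq0; apply/negPn/negP => pq0.
have := @max_poly_roots _ (p - q) [seq i%:R | i <- iota 0 (size (p - q))] pq0.
rewrite size_map size_iota ltnn => /(_ _ _)/wrap[]//.
  by apply/allP => _ /mapP[i _ ->]; rewrite /root hornerD hornerN pq subrr.
by rewrite map_inj_uniq ?iota_uniq// => i j /eqP; rewrite eqr_nat => /eqP.
Qed.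

Section gaussian_space.
Context {d} {T : measurableType d} {R : realType} (P : probability T R).
Local Notation E f := (Rintegral P setT f).
Implicit Types f g h H W X Y Z : T -> R.

(** Gaussianity reduced to what the argument consumes: each member satisfies the moment recursion of
    a centred normal law, and stability under linear combinations replaces the joint law. *)
Definition gaussian_space (L : set (T -> R)) :=
  (forall a Y Z, L Y -> L Z -> L (fun w => Y w + a * Z w)) /\
  (forall Y, L Y -> has_moments P Y /\
    forall n, E (fun w => Y w ^+ n.+1) =
      n%:R * E (fun w => Y w ^+ 2) * E (fun w => Y w ^+ n.-1)).

Lemma mean_exprD_poly H Y W n : has_moments P H -> has_moments P Y -> has_moments P W ->
  forall t, E (fun w => H w * (Y w + t * W w) ^+ n) =
   (\poly_(i < n.+1) ('C(n, i)%:R * E (fun w => H w * Y w ^+ (n - i) * W w ^+ i))).[t].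
Proof.
move=> mH mY mW t; rewrite horner_poly.
have mm i : has_moments P (fun w => H w * Y w ^+ (n - i) * W w ^+ i).
  by apply: has_momentsM; [apply: has_momentsM => //|]; exact: has_momentsX.
transitivity (E (fun w => \sum_(i < n.+1) ('C(n, i)%:R * t ^+ i) * (H w * Y w ^+ (n - i) * W w ^+ i))).
  apply: eq_Rintegral => w _; rewrite exprDn mulr_sumr; apply: eq_bigr => i _.
  by rewrite exprMn -mulr_natr; ring.
rewrite mean_sum; last by move=> i _; exact: has_momentsZ.
by apply: eq_bigr => i _; rewrite meanZ//; ring.
Qed.

Variable L : set (T -> R).
Hypothesis GL : gaussian_space L.

Let mL Y : L Y -> has_moments P Y.
Proof. by move=> /(GL.2 _)[]. Qed.

(* [H'] plays the role of the derivative of [H] in the direction of the covariance with [Z]. *)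
Definition gaussian_ibp Z H H' := [/\ has_moments P H, has_moments P H' &
  forall Y n, L Y -> E (fun w => Z w * H w * Y w ^+ n) =
    E (fun w => H' w * Y w ^+ n) +
    n%:R * E (fun w => Z w * Y w) * E (fun w => H w * Y w ^+ n.-1)].

Lemma gaussian_mean0 Y : L Y -> E Y = 0.
Proof.
move=> LY; have [_ /(_ 0%N)] := GL.2 _ LY; rewrite !mul0r => <-.
by apply: eq_Rintegral => w _; rewrite expr1.
Qed.

(** Polarisation: the recursion for [Y + t * Z] is an identity of polynomials in [t], and its
    coefficient of [t] expresses the mean of [Z * Y ^+ n.+2] by that of [Z * Y ^+ n]. Hence the
    strong induction in steps of two. *)
Lemma mean_mul_gaussian_exp Z Y n : L Z -> L Y ->
  E (fun w => Z w * Y w ^+ n) = n%:R * E (fun w => Z w * Y w) * E (fun w => Y w ^+ n.-1).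
Proof.
move=> LZ LY; set c := E (fun w => Z w * Y w).
have mZ := mL LZ; have mY := mL LY.
elim/ltn_ind: n => -[|[|n]] IH.
- rewrite !mul0r -(gaussian_mean0 LZ).
  by apply: eq_Rintegral => w _; rewrite expr0 mulr1.
- rewrite mul1r (_ : E _ = c); last by apply: eq_Rintegral => w _; rewrite expr1.
  by rewrite -[LHS]mulr1 -(mean_cst P 1); congr (_ * _); apply: eq_Rintegral.
have m1 := has_moments_cst P 1.
pose p k : {poly R} := \poly_(i < k.+1) ('C(k, i)%:R * E (fun w => 1 * Y w ^+ (k - i) * Z w ^+ i)).
have pE k t : E (fun w => (Y w + t * Z w) ^+ k) = (p k).[t].
  rewrite -mean_exprD_poly//.
  by apply: eq_Rintegral => w _; rewrite mul1r.
have : p n.+3 = n.+2%:R *: (p 2%N * p n.+1).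
  apply: poly_eq_horner => t; rewrite hornerZ hornerM -!pE.
  have [_ /(_ n.+2)] := GL.2 _ (GL.1 t _ _ LY LZ).
  by move=> -> /=; rewrite mulrA.
move/(congr1 (fun q : {poly R} => q`_1)).
rewrite coefZ coefM big_ord_recl big_ord1/= /bump/= !coef_poly/= !bin0 !bin1 !subn0 subn1/=.
set A := E (fun w => Y w ^+ 2).
have e1 k : E (fun w => 1 * Y w ^+ k * Z w ^+ 1) = E (fun w => Z w * Y w ^+ k).
  by apply: eq_Rintegral => w _; ring.
have e0 k : E (fun w => 1 * Y w ^+ k * Z w ^+ 0) = E (fun w => Y w ^+ k).
  by apply: eq_Rintegral => w _; ring.
rewrite !subSS !subn0 !e1 !e0 -/A.
rewrite (IH n)//.
have -> : E (fun w => Z w * Y w ^+ 1) = c by apply: eq_Rintegral => w _; rewrite expr1.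
have [_ /(_ n)] := GL.2 _ LY; rewrite -/A => r1.
rewrite !mul1r => h.
have n3 : n.+3%:R != 0 :> R by rewrite pnatr_eq0.
apply: (mulfI n3); rewrite h r1.
rewrite -!natr1; ring.
Qed.

Lemma gaussian_ibp1 Z : L Z -> gaussian_ibp Z (fun=> 1) (fun=> 0).
Proof.
move=> LZ; split; [exact: has_moments_cst|exact: has_moments_cst|] => Y n LY.
rewrite [X in _ = X + _](_ : _ = 0); last first.
  by rewrite -[RHS](mean_cst P); apply: eq_Rintegral => w _; rewrite mul0r.
rewrite add0r; transitivity (E (fun w => Z w * Y w ^+ n)).
  by apply: eq_Rintegral => w _; rewrite mulr1.
rewrite mean_mul_gaussian_exp//; congr (_ * _).
by apply: eq_Rintegral => w _; rewrite mul1r.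
Qed.

(** Polarisation again: the hypothesis for the test variable [Y + t * W] and the power [n.+1] is
    compared at the coefficient of [t], where exactly one factor [W] has been split off. Testing
    against all powers of all members is what makes the property stable under products. *)
Lemma gaussian_ibpM Z H H' W : L Z -> L W -> gaussian_ibp Z H H' ->
  gaussian_ibp Z (fun w => H w * W w)
    (fun w => H' w * W w + E (fun w' => Z w' * W w') * H w).
Proof.
move=> LZ LW [mH mH' ibp]; have mZ := mL LZ; have mW := mL LW.
split; first exact: has_momentsM.
  by apply: has_momentsD; [exact: has_momentsM|exact: has_momentsZ].
move=> Y n LY; have mY := mL LY.
have mZH := has_momentsM mZ mH.
pose p K k : {poly R} := \poly_(i < k.+1) ('C(k, i)%:R * E (fun w => K w * Y w ^+ (k - i) * W w ^+ i)).
set cY := E (fun w => Z w * Y w); set cW := E (fun w => Z w * W w).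
have pE K k t : has_moments P K -> E (fun w => K w * (Y w + t * W w) ^+ k) = (p K k).[t].
  by move=> mK; rewrite -mean_exprD_poly.
have : p (fun w => Z w * H w) n.+1 =
    p H' n.+1 + n.+1%:R *: ((cY%:P + cW *: 'X) * p H n).
  apply: poly_eq_horner => t.
  rewrite hornerD hornerZ hornerM hornerD hornerC hornerZ hornerX -!pE//.
  rewrite ibp; last exact: GL.1.
  rewrite -mulrA; congr (_ + _ * (_ * _)).
  rewrite /cY /cW [cW * t]mulrC -meanZ; last exact: has_momentsM.
  rewrite -meanD; [|exact: has_momentsM|by apply: has_momentsZ; exact: has_momentsM].
  by apply: eq_Rintegral => w _; ring.
move/(congr1 (fun q : {poly R} => q`_1)).
rewrite coefD coefZ coefM big_ord_recl big_ord1/= /bump/= !coef_poly/= !coefD !coefC !coefZ !coefX/=.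
rewrite !mulr0 !mulr1 addr0 add0r !bin1 !subn0 !subn1/= bin0 mul1r.
have e1 K k : E (fun w => K w * Y w ^+ k * W w ^+ 1) = E (fun w => K w * W w * Y w ^+ k).
  by apply: eq_Rintegral => w _; ring.
have e0 K k : E (fun w => K w * Y w ^+ k * W w ^+ 0) = E (fun w => K w * Y w ^+ k).
  by apply: eq_Rintegral => w _; ring.
rewrite !e1 !e0 => h.
have n1 : n.+1%:R != 0 :> R by rewrite pnatr_eq0.
apply: (mulfI n1).
transitivity (n.+1%:R * E (fun w => Z w * H w * W w * Y w ^+ n)).
  by congr (_ * _); apply: eq_Rintegral => w _; ring.
rewrite h -/cY -/cW.
have -> : E (fun w => (H' w * W w + cW * H w) * Y w ^+ n) =
    E (fun w => H' w * W w * Y w ^+ n) + cW * E (fun w => H w * Y w ^+ n).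
  have mX := has_momentsX n mY.
  rewrite -meanZ; last exact: has_momentsM.
  rewrite -meanD; [|by do 2 apply: has_momentsM => //|by apply: has_momentsZ; exact: has_momentsM].
  by apply: eq_Rintegral => w _; ring.
case: n {n1 h} => [|n] /=; first by rewrite mul0r mulr0; ring.
ring.
Qed.

End gaussian_space.

(** The Cauchy-Schwarz inequality for the weights [|a k|]. After doubling, it compares terms pair by
    pair through [(|b i| - |b j|) ^+ 2 >= 0]. *)
Lemma sum_sqr_le_weighted {R : realFieldType} n (a b : 'I_n -> R) :
  (\sum_k a k * b k) ^+ 2 <= (\sum_k `|a k|) * (\sum_k `|a k| * b k ^+ 2).
Proof.
rewrite expr2 !big_distrlr /=.
rewrite -(ler_pM2l (ltr0n _ 2)) !mulr_natl !mulr2n.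
rewrite [X in _ <= X + _](_ : _ = \sum_i \sum_j `|a i| * `|a j| * b j ^+ 2); last first.
  by apply: eq_bigr => i _; apply: eq_bigr => j _; rewrite mulrA.
rewrite [X in _ <= _ + X](_ : _ = \sum_i \sum_j `|a i| * `|a j| * b i ^+ 2); last first.
  by rewrite exchange_big /=; apply: eq_bigr => i _; apply: eq_bigr => j _; ring.
rewrite -!big_split/=; apply: ler_sum => i _; rewrite -!big_split/=; apply: ler_sum => j _.
apply: le_trans (ler_norm _) _; apply: le_trans (ler_normD _ _) _.
rewrite !normrM -mulrDr -(real_normK (num_real (b i))) -(real_normK (num_real (b j))).
have := sqr_ge0 (`|b i| - `|b j|); rewrite sqrrB.
have xy : 0 <= `|a i| * `|a j| by rewrite mulr_ge0.
move: xy; set x := `|a i|; set y := `|a j|; set p := `|b i|; set q := `|b j| => xy h.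
have -> : x * p * (y * q + y * q) = x * y * (p * q *+ 2).
  by rewrite -mulr_natl; ring.
by rewrite -mulrDr ler_wpM2l//; lra.
Qed.

(** * Moments of a Gaussian quadratic form *)

Section gaussian_quadratic_form.
Context {d} {T : measurableType d} {R : realType} (P : probability T R).
Local Notation E f := (Rintegral P setT f).
Variables (L : set (T -> R)) (GL : gaussian_space P L).
Implicit Types Z H : T -> R.

Let mL Y : L Y -> has_moments P Y.
Proof. by move=> /(GL.2 _)[]. Qed.

Lemma gaussian_ibpZ c Z H H' : gaussian_ibp P L Z H H' -> L Z ->
  gaussian_ibp P L Z (fun w => c * H w) (fun w => c * H' w).
Proof.
move=> [mH mH' ibp] /mL mZ; split; [exact: has_momentsZ|exact: has_momentsZ|].
move=> Y n LY; have mX k := has_momentsX k (mL LY).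
transitivity (c * E (fun w => Z w * H w * Y w ^+ n)).
  rewrite -meanZ; first by apply: eq_Rintegral => w _; ring.
  by apply: has_momentsM => //; exact: has_momentsM.
rewrite ibp// mulrDr -meanZ; last exact: has_momentsM.
rewrite mulrCA -(meanZ c); last exact: has_momentsM.
by congr (_ + _ * _); apply: eq_Rintegral => w _; ring.
Qed.

Lemma gaussian_ibpD Z H1 H1' H2 H2' : L Z ->
  gaussian_ibp P L Z H1 H1' -> gaussian_ibp P L Z H2 H2' ->
  gaussian_ibp P L Z (fun w => H1 w + H2 w) (fun w => H1' w + H2' w).
Proof.
move=> /mL mZ [m1 m1' ibp1] [m2 m2' ibp2]; split; [exact: has_momentsD|exact: has_momentsD|].
move=> Y n LY; have mX k := has_momentsX k (mL LY).
transitivity (E (fun w => Z w * H1 w * Y w ^+ n) + E (fun w => Z w * H2 w * Y w ^+ n)).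
  rewrite -meanD; first by apply: eq_Rintegral => w _; ring.
    by apply: has_momentsM => //; exact: has_momentsM.
  by apply: has_momentsM => //; exact: has_momentsM.
rewrite ibp1// ibp2// addrACA -mulrDr.
rewrite -meanD; [|exact: has_momentsM|exact: has_momentsM].
rewrite -meanD; [|exact: has_momentsM|exact: has_momentsM].
by congr (_ + _ * _); apply: eq_Rintegral => w _; ring.
Qed.

Lemma gaussian_ibp_sum n Z (H H' : 'I_n -> T -> R) : L Z ->
  (forall i, gaussian_ibp P L Z (H i) (H' i)) ->
  gaussian_ibp P L Z (fun w => \sum_i H i w) (fun w => \sum_i H' i w).
Proof.
move=> LZ; elim: n H H' => [|n IH] H H' h.
  have := gaussian_ibpZ 0 (gaussian_ibp1 GL LZ) LZ.
  by congr (gaussian_ibp _ _ _ _ _); apply/funext => w; rewrite big_ord0 mul0r.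
have := gaussian_ibpD LZ (h ord0) (IH _ _ (fun i => h (lift ord0 i))).
by congr (gaussian_ibp _ _ _ _ _); apply/funext => w; rewrite big_ord_recl.
Qed.

Lemma gaussian_ibp_mean Z H H' : L Z -> gaussian_ibp P L Z H H' ->
  E (fun w => Z w * H w) = E H'.
Proof.
move=> LZ [_ _ /(_ Z 0%N LZ)]; rewrite !mul0r addr0 => h.
transitivity (E (fun w => Z w * H w * Z w ^+ 0)); first by apply: eq_Rintegral => w _; ring.
by rewrite h; apply: eq_Rintegral => w _; ring.
Qed.

Variables (n : nat) (X : 'I_n -> T -> R) (LX : forall i, L (X i)).

Definition cov i j := E (fun w => X i w * X j w).

Lemma covC i j : cov i j = cov j i.
Proof. by apply: eq_Rintegral => w _; rewrite mulrC. Qed.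

Definition sqnorm w := \sum_i X i w ^+ 2.
(** Up to the factor 4 this is the carré du champ of [sqnorm], the squared length of its gradient
    measured by the covariance. Asymptotic normality follows once this variable concentrates around
    its mean. *)
Definition cov_form w := \sum_i \sum_j cov i j * (X i w * X j w).
Definition cov2 i j := \sum_k cov i k * cov k j.

Let mX i : has_moments P (X i). Proof. exact: mL. Qed.

Lemma has_moments_sqnorm : has_moments P sqnorm.
Proof. by apply: has_moments_sum => i _; exact: has_momentsX. Qed.

Lemma has_moments_cov_form : has_moments P cov_form.
Proof.
apply: has_moments_sum => i _; apply: has_moments_sum => j _.
by apply: has_momentsZ; exact: has_momentsM.
Qed.

Lemma gaussian_ibp_quad (a : 'I_n -> 'I_n -> R) i H H' :
  gaussian_ibp P L (X i) H H' ->
  gaussian_ibp P L (X i) (fun w => H w * \sum_j \sum_k a j k * (X j w * X k w))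
   (fun w => H' w * (\sum_j \sum_k a j k * (X j w * X k w)) +
      H w * \sum_j \sum_k a j k * (cov i j * X k w + cov i k * X j w)).
Proof.
move=> h.
have h2 j k := gaussian_ibpZ (a j k) (gaussian_ibpM GL (LX i) (LX k)
   (gaussian_ibpM GL (LX i) (LX j) h)) (LX i).
have := gaussian_ibp_sum (LX i) (fun j => gaussian_ibp_sum (LX i) (h2 j)).
congr (gaussian_ibp _ _ _ _ _); apply/funext => w.
  rewrite mulr_sumr; apply: eq_bigr => j _; rewrite mulr_sumr.
  by apply: eq_bigr => k _; ring.
rewrite !mulr_sumr -big_split/=; apply: eq_bigr => j _.
rewrite !mulr_sumr -big_split/=; apply: eq_bigr => k _.
rewrite -/(cov i j) -/(cov i k); ring.
Qed.

Lemma sqnormE w : sqnorm w = \sum_j \sum_k (j == k)%:R * (X j w * X k w).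
Proof.
apply: eq_bigr => j _; rewrite (bigD1 j)//= eqxx mul1r big1 ?addr0// => k kj.
by rewrite eq_sym (negbTE kj) mul0r.
Qed.

Lemma gaussian_ibp_sqnorm i H H' (c : R) : gaussian_ibp P L (X i) H H' ->
  gaussian_ibp P L (X i) (fun w => H w * (sqnorm w - c))
   (fun w => H' w * (sqnorm w - c) + H w * (2 * \sum_j cov i j * X j w)).
Proof.
move=> h.
have := gaussian_ibpD (LX i) (gaussian_ibp_quad (fun j k => (j == k)%:R) h)
  (gaussian_ibpZ (- c) h (LX i)).
congr (gaussian_ibp _ _ _ _ _); apply/funext => w; first by rewrite -sqnormE; ring.
rewrite -sqnormE.
have -> : \sum_j \sum_k (j == k)%:R * (cov i j * X k w + cov i k * X j w) =
    2 * \sum_j cov i j * X j w.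
  rewrite mulr_sumr; apply: eq_bigr => j _.
  rewrite (bigD1 j)//= eqxx mul1r big1 ?addr0 => [|k kj]; first by ring.
  by rewrite eq_sym (negbTE kj) mul0r.
ring.
Qed.

Lemma gaussian_ibp_sqnormX i (c s : R) p :
  gaussian_ibp P L (X i) (fun w => (s * (sqnorm w - c)) ^+ p)
   (fun w => p%:R * (s * (sqnorm w - c)) ^+ p.-1 * (2 * s * \sum_j cov i j * X j w)).
Proof.
elim: p => [|p IH].
  by have := gaussian_ibp1 GL (LX i); congr (gaussian_ibp _ _ _ _ _); apply/funext => w; ring.
have := gaussian_ibpZ s (gaussian_ibp_sqnorm c IH) (LX i).
congr (gaussian_ibp _ _ _ _ _); apply/funext => w; first by rewrite exprS; ring.
case: p {IH} => [|p] /=; first by rewrite expr0; ring.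
by rewrite exprS -natr1; ring.
Qed.

(** One factor [W] is expanded and an [X i] of each square is integrated by parts: differentiating
    the other [X i] produces the trace, differentiating [W ^+ p] produces [cov_form]. With
    [cov_form] constant and [c] equal to the trace, this would be exactly the normal recursion. *)
Lemma mean_sqnormX_rec (c s : R) p (W := fun w => s * (sqnorm w - c)) :
  E (fun w => W w ^+ p.+1) = s * (\sum_i cov i i - c) * E (fun w => W w ^+ p) +
    2 * p%:R * E (fun w => s ^+ 2 * cov_form w * W w ^+ p.-1).
Proof.
have mW : has_moments P W.
  by apply: has_momentsZ; apply: has_momentsB; [exact: has_moments_sqnorm|exact: has_moments_cst].
have mWk k := has_momentsX k mW.
have mS i : has_moments P (fun w => \sum_j cov i j * X j w).
  by apply: has_moments_sum => j _; exact: has_momentsZ.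
have hi i : E (fun w => X i w * (W w ^+ p * X i w)) = cov i i * E (fun w => W w ^+ p) +
    p%:R * (2 * s) * E (fun w => X i w * (\sum_j cov i j * X j w) * W w ^+ p.-1).
  rewrite (gaussian_ibp_mean (LX i) (gaussian_ibpM GL (LX i) (LX i) (gaussian_ibp_sqnormX i c s p))).
  rewrite -/(cov i i) -!meanZ//; last first.
    by apply: has_momentsM => //; exact: has_momentsM.
  rewrite -meanD.
  - by apply: eq_Rintegral => w _; rewrite /W; ring.
  - exact: has_momentsZ.
  - by apply: has_momentsZ; apply: has_momentsM => //; exact: has_momentsM.
transitivity (s * \sum_i E (fun w => X i w * (W w ^+ p * X i w)) - s * c * E (fun w => W w ^+ p)).
  rewrite -mean_sum; last by move=> i _; do 2 apply: has_momentsM => //.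
  have mm : has_moments P (fun w => \sum_i X i w * (W w ^+ p * X i w)).
    by apply: has_moments_sum => i _; do 2 apply: has_momentsM => //.
  rewrite -!meanZ// -meanB; [|exact: has_momentsZ|exact: has_momentsZ].
  apply: eq_Rintegral => w _; rewrite exprS {1}/W /sqnorm.
  rewrite [X in _ = s * X - _](_ : _ = W w ^+ p * \sum_i X i w ^+ 2); first by ring.
  by rewrite mulr_sumr; apply: eq_bigr => i _; ring.
under eq_bigr do rewrite hi.
rewrite big_split/= -mulr_suml -mulr_sumr.
have -> : E (fun w => s ^+ 2 * cov_form w * W w ^+ p.-1) =
   s ^+ 2 * \sum_i E (fun w => X i w * (\sum_j cov i j * X j w) * W w ^+ p.-1).
  rewrite -mean_sum; last by move=> i _; apply: has_momentsM => //; exact: has_momentsM.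
  rewrite -meanZ; last first.
    by apply: has_moments_sum => i _; apply: has_momentsM => //; exact: has_momentsM.
  apply: eq_Rintegral => w _; rewrite -mulrA -mulr_suml; congr (_ * (_ * _)).
  apply: eq_bigr => i _; rewrite mulr_sumr; apply: eq_bigr => j _; ring.
ring.
Qed.

Lemma mean_cov_form : E cov_form = \sum_i \sum_j cov i j ^+ 2.
Proof.
rewrite mean_sum; last first.
  by move=> i _; apply: has_moments_sum => j _; apply: has_momentsZ; exact: has_momentsM.
apply: eq_bigr => i _; rewrite mean_sum; last first.
  by move=> j _; apply: has_momentsZ; exact: has_momentsM.
by apply: eq_bigr => j _; rewrite meanZ ?expr2//; exact: has_momentsM.
Qed.

Lemma cov_form_deriv i w :
  \sum_j \sum_k cov j k * (cov i j * X k w + cov i k * X j w) = 2 * \sum_j cov2 i j * X j w.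
Proof.
have h : \sum_j \sum_k cov j k * (cov i j * X k w) = \sum_j cov2 i j * X j w.
  rewrite exchange_big /=; apply: eq_bigr => j _; rewrite /cov2 mulr_suml.
  by apply: eq_bigr => k _; ring.
rewrite (_ : 2 * _ = \sum_j cov2 i j * X j w + \sum_j cov2 i j * X j w); last by ring.
rewrite -{1}h -h [X in _ = _ + X]exchange_big -big_split/=; apply: eq_bigr => j _.
by rewrite -big_split/=; apply: eq_bigr => k _; rewrite (covC k j); ring.
Qed.

(** Integration by parts applied to [cov_form] times itself. As the first term is the squared mean,
    the second is the variance of [cov_form], twice the squared Frobenius norm of the squared
    covariance matrix. *)
Lemma mean_cov_form2 :
  E (fun w => cov_form w ^+ 2) = (\sum_i \sum_j cov i j ^+ 2) ^+ 2 +
    2 * \sum_i \sum_j cov2 i j ^+ 2.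
Proof.
have hi i j : E (fun w => X i w * (cov_form w * X j w)) =
   cov i j * E cov_form + 2 * \sum_k cov2 i k * cov k j.
  have := gaussian_ibpM GL (LX i) (LX j) (gaussian_ibp_quad cov (gaussian_ibp1 GL (LX i))).
  move/(gaussian_ibp_mean (LX i)) => h.
  transitivity (E (fun w => X i w * (1 * cov_form w * X j w))).
    by apply: eq_Rintegral => w _; ring.
  rewrite h -/(cov i j).
  transitivity (E (fun w => cov i j * cov_form w + \sum_k 2 * cov2 i k * (X k w * X j w))).
    apply: eq_Rintegral => w _; rewrite mul0r add0r !mul1r cov_form_deriv addrC; congr (_ + _).
    by rewrite mulr_sumr mulr_suml; apply: eq_bigr => k _; ring.
  rewrite meanD; last 2 first.
  - by apply: has_momentsZ; exact: has_moments_cov_form.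
  - by apply: has_moments_sum => k _; apply: has_momentsZ; exact: has_momentsM.
  rewrite meanZ; last exact: has_moments_cov_form.
  congr (_ + _); rewrite mean_sum; last first.
    by move=> k _; apply: has_momentsZ; exact: has_momentsM.
  rewrite mulr_sumr; apply: eq_bigr => k _; rewrite meanZ; last exact: has_momentsM.
  by rewrite mulrA.
have mF := has_moments_cov_form.
transitivity (E (fun w => \sum_i \sum_j cov i j * (X i w * (cov_form w * X j w)))).
  apply: eq_Rintegral => w _; rewrite expr2 {1}/cov_form mulr_suml.
  apply: eq_bigr => i _; rewrite mulr_suml; apply: eq_bigr => j _; ring.
rewrite mean_sum; last first.
  move=> i _; apply: has_moments_sum => j _; apply: has_momentsZ.
  by do 2 apply: has_momentsM => //.
transitivity (\sum_i \sum_j cov i j * (cov i j * E cov_form + 2 * \sum_k cov2 i k * cov k j)).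
  apply: eq_bigr => i _; rewrite mean_sum; last first.
    by move=> j _; apply: has_momentsZ; do 2 apply: has_momentsM => //.
  apply: eq_bigr => j _; rewrite meanZ ?hi//.
  by do 2 apply: has_momentsM => //.
rewrite mean_cov_form; set S := \sum_i \sum_j cov i j ^+ 2.
transitivity (\sum_i (\sum_j cov i j ^+ 2 * S + 2 * \sum_k cov2 i k ^+ 2)).
  apply: eq_bigr => i _.
  transitivity (\sum_j cov i j ^+ 2 * S + 2 * \sum_j \sum_k cov i j * (cov2 i k * cov k j)).
    rewrite mulr_sumr -big_split/=; apply: eq_bigr => j _.
    by rewrite -mulr_sumr; ring.
  congr (_ + 2 * _); rewrite exchange_big/=; apply: eq_bigr => k _.
  rewrite expr2 [X in _ = _ * X]/cov2 mulr_sumr; apply: eq_bigr => j _.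
  by rewrite (covC k j); ring.
rewrite big_split/= -mulr_sumr; congr (_ + _).
by rewrite expr2 {2}/S mulr_suml; apply: eq_bigr => i _; rewrite mulr_suml.
Qed.

Variable r : R.
Hypothesis r0 : 0 <= r.
Hypothesis rowsum : forall i, \sum_j `|cov i j| <= r.

(** Schur's test: the maximal absolute row sum bounds the operator norm of a symmetric matrix, so
    multiplying by the covariance costs at most a factor [r] in Frobenius norm. The weighted
    Cauchy-Schwarz inequality proves it without eigenvalues. *)
Lemma cov2_le : \sum_i \sum_j cov2 i j ^+ 2 <= r ^+ 2 * \sum_i \sum_j cov i j ^+ 2.
Proof.
apply: (@le_trans _ _ (\sum_i \sum_j r * \sum_k `|cov i k| * cov k j ^+ 2)).
  apply: ler_sum => i _; apply: ler_sum => j _.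
  apply: le_trans (sum_sqr_le_weighted _ _) _.
  by apply: ler_wpM2r => //; apply: sumr_ge0 => k _; rewrite mulr_ge0 ?sqr_ge0.
have -> : \sum_i \sum_j r * \sum_k `|cov i k| * cov k j ^+ 2 =
    r * \sum_k (\sum_i `|cov k i|) * \sum_j cov k j ^+ 2.
  rewrite mulr_sumr; under eq_bigr do rewrite -mulr_sumr.
  rewrite -!mulr_sumr; congr (_ * _).
  under eq_bigr do rewrite exchange_big/=.
  rewrite exchange_big/=; apply: eq_bigr => k _; rewrite mulr_suml.
  by apply: eq_bigr => i _; rewrite mulr_sumr; apply: eq_bigr => j _; rewrite covC.
rewrite expr2 -mulrA ler_wpM2l// mulr_sumr; apply: ler_sum => k _.
by rewrite ler_wpM2r// sumr_ge0// => j _; exact: sqr_ge0.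
Qed.

(** Schur's test in quadratic form: a product is at most half the sum of the squares, and by
    symmetry both halves contribute the same. *)
Lemma cov_form_le w : cov_form w <= r * sqnorm w.
Proof.
apply: (@le_trans _ _ (\sum_i \sum_j `|cov i j| * ((X i w ^+ 2 + X j w ^+ 2) / 2))).
  apply: ler_sum => i _; apply: ler_sum => j _.
  apply: le_trans (ler_norm _) _; rewrite normrM ler_wpM2l//.
  rewrite ler_norml; have := sqr_ge0 (X i w - X j w); have := sqr_ge0 (X i w + X j w).
  by rewrite sqrrB sqrrD -mulr_natl; lra.
have e : \sum_i \sum_j `|cov i j| * X i w ^+ 2 <= r * sqnorm w.
  rewrite /sqnorm mulr_sumr; apply: ler_sum => i _.
  by rewrite -mulr_suml ler_wpM2r ?sqr_ge0.
have -> : \sum_i \sum_j `|cov i j| * ((X i w ^+ 2 + X j w ^+ 2) / 2) =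
   (\sum_i \sum_j `|cov i j| * X i w ^+ 2 + \sum_i \sum_j `|cov i j| * X i w ^+ 2) / 2.
  rewrite [X in (_ + X) / _]exchange_big/= -big_split/= mulr_suml; apply: eq_bigr => i _.
  rewrite -big_split/= mulr_suml; apply: eq_bigr => j _.
  by rewrite (covC j i) mulrA -mulrDr.
lra.
Qed.

End gaussian_quadratic_form.

Lemma cvgn_norm_ub {R : realType} (x : nat -> R) (l : R) :
  x m @[m --> \oo] --> l -> exists D, forall m, `|x m| <= D.
Proof.
move=> xl; have /cvg_seq_bounded[D [_ hD]] : cvg (x m @[m --> \oo]) by apply/cvg_ex; exists l.
by exists (D + 1) => m; apply: hD => //; rewrite ltrDl.
Qed.

(** * Convergence of the moments of the rescaled quadratic form *)

Section moment_convergence.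
Context {d} {T : measurableType d} {R : realType} (P : probability T R).
Local Notation E f := (Rintegral P setT f).
Variables (L : set (T -> R)) (GL : gaussian_space P L).
Variables (N : nat -> nat) (X : forall m, 'I_(N m) -> T -> R).
Hypothesis LX : forall m i, L (@X m i).
Variables (s c r : nat -> R) (v C : R).
Hypotheses (s0 : forall m, 0 <= s m) (r0 : forall m, 0 <= r m).
Hypothesis rowsum : forall m i, \sum_j `|cov P (@X m) i j| <= r m.
Hypothesis bias : s m * (\sum_i cov P (@X m) i i - c m) @[m --> \oo] --> 0.
Hypothesis var : 2 * s m ^+ 2 * (\sum_i \sum_j cov P (@X m) i j ^+ 2) @[m --> \oo] --> v.
Hypothesis sr0 : s m * r m @[m --> \oo] --> 0.
Hypothesis srC : forall m, s m ^+ 2 * r m * c m <= C.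

Let W m w := s m * (sqnorm (@X m) w - c m).
Let b m := s m * (\sum_i cov P (@X m) i i - c m).
Let G m w := s m ^+ 2 * cov_form P (@X m) w.

Let mW m : has_moments P (W m).
Proof.
apply: has_momentsZ; apply: has_momentsB; last exact: has_moments_cst.
exact: (has_moments_sqnorm GL (@LX m)).
Qed.

Let mG m : has_moments P (G m).
Proof. by apply: has_momentsZ; exact: (has_moments_cov_form GL (@LX m)). Qed.

Let recW m p : E (fun w => W m w ^+ p.+1) =
  b m * E (fun w => W m w ^+ p) + 2 * p%:R * E (fun w => G m w * W m w ^+ p.-1).
Proof. exact: (mean_sqnormX_rec GL (@LX m)). Qed.

Let G_le m w : G m w <= s m * r m * W m w + C.
Proof.
apply: le_trans (_ : s m ^+ 2 * (r m * sqnorm (@X m) w) <= _).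
  by rewrite ler_wpM2l ?sqr_ge0//; exact: cov_form_le.
have := srC m; rewrite /W; nra.
Qed.

(** The pointwise bound on [G] turns the recursion into an estimate of the moment of order [2p + 2]
    by the absolute moment of order [2p + 1] and the moment of order [2p]; the intermediate one is
    then interpolated. *)
Lemma even_moment_bound p : exists D, forall m, E (fun w => W m w ^+ (p.*2)) <= D.
Proof.
elim: p => [|p [D hD]].
  by exists 1 => m; rewrite mean_cst.
have [D1 hD1] := cvgn_norm_ub bias; have [D2 hD2] := cvgn_norm_ub sr0.
have D1_0 : 0 <= D1 by apply: le_trans (hD1 0%N).
have D2_0 : 0 <= D2 by apply: le_trans (hD2 0%N).
pose q := 2 * (p.*2.+1)%:R : R; have q0 : 0 <= q by rewrite mulr_ge0.
pose K := D1 + q * D2; have K0 : 0 <= K by rewrite addr_ge0// mulr_ge0.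
exists ((K ^+ 2 + 2 * q * `|C|) * D) => m.
set e0 := E (fun w => W m w ^+ p.*2) in hD *.
set e2 := E (fun w => W m w ^+ p.+1.*2).
have mk k := has_momentsX k (mW m).
have e00 : 0 <= e0.
  by apply: mean_ge0 => w; rewrite -muln2 exprM sqr_ge0.
pose e1 := E (fun w => `|W m w| ^+ p.*2.+1).
have me1 : has_moments P (fun w => `|W m w| ^+ p.*2.+1).
  by apply: has_momentsX; exact: has_moments_norm.
(* From [(|W m| - K) ^+ 2 >= 0]: the odd absolute moment costs half of [e2], which the left-hand
   side of [h2] can absorb. *)
have h1 : K * e1 <= e2 / 2 + K ^+ 2 / 2 * e0.
  rewrite /e1 /e2 /e0 mulrC -(meanZ _ (mk _)) -(mulrC K) -(meanZ _ me1).
  rewrite (_ : _ / 2 = 2^-1 * E (fun w => W m w ^+ p.+1.*2)); last by rewrite mulrC.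
  rewrite -(meanZ _ (mk _)) -meanD; [|exact: has_momentsZ|exact: has_momentsZ].
  apply: le_mean; [exact: has_momentsZ|by apply: has_momentsD; exact: has_momentsZ|move=> w].
  rewrite exprS -!mul2n !exprM -(real_normK (num_real (W m w))).
  set z := `|W m w|; have z0 : 0 <= z by exact: normr_ge0.
  have zp : 0 <= (z ^+ 2) ^+ p by rewrite exprn_ge0// sqr_ge0.
  have := mulr_ge0 zp (sqr_ge0 (z - K)).
  rewrite sqrrB -[_ *+ 2]mulr_natl (exprSr (z ^+ 2)).
  move: zp; set y := (z ^+ 2) ^+ p => zp h; lra.
have h2 : e2 <= (`|b m| + q * (s m * r m)) * e1 + q * `|C| * e0.
  rewrite /e2 doubleS recW -/q.
  have -> : p.*2.+1.-1 = p.*2 by [].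
  have hb : b m * E (fun w => W m w ^+ p.*2.+1) <= `|b m| * e1.
    apply: le_trans (ler_norm _) _; rewrite normrM ler_wpM2l//.
    apply: le_trans (le_norm_mean (mk _)) _.
    by apply: le_mean => [||w]; [exact: has_moments_norm|exact: me1|rewrite normrX].
  have hg : E (fun w => G m w * W m w ^+ p.*2) <= s m * r m * e1 + `|C| * e0.
    rewrite /e1 /e0 -(meanZ _ me1) -(meanZ _ (mk _)) -meanD; [|exact: has_momentsZ|exact: has_momentsZ].
    apply: le_mean; [exact: has_momentsM|by apply: has_momentsD; exact: has_momentsZ|move=> w].
    rewrite exprS -!mul2n !exprM (real_normK (num_real (W m w))).
    have zp : 0 <= (W m w ^+ 2) ^+ p by rewrite exprn_ge0// sqr_ge0.
    rewrite mulrA -mulrDl ler_wpM2r//; apply: le_trans (G_le m w) _.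
    by apply: lerD; [rewrite ler_wpM2l ?mulr_ge0// ler_norm|exact: ler_norm].
  have := ler_wpM2l q0 hg; lra.
have e10 : 0 <= e1 by apply: mean_ge0 => w; rewrite exprn_ge0.
have hK : (`|b m| + q * (s m * r m)) * e1 <= K * e1.
  rewrite ler_wpM2r// lerD ?hD1// ler_wpM2l//.
  by apply: le_trans (hD2 m); exact: ler_norm.
have hE : e2 <= (K ^+ 2 + 2 * q * `|C|) * e0 by lra.
apply: le_trans hE _; rewrite ler_wpM2l// ?hD//.
by rewrite addr_ge0 ?sqr_ge0// !mulr_ge0.
Qed.

(** In the recursion [G m] is replaced by its mean. The error [D m] is controlled by Cauchy-Schwarz:
    the variance of [G m] is at most [(s m * r m) ^+ 2] times a convergent factor, and the even
    moments of [W m] are bounded. The bias term vanishes, and strong induction on the order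
    identifies the limit. *)
Lemma moments_cvg (mu : nat -> R) : mu 0%N = 1 ->
  (forall p, mu p.+1 = p%:R * v * mu p.-1) ->
  forall p, E (fun w => W m w ^+ p) @[m --> \oo] --> mu p.
Proof.
move=> mu0 muS; elim/ltn_ind => -[|p] IH.
  rewrite mu0; apply: cvg_near_cst; apply: nearW => m.
  by rewrite -[RHS](mean_cst P); apply: eq_Rintegral => w _; rewrite expr0.
have mk m k := has_momentsX k (mW m).
pose S m := \sum_i \sum_j cov P (@X m) i j ^+ 2.
have EG m : E (G m) = s m ^+ 2 * S m.
  by rewrite meanZ ?(mean_cov_form GL (@LX m))//; exact: (has_moments_cov_form GL (@LX m)).
have mGE m : has_moments P (fun w => G m w - E (G m)).
  by apply: has_momentsB => //; exact: has_moments_cst.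
pose D m := E (fun w => (G m w - E (G m)) * W m w ^+ p.-1).
have D0 : D m @[m --> \oo] --> 0.
  have [B hB] := even_moment_bound p.-1.
  have varG m : E (fun w => (G m w - E (G m)) ^+ 2) <= (s m * r m) ^+ 2 * (2 * s m ^+ 2 * S m).
    have -> : E (fun w => (G m w - E (G m)) ^+ 2) = E (fun w => G m w ^+ 2) - E (G m) ^+ 2.
      transitivity (E (fun w => G m w ^+ 2 - 2 * E (G m) * G m w + E (G m) ^+ 2)).
        by apply: eq_Rintegral => w _; ring.
      have m1 := has_momentsX 2 (mG m); have m2 := has_momentsZ (2 * E (G m)) (mG m).
      rewrite (meanD (has_momentsB m1 m2) (has_moments_cst P _)) (meanB m1 m2) meanZ// mean_cst.
      by ring.
    have -> : E (fun w => G m w ^+ 2) = s m ^+ 4 * E (fun w => cov_form P (@X m) w ^+ 2).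
      rewrite -meanZ; last by apply: has_momentsX; exact: (has_moments_cov_form GL (@LX m)).
      by apply: eq_Rintegral => w _; rewrite /G; ring.
    rewrite EG (mean_cov_form2 GL (@LX m)) -/(S m).
    have := cov2_le (r0 m) (@rowsum m); rewrite -/(S m).
    set S2 := \sum_i \sum_j cov2 _ _ _ _ ^+ 2 => h.
    have s4 : 0 <= s m ^+ 4 by rewrite exprn_ge0.
    have := ler_wpM2l s4 h; rewrite !exprS expr0; lra.
  have D2 m : D m ^+ 2 <= (s m * r m) ^+ 2 * (2 * s m ^+ 2 * S m) * B.
    apply: le_trans (mean_CauchySchwarz (mGE m) (mk m p.-1)) _.
    apply: ler_pM => //; [by apply: mean_ge0 => w; exact: sqr_ge0|by apply: mean_ge0 => w; exact: sqr_ge0|].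
    apply: le_trans (hB m); rewrite le_eqVlt; apply/orP; left; apply/eqP.
    by apply: eq_Rintegral => w _; rewrite -exprM muln2.
  have l0 : (s m * r m) ^+ 2 * (2 * s m ^+ 2 * S m) * B @[m --> \oo] --> 0.
    rewrite (_ : 0 = (0 * 0) * v * B); last by rewrite !mul0r.
    apply: cvgM; last exact: cvg_cst.
    by apply: cvgM; [exact: cvgM|exact: var].
  have d2 : D m ^+ 2 @[m --> \oo] --> 0.
    apply: (squeeze_cvgr _ (cvg_cst 0) l0).
    by apply: nearW => m; rewrite sqr_ge0 D2.
  have := @cvg_comp _ _ _ (fun m => D m ^+ 2) Num.sqrt _ _ _ d2 (@sqrt_continuous R 0).
  rewrite sqrtr0 => h; apply: norm_cvg0.
  by apply: cvg_trans h; apply: near_eq_cvg; apply: nearW => m /=; rewrite sqrtr_sqr.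
have -> : mu p.+1 = 0 * mu p + p%:R * (v * mu p.-1 + 2 * 0) by rewrite muS; ring.
have -> : (fun m => E (fun w => W m w ^+ p.+1)) = (fun m => b m * E (fun w => W m w ^+ p) +
   p%:R * (2 * s m ^+ 2 * S m * E (fun w => W m w ^+ p.-1) + 2 * D m)).
  apply/funext => m; rewrite recW; congr (_ + _).
  have -> : E (fun w => G m w * W m w ^+ p.-1) = D m + E (G m) * E (fun w => W m w ^+ p.-1).
    rewrite -meanZ// -meanD; first by apply: eq_Rintegral => w _; ring.
      exact: has_momentsM.
    exact: has_momentsZ.
  by rewrite EG; ring.
apply: cvgD; first by apply: cvgM; [exact: bias|exact: IH].
apply: cvgM; first exact: cvg_cst.
apply: cvgD; last by apply: cvgM => //; exact: cvg_cst.
apply: cvgM; first exact: var.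
by case: p IH {D D0} => [|p] IH; apply: IH.
Qed.

End moment_convergence.

(** * Convergence in law from convergence of moments *)

(** Only [x] is confined to the segment; [y] may leave it. The Slutsky argument needs this, since
    there only one of the two variables is known to be bounded. *)
Lemma segment_unif_continuous {R : realType} (a b : R) (g : R -> R) (e : R) :
  continuous g -> 0 < e -> exists2 dlt : R, 0 < dlt &
    forall x y, a <= x <= b -> `|x - y| < dlt -> `|g x - g y| < e.
Proof.
move=> cg e0.
have /compact_near_coveringP cov := @segment_compact R a b.
have := cov R (0^'+) (fun dl x => forall y, `|x - y| < dl -> `|g x - g y| < e) _ _.
case.
  move=> x _; have e2 : 0 < e / 2 by rewrite divr_gt0.
  have /cvgrPdist_lt /(_ _ e2) /nbhs_ballP[eta /= eta0 hb] := cg x.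
  have eta2 : 0 < eta / 2 by rewrite divr_gt0.
  exists (ball x (eta / 2), [set dl | 0 < dl < eta / 2]) => /=.
    split; first exact: nbhsx_ballx.
    near=> dl; apply/andP; split; near: dl; [exact: nbhs_right_gt|exact: nbhs_right_lt].
  move=> [x' dl] [/= xx' /andP[dl0 dle]] y yx'.
  have h1 : `|g x - g x'| < e / 2.
    by apply: hb; apply: lt_le_trans xx' _; lra.
  have h2 : `|g x - g y| < e / 2.
    apply: hb; rewrite /ball/=; move: xx'; rewrite /ball/= => xx'.
    have -> : x - y = (x - x') + (x' - y) by ring.
    by apply: le_lt_trans (ler_normD _ _) _; lra.
  have -> : g x' - g y = (g x - g y) - (g x - g x') by ring.
  by apply: le_lt_trans (ler_normB _ _) _; lra.
move=> eta /= eta0 h.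
exists (eta / 2); first by rewrite divr_gt0.
move=> x y /andP[x0 x1] xy; apply: (h (eta / 2)) => //.
- by rewrite /ball_/= sub0r normrN gtr0_norm ?divr_gt0// ltr_pdivrMr// ltr_pMr// ltr1n.
- by rewrite divr_gt0.
- by rewrite /= in_itv/= x0 x1.
Unshelve. all: by end_near. Qed.

(* The Bernstein operator, defined through Pascal's rule. *)
Fixpoint bernstein {R : comNzRingType} n (f : nat -> R) : {poly R} :=
  if n is n'.+1 then
    'X * bernstein n' (fun k => f k.+1) + (1 - 'X) * bernstein n' f
  else (f 0%N)%:P.

Section bernstein.
Context {R : realFieldType}.

Lemma hornerBS n (f : nat -> R) x : (bernstein n.+1 f).[x] =
  x * (bernstein n (fun k => f k.+1)).[x] + (1 - x) * (bernstein n f).[x].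
Proof. by rewrite /= !hornerE. Qed.

Lemma le_bernstein n (f g : nat -> R) x : 0 <= x <= 1 ->
  (forall k, (k <= n)%N -> f k <= g k) -> (bernstein n f).[x] <= (bernstein n g).[x].
Proof.
move=> /andP[x0 x1]; elim: n f g => [|n IH] f g fg; first by rewrite /= !hornerC fg.
rewrite !hornerBS lerD// ler_wpM2l// ?subr_ge0//; apply: IH => k kn; first exact: fg.
by apply: fg; exact: leqW.
Qed.

Lemma bernsteinD n (f g : nat -> R) (a b : R) x :
  (bernstein n (fun k => a * f k + b * g k)).[x] = a * (bernstein n f).[x] + b * (bernstein n g).[x].
Proof. by elim: n f g => [|n IH] f g; rewrite ?hornerBS ?IH /= ?hornerC//; ring. Qed.

Lemma bernstein_cst n (c x : R) : (bernstein n (fun=> c)).[x] = c.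
Proof. by elim: n => [|n IH]; rewrite ?hornerBS ?IH /= ?hornerC//; ring. Qed.

(** The second moment about [a] of the binomial law with parameters [n] and [x]. The point [a] stays
    free because the shift of the argument in Pascal's rule moves it to [a - 1]. *)
Lemma bernstein_var n (x a : R) :
  (bernstein n (fun k => (k%:R - a) ^+ 2)).[x] = n%:R * x * (1 - x) + (n%:R * x - a) ^+ 2.
Proof.
elim: n a => [|n IH] a; first by rewrite /= hornerC; ring.
rewrite hornerBS IH.
rewrite [X in x * X](_ : _ = (bernstein n (fun k => (k%:R - (a - 1)) ^+ 2)).[x]).
  by rewrite IH -natr1; ring.
congr (_.[x]); congr bernstein; apply/funext => k; rewrite -natr1; ring.
Qed.

End bernstein.

(** Bernstein's proof: uniform continuity and boundedness give
    [|g x - g y| <= e / 2 + K * (x - y) ^+ 2]; the positive operator [bernstein] preserves this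
    inequality, and the binomial variance makes the quadratic term of order [1 / n]. *)
Lemma polynomial_approximation {R : realType} (g : R -> R) (e : R) :
  continuous g -> 0 < e ->
  exists p : {poly R}, forall x, 0 <= x <= 1 -> `|g x - p.[x]| <= e.
Proof.
move=> cg e0; have e2 : 0 < e / 2 by rewrite divr_gt0.
have [dl dl0 hd] := segment_unif_continuous 0 1 cg e2.
have [M hM] : exists M, forall x, 0 <= x <= 1 -> `|g x| <= M.
  have cn : {within `[0, 1], continuous (fun x => `|g x|)}.
    by apply: continuous_subspaceT => x; apply: continuous_comp; [exact: cg|exact: norm_continuous].
  have [c _ hc] := EVT_max ler01 cn.
  by exists `|g c| => x x01; apply: hc; rewrite in_itv.
have M0 : 0 <= M by apply: le_trans (hM 0 _); rewrite ?normr_ge0// lexx ler01.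
pose K := 2 * M / dl ^+ 2; have K0 : 0 <= K by apply: divr_ge0; [exact: mulr_ge0|exact: sqr_ge0].
have gK x y : 0 <= x <= 1 -> 0 <= y <= 1 -> `|g x - g y| <= e / 2 + K * (x - y) ^+ 2.
  move=> x01 y01; have [xy|xy] := ltP `|x - y| dl.
    apply: ltW; apply: lt_le_trans (hd _ _ x01 xy) _.
    by rewrite lerDl; apply: mulr_ge0 => //; exact: sqr_ge0.
  apply: (@le_trans _ _ (2 * M)).
    by apply: le_trans (ler_normB _ _) _; have := hM _ x01; have := hM _ y01; lra.
  apply: (@le_trans _ _ (K * (x - y) ^+ 2)); last by rewrite lerDr ltW.
  rewrite /K -mulrA ler_peMr ?mulr_ge0// mulrC ler_pdivlMr ?exprn_gt0// mul1r.
  by rewrite -(real_normK (num_real (x - y))) ler_sqr ?nnegrE// ltW.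
pose n := (Num.bound (2 * K / e)).+1.
have n0 : (0 : R) < n%:R by rewrite ltr0n.
have hn : K <= e / 2 * n%:R.
  have := archi_boundP (divr_ge0 (mulr_ge0 (ler0n R 2) K0) (ltW e0)).
  by rewrite ltr_pdivrMr// /n -[(Num.bound _).+1%:R]natr1; lra.
exists (bernstein n (fun k => g (k%:R / n%:R))) => x x01.
have hk k : (k <= n)%N -> 0 <= (k%:R / n%:R : R) <= 1.
  by move=> kn; rewrite divr_ge0//= ler_pdivrMr// mul1r ler_nat.
have hb : K / n%:R ^+ 2 * (bernstein n (fun k => (k%:R - n%:R * x) ^+ 2)).[x] <= e / 2.
  rewrite bernstein_var subrr expr0n addr0.
  have -> : K / n%:R ^+ 2 * (n%:R * x * (1 - x)) = K * (x * (1 - x)) / n%:R by field; rewrite gt_eqF.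
  rewrite ler_pdivrMr//; apply: le_trans hn; rewrite ler_piMr//.
  case/andP: x01 => *; nra.
rewrite ler_norml; apply/andP; split.
  have := @le_bernstein _ n (fun k => g (k%:R / n%:R)) (fun k => 1 * (g x + e / 2) + K / n%:R ^+ 2 * (k%:R - n%:R * x) ^+ 2) x x01 _.
  rewrite bernsteinD bernstein_cst => /(_ _)/wrap[].
    move=> k kn; have := gK _ _ x01 (hk _ kn); rewrite ler_norml => /andP[h _].
    have -> : K / n%:R ^+ 2 * (k%:R - n%:R * x) ^+ 2 = K * (x - k%:R / n%:R) ^+ 2 by field; rewrite gt_eqF.
    lra.
  lra.
have := @le_bernstein _ n (fun k => 1 * (g x - e / 2) + (- K / n%:R ^+ 2) * (k%:R - n%:R * x) ^+ 2) (fun k => g (k%:R / n%:R)) x x01 _.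
rewrite bernsteinD bernstein_cst => /(_ _)/wrap[].
  move=> k kn; have := gK _ _ x01 (hk _ kn); rewrite ler_norml => /andP[_ h].
  have -> : - K / n%:R ^+ 2 * (k%:R - n%:R * x) ^+ 2 = - (K * (x - k%:R / n%:R) ^+ 2) by field; rewrite gt_eqF.
  lra.
lra.
Qed.

(** For [x >= 0] the mean value theorem applies to the power minus the function, whose derivative is
    nonnegative. Replacing the function by its opposite gives the lower bound, and reflecting the
    argument gives negative [x]. *)
Lemma norm_le_pow_of_derive {R : realType} (g dg : R -> R) n :
  (forall x : R, is_derive x 1 g (dg x)) -> g 0 = 0 ->
  (forall x, `|dg x| <= `|x| ^+ n / n`!%:R) ->
  forall x, `|g x| <= `|x| ^+ n.+1 / n.+1`!%:R.
Proof.
move=> dgP g0 hdg.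
have pos (h dh : R -> R) : (forall x : R, is_derive x 1 h (dh x)) -> h 0 = 0 ->
    (forall x, `|dh x| <= `|x| ^+ n / n`!%:R) ->
    forall x, 0 <= x -> h x <= x ^+ n.+1 / n.+1`!%:R.
  move=> dhP h0 hdh x x0.
  pose k y := n.+1`!%:R^-1 * y ^+ n.+1 - h y.
  have dk (y : R) : is_derive y 1 k (y ^+ n / n`!%:R - dh y).
    have dX : is_derive y 1 (fun y : R => y ^+ n.+1) (n.+1%:R * y ^+ n).
      by have := is_deriveX n.+1 (is_derive_id y 1); rewrite exprfctE /GRing.scale/= mulr1.
    apply: (is_derive_eq (is_deriveB (is_deriveZ (n.+1`!%:R^-1) dX) (dhP y))).
    rewrite /GRing.scale/= factS natrM; congr (_ - _); field.
    by rewrite addrC natr1 !pnatr_eq0 -lt0n fact_gt0.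
  have [->|xn0] := eqVneq x 0; first by rewrite h0 expr0n mul0r.
  have xp : 0 < x by rewrite lt_neqAle eq_sym xn0.
  have ck : {within `[0, x], continuous k}.
    by apply: derivable_within_continuous => y _; case: (dk y).
  have [c + hc] := MVT xp (fun y _ => dk y) ck.
  rewrite in_itv/= => /andP[c0 cx].
  have : 0 <= k x - k 0.
    rewrite hc subr0 mulr_ge0// subr_ge0; apply: le_trans (ler_norm _) _.
    by apply: le_trans (hdh c) _; rewrite gtr0_norm.
  by rewrite /k h0 expr0n mulr0 subrr subr0 subr_ge0 mulrC.
have pos2 (h dh : R -> R) : (forall x : R, is_derive x 1 h (dh x)) -> h 0 = 0 ->
    (forall x, `|dh x| <= `|x| ^+ n / n`!%:R) ->
    forall x, 0 <= x -> `|h x| <= x ^+ n.+1 / n.+1`!%:R.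
  move=> dhP h0 hdh x x0; rewrite ler_norml (pos h dh)// andbT.
  rewrite lerNl; apply: (pos (fun y => - h y) (fun y => - dh y)) => //.
  - by rewrite h0 oppr0.
  - by move=> y; rewrite normrN.
move=> x; have [x0|x0] := leP 0 x; first by rewrite (ger0_norm x0); exact: pos2 x0.
rewrite -[x]opprK normrN [`|- x|]gtr0_norm ?oppr_gt0//.
apply: (pos2 (fun y => g (- y)) (fun y => - dg (- y))).
- move=> y; have := is_derive1_comp (dgP (- y)) (is_deriveNid y 1).
  by rewrite mulrN1.
- by rewrite oppr0.
- by move=> y; rewrite normrN -[`|y|]normrN.
- by rewrite oppr_ge0 ltW.
Qed.

(** The free phase makes the induction work: differentiating the cosine adds [pi / 2] to [phi], so
    the derivative of the remainder is the remainder of the previous order with another phase. *)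
Lemma cos_taylor {R : realType} n (phi x : R) :
  `|cos (x + phi) - \sum_(k < n) cos (phi + k%:R * (pi / 2)) / k`!%:R * x ^+ k|
    <= `|x| ^+ n / n`!%:R.
Proof.
elim: n phi x => [|n IH] phi.
  by move=> x; rewrite big_ord0 subr0 expr0 fact0 divr1 ler_norml cos_geN1 cos_le1.
pose c k : R := cos (phi + k%:R * (pi / 2)) / k`!%:R.
pose p : {poly R} := \poly_(k < n.+1) c k.
have pE x : \sum_(k < n.+1) c k * x ^+ k = p.[x] by rewrite horner_poly.
pose dg x := - sin (x + phi) - p^`().[x].
have dgE x : dg x = cos (x + (phi + pi / 2)) -
    \sum_(k < n) cos (phi + pi / 2 + k%:R * (pi / 2)) / k`!%:R * x ^+ k.
  rewrite /dg addrA cosDpihalf; congr (_ - _).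
  rewrite (horner_coef_wide _ (n := n)); last first.
    by apply/leq_sizeP => j nj; rewrite coef_deriv coef_poly ltnS ltnNge nj mul0rn.
  apply: eq_bigr => k _; rewrite coef_deriv coef_poly ltnS ltn_ord; congr (_ * _).
  rewrite -[LHS]mulr_natl /c factS natrM.
  have -> : phi + k.+1%:R * (pi / 2) = phi + pi / 2 + k%:R * (pi / 2) by rewrite -natr1; ring.
  by field; rewrite [1 + _]addrC natr1 !pnatr_eq0 -lt0n fact_gt0.
suff h x : `|cos (x + phi) - p.[x]| <= `|x| ^+ n.+1 / n.+1`!%:R.
  by move=> x; have := h x; rewrite -pE.
move: x; apply: (@norm_le_pow_of_derive _ (fun x => cos (x + phi) - p.[x]) dg).
- move=> x; apply: is_deriveB.
  have := @is_derive1_comp R cos (fun y => y + phi) x _ _ (is_derive_cos _) (is_deriveD (is_derive_id x 1) (is_derive_cst phi x 1)).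
  by rewrite addr0 mulr1.
- rewrite add0r -pE big_ord_recl big1 ?addr0 => [|k _]; last by rewrite expr0n mulr0.
  by rewrite /c fact0 mul0r addr0 divr1 expr0 mulr1 subrr.
- by move=> x; rewrite dgE; exact: IH.
Qed.

Lemma cvgn_bigsum {R : realType} I (s : seq I) (A : pred I) (F : I -> nat -> R) (l : I -> R) :
  (forall i, A i -> F i m @[m --> \oo] --> l i) ->
  \sum_(i <- s | A i) F i m @[m --> \oo] --> \sum_(i <- s | A i) l i.
Proof.
move=> Fl; elim: s => [|i s IH].
  rewrite big_nil; apply: cvg_near_cst; apply: nearW => m; exact: big_nil.
rewrite big_cons; under eq_fun do rewrite big_cons.
by case: (A i) (Fl i) => [/(_ isT) h|_] //; exact: cvgD.
Qed.

Section trigonometric_means.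
Context {d} {T : measurableType d} {R : realType} (P : probability T R).
Local Notation E f := (Rintegral P setT f).

Lemma has_moments_bounded (f : T -> R) (c : R) : measurable_fun setT f ->
  (forall w, `|f w| <= c) -> has_moments P f.
Proof.
move=> mf fc; apply: (has_moments_le (c := c) mf (has_moments_cst P 0)) => w.
by rewrite normr0 addr0.
Qed.

Lemma measurable_cos_affine (Y : T -> R) t phi : measurable_fun setT Y ->
  measurable_fun setT (fun w => cos (t * Y w + phi)).
Proof.
move=> mY; apply: measurableT_comp; first by apply: continuous_measurable_fun; exact: continuous_cos.
by apply: measurable_funD => //; exact: measurable_funM.
Qed.

Lemma measurable_sin_scale (Y : T -> R) t : measurable_fun setT Y ->
  measurable_fun setT (fun w => sin (t * Y w)).
Proof.
move=> mY; apply: measurableT_comp; first by apply: continuous_measurable_fun; exact: continuous_sin.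
exact: measurable_funM.
Qed.

(** The order is even so that the remainder is bounded by an ordinary moment rather than by an
    absolute one. *)
Lemma mean_cos_taylor (Y : T -> R) t phi n : has_moments P Y ->
  `|E (fun w => cos (t * Y w + phi)) -
    \sum_(k < n.*2) cos (phi + k%:R * (pi / 2)) / k`!%:R * t ^+ k * E (fun w => Y w ^+ k)|
  <= t ^+ n.*2 / n.*2`!%:R * E (fun w => Y w ^+ n.*2).
Proof.
move=> mY; have mk k := has_momentsX k mY.
have mc : has_moments P (fun w => cos (t * Y w + phi)).
  apply: (@has_moments_bounded _ 1); first by apply: measurable_cos_affine; case: mY.
  by move=> w; rewrite ler_norml cos_geN1 cos_le1.
pose a (k : 'I_n.*2) : R := cos (phi + k%:R * (pi / 2)) / k`!%:R * t ^+ k.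
have ms : has_moments P (fun w => \sum_(k < n.*2) a k * Y w ^+ k).
  by apply: has_moments_sum => k _; exact: has_momentsZ.
have -> : \sum_(k < n.*2) cos (phi + k%:R * (pi / 2)) / k`!%:R * t ^+ k * E (fun w => Y w ^+ k) =
    E (fun w => \sum_(k < n.*2) a k * Y w ^+ k).
  rewrite mean_sum; last by move=> k _; exact: has_momentsZ.
  by apply: eq_bigr => k _; rewrite meanZ.
rewrite -meanB// -meanZ//.
apply: le_trans (le_norm_mean (has_momentsB mc ms)) _.
apply: le_mean; [exact/has_moments_norm/has_momentsB|exact: has_momentsZ|move=> w].
have := cos_taylor n.*2 phi (t * Y w).
rewrite (_ : `|t * Y w| ^+ n.*2 = t ^+ n.*2 * Y w ^+ n.*2); last first.
  by rewrite -exprMn -!mul2n !exprM real_normK// num_real.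
rewrite mulrAC => h.
have -> : \sum_(k < n.*2) a k * Y w ^+ k =
    \sum_(k < n.*2) cos (phi + k%:R * (pi / 2)) / k`!%:R * (t * Y w) ^+ k.
  by apply: eq_bigr => k _; rewrite /a exprMn [RHS]mulrA.
exact: h.
Qed.

End trigonometric_means.

Section weak_convergence_from_moments.
Context {d} {T : measurableType d} {R : realType} (P : probability T R).
Variables (nu : probability (measurableTypeR R) R) (W : nat -> T -> R).
Local Notation E f := (Rintegral P setT f).
Hypothesis mW : forall m, has_moments P (W m).
Hypothesis mnu : has_moments nu (fun x => x).
Hypothesis cvgW : forall p, E (fun w => W m w ^+ p) @[m --> \oo] --> \int[nu]_x x ^+ p.
Hypothesis growth : forall t : R,
  t ^+ n.*2 / n.*2`!%:R * (\int[nu]_x x ^+ n.*2) @[n --> \oo] --> 0.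

(** The order [n] is fixed by [growth], which makes the Taylor remainder small for [nu]. The
    remainder for [W m] is governed by a moment that converges to that of [nu], so it is eventually
    small too. *)
Lemma cvg_mean_cos t phi :
  E (fun w => cos (t * W m w + phi)) @[m --> \oo] --> \int[nu]_x cos (t * x + phi).
Proof.
apply/cvgrPdist_lt => e e0; have e4 : 0 < e / 4 by rewrite divr_gt0.
have /cvgrPdist_lt /(_ _ e4) [n _ /(_ n (leqnn n))] := growth t.
rewrite sub0r normrN => hn.
pose S (M : nat -> R) := \sum_(k < n.*2) cos (phi + k%:R * (pi / 2)) / k`!%:R * t ^+ k * M k.
have cS : S (fun k => E (fun w => W m w ^+ k)) @[m --> \oo] --> S (fun k => \int[nu]_x x ^+ k).
  apply: cvgn_bigsum => k _; apply: cvgM; [exact: cvg_cst|exact: cvgW].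
have cT : t ^+ n.*2 / n.*2`!%:R * E (fun w => W m w ^+ n.*2) @[m --> \oo] -->
    t ^+ n.*2 / n.*2`!%:R * (\int[nu]_x x ^+ n.*2).
  by apply: cvgM; [exact: cvg_cst|exact: cvgW].
have h1 := mean_cos_taylor t phi n mnu.
move/cvgrPdist_lt : cS => /(_ _ e4); move/cvgrPdist_lt : cT => /(_ _ e4).
apply: filterS2 => m h2 h3.
have h4 := mean_cos_taylor t phi n (mW m).
move: h3 h1 h4; rewrite -/(S (fun k => \int[nu]_x x ^+ k)) -/(S (fun k => E (fun w => W m w ^+ k))).
move: hn h2; set A := S _; set B := S _; set a := Rintegral nu _ (fun x => cos _); set b := E (fun w => cos _).
set u := _ * \int[nu]_x x ^+ n.*2; set v := _ * E _ => hn h2 h3 h1 h4.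
have := ler_norm u; have := ler_normB v u => hh hu.
have hv : v < e / 2.
  have : `|v| <= `|v - u| + `|u| by rewrite -{1}(subrK u v); exact: ler_normD.
  have := ler_norm v; rewrite distrC in h2; lra.
have -> : a - b = (a - A) + (A - B) + (B - b) by ring.
apply: le_lt_trans (ler_normD _ _) _; apply: le_lt_trans (_ : `|a - A| + `|A - B| + `|B - b| < _).
  by rewrite lerD2r; exact: ler_normD.
rewrite [`|B - b|]distrC; lra.
Qed.

(** Each factor [sin] is removed by the product-to-sum formula, the resulting sines being written as
    cosines with phase shifted by [- pi / 2]; the induction ends at [cvg_mean_cos]. *)
Lemma cvg_mean_sinX_cos (s t phi : R) k :
  E (fun w => sin (s * W m w) ^+ k * cos (t * W m w + phi)) @[m --> \oo] -->
  \int[nu]_x (sin (s * x) ^+ k * cos (t * x + phi)).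
Proof.
have mS d' (T' : measurableType d') (Q : probability T' R) (Y : T' -> R) j a b : has_moments Q Y ->
    has_moments Q (fun w => sin (s * Y w) ^+ j * cos (a * Y w + b)).
  move=> [mY _]; apply: has_momentsM.
    apply: has_momentsX; apply: (@has_moments_bounded _ _ _ _ _ 1).
      exact: measurable_sin_scale.
    by move=> w; rewrite ler_norml sin_geN1 sin_le1.
  apply: (@has_moments_bounded _ _ _ _ _ 1); first exact: measurable_cos_affine.
  by move=> w; rewrite ler_norml cos_geN1 cos_le1.
have rec d' (T' : measurableType d') (Q : probability T' R) (Y : T' -> R) j a b : has_moments Q Y ->
    \int[Q]_w (sin (s * Y w) ^+ j.+1 * cos (a * Y w + b)) =
    2^-1 * (\int[Q]_w (sin (s * Y w) ^+ j * cos ((a + s) * Y w + (b - pi / 2))) -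
            \int[Q]_w (sin (s * Y w) ^+ j * cos ((a - s) * Y w + (b - pi / 2)))).
  move=> mY; rewrite -meanB; [|exact: mS|exact: mS].
  rewrite -meanZ; last by apply: has_momentsB; exact: mS.
  apply: eq_Rintegral => w _.

  rewrite !addrA !cosBpihalf exprS.
  rewrite (_ : (a + s) * Y w + b = (a * Y w + b) + s * Y w); last by ring.
  rewrite (_ : (a - s) * Y w + b = (a * Y w + b) - s * Y w); last by ring.
  rewrite sinD sinB. by field.
elim: k t phi => [|k IH] t phi.
  have e d' (T' : measurableType d') (Q : probability T' R) (Y : T' -> R) :
      \int[Q]_w (sin (s * Y w) ^+ 0 * cos (t * Y w + phi)) = \int[Q]_w cos (t * Y w + phi).
    by apply: eq_Rintegral => w _; rewrite expr0 mul1r.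
  rewrite (e _ _ nu (fun x => x)); under eq_fun do rewrite e.
  exact: cvg_mean_cos.
rewrite (rec _ _ nu (fun x => x))//.
under eq_fun do rewrite rec//.
by apply: cvgM; [exact: cvg_cst|apply: cvgB; exact: IH].
Qed.

Lemma cvg_mean_poly_sin (s : R) (p : {poly R}) :
  E (fun w => p.[(1 + sin (s * W m w)) / 2]) @[m --> \oo] --> \int[nu]_x p.[(1 + sin (s * x)) / 2].
Proof.
pose q := p \Po (2^-1 *: (1 + 'X)).
have qE x : p.[(1 + sin (s * x)) / 2] = \sum_(k < size q) q`_k * sin (s * x) ^+ k.
  by rewrite -horner_coef horner_comp !hornerE mulrC.
have mS d' (T' : measurableType d') (Q : probability T' R) (Y : T' -> R) j : has_moments Q Y ->
    has_moments Q (fun w => sin (s * Y w) ^+ j).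
  move=> [mY _]; apply: has_momentsX; apply: (@has_moments_bounded _ _ _ _ _ 1).
    exact: measurable_sin_scale.
  by move=> w; rewrite ler_norml sin_geN1 sin_le1.
have e d' (T' : measurableType d') (Q : probability T' R) (Y : T' -> R) : has_moments Q Y ->
    \int[Q]_w p.[(1 + sin (s * Y w)) / 2] = \sum_(k < size q) q`_k * \int[Q]_w (sin (s * Y w) ^+ k).
  move=> mY; transitivity (\int[Q]_w \sum_(k < size q) q`_k * sin (s * Y w) ^+ k).
    by apply: eq_Rintegral => w _; rewrite qE.
  rewrite mean_sum; last by move=> k _; apply: has_momentsZ; exact: mS.
  by apply: eq_bigr => k _; rewrite meanZ//; exact: mS.
rewrite (e _ _ nu (fun x => x))//.
under eq_fun do rewrite e//.
apply: cvgn_bigsum => k _; apply: cvgM; first exact: cvg_cst.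
have := @cvg_mean_sinX_cos s 0 0 k.
have h d' (T' : measurableType d') (Q : probability T' R) (Y : T' -> R) :
    \int[Q]_w (sin (s * Y w) ^+ k * cos (0 * Y w + 0)) = \int[Q]_w (sin (s * Y w) ^+ k).
  by apply: eq_Rintegral => w _; rewrite mul0r addr0 cos0 mulr1.
by rewrite (h _ _ nu (fun x => x)); under eq_fun do rewrite h.
Qed.

(** On [[-L, L]] the function [f] is a continuous function of [sin (x / L)], as the sine is
    injective on [[-1, 1]]; a polynomial [p] approximates it uniformly. Outside, the error is at
    most [2 * M] up to [e5], and the bounded second moments make the contribution small. *)
Lemma weak_cvg_of_moments (f : R -> R) : continuous f ->
  (exists M, forall y, `|f y| <= M) ->
  E (fun w => f (W m w)) @[m --> \oo] --> \int[nu]_x f x.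
Proof.
move=> cf [M hM]; have M0 : 0 <= M by apply: le_trans (hM 0).
have [K0 hK0] := cvgn_norm_ub (@cvgW 2).
pose K := K0 + \int[nu]_x x ^+ 2.
have K00 : 0 <= K0 by apply: le_trans (hK0 0%N).
have n20 : 0 <= \int[nu]_x x ^+ 2 by apply: mean_ge0 => w; exact: sqr_ge0.
(* Five shares: two for replacing [f] by [q] under [nu], two under the law of [W m], and one for the
   convergence of the means of [q]. *)
apply/cvgrPdist_lt => e e0; pose e5 := e / 5.
have e50 : 0 < e5 by rewrite divr_gt0.
(* Chosen so that [2 * M * K / L ^+ 2] is at most [e5]. *)
pose L := 1 + 2 * M * K / e5.
have L1 : 1 <= L by rewrite lerDl divr_ge0 ?mulr_ge0 ?addr_ge0// ltW.
have L0 : 0 < L by apply: lt_le_trans L1.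
pose s1 : R := sin 1.
have pi2 := @pihalf_ge1 R; have p20 : 0 < pi / 2 :> R by apply: lt_le_trans pi2.
have hin (x : R) : `|x| <= 1 -> x \in `[- (pi / 2), pi / 2]%R.
  by rewrite in_itv/= -ler_norml => h; exact: le_trans h pi2.
have s1lt : s1 < 1.
  rewrite -sin_pihalf ltr_sin ?in_itv/= ?lexx ?andbT.
  - rewrite lt_neqAle pi2 andbT; apply/negP => /eqP h.
    by have := @cos1_gt0 R; rewrite h cos_pihalf ltxx.
  - by rewrite pi2 andbT; lra.
  - by rewrite lerNl; lra.
have sin_le (x : R) : `|x| <= 1 -> `|sin x| <= s1.
  move=> x1; have h1 := hin 1; rewrite normr1 lexx in h1.
  have hN1 := hin (- 1); rewrite normrN1 lexx in hN1.
  rewrite ler_norml -sinN !leNgt !ltr_sin ?hin ?normrN1 ?normr1//.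
  by rewrite -!leNgt -ler_norml.
have s10 : 0 <= s1 by apply: le_trans (sin_le 0 _); rewrite ?normr0.
(* Truncation to [[- sin 1, sin 1]], written with absolute values to be visibly continuous. It keeps
   the argument of [asin] strictly inside []-1, 1[], so that [g] is continuous on the whole line. *)
pose clip (z : R) := (`|z + s1| - `|z - s1|) / 2.
pose g y := f (L * asin (clip (2 * y - 1))).
have clip_lt (z : R) : -1 < clip z < 1.
  have h : `|clip z| <= s1.
    rewrite normrM [`|2^-1|]ger0_norm// ler_pdivrMr//.
    apply: le_trans (ler_dist_dist _ _) _.
    have -> : z + s1 - (z - s1) = s1 * 2 by ring.
    by rewrite ger0_norm// mulr_ge0.
  by rewrite -ltr_norml; apply: le_lt_trans h s1lt.
have clip_id (z : R) : `|z| <= s1 -> clip z = z.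
  rewrite ler_norml => /andP[h1 h2]; rewrite /clip ger0_norm; last by lra.
  by rewrite ler0_norm; [field|lra].
have lin : continuous (fun y : R => 2 * y - 1).
  by move=> z; apply: cvgB; [apply: cvgM; [exact: cvg_cst|exact: cvg_id]|exact: cvg_cst].
have cclip : continuous (fun y : R => clip (2 * y - 1)).
  move=> y; apply: cvgM; last exact: cvg_cst.
  apply: cvgB; apply: cvg_norm.
    by apply: cvgD; [exact: lin|exact: cvg_cst].
  by apply: cvgB; [exact: lin|exact: cvg_cst].
have casin : continuous (fun y : R => asin (clip (2 * y - 1))).
  by move=> y; apply: continuous_comp; [exact: cclip|exact: continuous_asin].
have cLasin : continuous (fun y : R => L * asin (clip (2 * y - 1))).
  by move=> y; apply: cvgM; [exact: cvg_cst|exact: casin].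
have cg : continuous g.
  by move=> y; apply: continuous_comp; [exact: cLasin|exact: cf].
have [p hp] := polynomial_approximation cg e50.
pose q x := p.[(1 + sin (L^-1 * x)) / 2].
have hy (x : R) : 0 <= (1 + sin (L^-1 * x)) / 2 <= 1.
  have := sin_le1 (L^-1 * x); have := sin_geN1 (L^-1 * x) => h1 h2.
  by apply/andP; split; lra.
have c0 : 0 <= 2 * M / L ^+ 2 by apply: divr_ge0; [exact: mulr_ge0|exact: sqr_ge0].
have fq (x : R) : `|f x - q x| <= e5 + 2 * M / L ^+ 2 * x ^+ 2.
  have [xL|xL] := leP `|x| L.
    have u1 : `|L^-1 * x| <= 1.
      by rewrite normrM gtr0_norm ?invr_gt0// mulrC ler_pdivrMr// mul1r.
    have gx : g ((1 + sin (L^-1 * x)) / 2) = f x.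
      rewrite /g; congr f.
      have -> : 2 * ((1 + sin (L^-1 * x)) / 2) - 1 = sin (L^-1 * x) by field.
      rewrite clip_id; last exact: sin_le.
      rewrite sinK; last exact: hin.
      by rewrite mulVKf// gt_eqF.
    rewrite -gx; apply: le_trans (hp _ (hy x)) _.
    by rewrite lerDl; apply: mulr_ge0 => //; exact: sqr_ge0.
  have h1 : `|g ((1 + sin (L^-1 * x)) / 2) - q x| <= e5 by exact: hp.
  have h2 : `|f x - q x| <= e5 + 2 * M.
    have -> : f x - q x = f x - g ((1 + sin (L^-1 * x)) / 2) +
       (g ((1 + sin (L^-1 * x)) / 2) - q x) by ring.
    apply: le_trans (ler_normD _ _) _; rewrite addrC lerD//.
    by apply: le_trans (ler_normB _ _) _; rewrite mulr_natl mulr2n lerD// hM.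
  apply: le_trans h2 _; rewrite lerD2l -mulrA ler_peMr ?mulr_ge0//.
  rewrite mulrC ler_pdivlMr ?exprn_gt0// mul1r -(real_normK (num_real x)).
  by rewrite ler_sqr ?nnegrE ?normr_ge0 ?(ltW L0)// ltW.
have mf d' (T' : measurableType d') (Q : probability T' R) (Y : T' -> R) : has_moments Q Y ->
    has_moments Q (fun w => f (Y w)) /\ has_moments Q (fun w => q (Y w)).
  move=> [mY _].
  have mfY : measurable_fun setT (fun w => f (Y w)).
    by apply: measurableT_comp => //; exact: continuous_measurable_fun.
  have mfq : measurable_fun setT (fun w => q (Y w)).
    apply: (measurableT_comp (f := fun x => p.[x])).
      by apply: continuous_measurable_fun; exact: continuous_horner.
    apply: measurable_funM => //; apply: measurable_funD => //.
    exact: measurable_sin_scale.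
  split; first by apply: (@has_moments_bounded _ _ _ _ _ M) => // w; exact: hM.
  apply: (@has_moments_bounded _ _ _ _ _ (M + e5)) => // w.
  have -> : q (Y w) = g ((1 + sin (L^-1 * Y w)) / 2) - (g ((1 + sin (L^-1 * Y w)) / 2) - q (Y w)) by ring.
  by apply: le_trans (ler_normB _ _) _; apply: lerD; [exact: hM|exact: hp].
have bnd d' (T' : measurableType d') (Q : probability T' R) (Y : T' -> R) : has_moments Q Y ->
    \int[Q]_w Y w ^+ 2 <= K ->
    `|\int[Q]_w f (Y w) - \int[Q]_w q (Y w)| <= 2 * e5.
  move=> mY YK; have [m1 m2] := mf _ _ _ _ mY.
  rewrite -meanB//; apply: le_trans (le_norm_mean (has_momentsB m1 m2)) _.
  apply: (@le_trans _ _ (\int[Q]_w (e5 + 2 * M / L ^+ 2 * Y w ^+ 2))).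
    apply: le_mean; [exact/has_moments_norm/has_momentsB| |by move=> w; exact: fq].
    by apply: has_momentsD; [exact: has_moments_cst|apply: has_momentsZ; exact: has_momentsX].
  rewrite meanD; [|exact: has_moments_cst|by apply: has_momentsZ; exact: has_momentsX].
  rewrite mean_cst meanZ; last exact: has_momentsX.
  rewrite [2 * e5]mulr_natl mulr2n lerD2l.
  apply: le_trans (ler_wpM2l c0 YK) _.
  rewrite mulrAC ler_pdivrMr ?exprn_gt0//.
  have h : 2 * M * K <= e5 * L.
    rewrite (_ : e5 * L = e5 + 2 * M * K); first by rewrite lerDr ltW.
    by rewrite /L; field; rewrite gt_eqF.
  apply: le_trans h _; rewrite ler_pM2l// expr2 ler_peMr// ltW//.
have cq := @cvg_mean_poly_sin L^-1 p.
move/cvgrPdist_lt : cq => /(_ _ e50); apply: filterS => m hm.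
have b1 : `|E (fun w => f (W m w)) - E (fun w => q (W m w))| <= 2 * e5.
  apply: bnd => //; apply: le_trans (ler_norm _) _; apply: le_trans (hK0 m) _.
  by rewrite lerDl.
have b2 : `|\int[nu]_x f x - \int[nu]_x q x| <= 2 * e5.
  by apply: (bnd _ _ nu (fun x => x)) => //; rewrite lerDr.
move: hm b1 b2; rewrite -/q.
set A := Rintegral nu _ (fun x => f x); set B := E (fun w => f _).
set A' := Rintegral nu _ (fun x => q x); set B' := E (fun w => q _) => hm b1 b2.
have -> : A - B = (A - A') + (A' - B') + (B' - B) by ring.
apply: le_lt_trans (ler_normD _ _) _; apply: le_lt_trans (_ : `|A - A'| + `|A' - B'| + `|B' - B| < _).
  by rewrite lerD2r; exact: ler_normD.
rewrite [`|B' - B|]distrC; rewrite /e5 in hm b1 b2; lra.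
Qed.

End weak_convergence_from_moments.

(** * Spectral integrals *)

(** Uniqueness of the Lebesgue measure: [a] times the image measure under [x |-> a * x] gives
    half-open intervals their length. *)
Lemma lebesgue_measure_scale {R : realType} (a : R) (A : set R) : 0 < a ->
  measurable A ->
  lebesgue_measure ((fun x : R => a * x) @^-1` A) = ((a^-1)%:E * lebesgue_measure A)%E.
Proof.
move=> a0 mA.
have ma : measurable_fun [set: measurableTypeR R] (fun x : R => a * x : measurableTypeR R).
  exact: measurable_funM.
pose mu : {measure set (measurableTypeR R) -> \bar R} :=
  mscale (NngNum (ltW a0)) (pushforward (@lebesgue_measure R) (fun x : R => a * x : measurableTypeR R)).
have h : lebesgue_measure A = mu ma A.
  apply: lebesgue_measure_unique => // _ [[b c] _ <-] /=.
  rewrite /mu /mscale /= /pushforward.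
  have -> : (fun x : R => a * x) @^-1` `]b, c] = `]b / a, c / a]%classic.
    apply/seteqP; split=> x /=; rewrite !in_itv/= ltr_pdivrMr// ler_pdivlMr//; by rewrite [a * x]mulrC.
  rewrite !lebesgue_measure_itv/= !lte_fin ltr_pM2r ?invr_gt0//.
  case: ifPn => _; last by rewrite mule0.
  by rewrite -!EFinD -EFinM; congr EFin; field; rewrite gt_eqF.
rewrite h /mu /mscale /= /pushforward muleA -EFinM mulVf ?gt_eqF// mul1e.
by [].
Qed.

Definition scalet {R : realType} {d : nat} (a : R) (x : d.-tuple R) : d.-tuple R :=
  [tuple a * tnth x k | k < d].

Section radial_integrals.
Context {R : realType}.

Lemma measurable_scalet d (a : R) : measurable_fun setT (@scalet R d a).
Proof.
apply/measurable_fun_tnthP => i.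
rewrite (_ : _ \o _ = fun x : d.-tuple R => a * tnth x i); last first.
  by apply/funext => x /=; rewrite tnth_mktuple.
by apply: measurable_funM => //; exact: measurable_tnth.
Qed.

(** Fubini on the head coordinate: each section contributes one factor [a^-1], and the tail
    contributes the others by induction. *)
Lemma lebesgue_tuple_scale d (a : R) (A : set (d.-tuple R)) : 0 < a -> measurable A ->
  lebesgue_tuple d (scalet a @^-1` A) = ((a ^- d)%:E * lebesgue_tuple d A)%E.
Proof.
move=> a0; elim: d A => [|d IH] A mA.
  rewrite expr0 invr1 mul1e; congr (lebesgue_tuple 0 _).
  by apply/funext => x /=; congr A; rewrite [LHS]tuple0 [RHS]tuple0.
have mC : measurable (@tuple_cons R d @^-1` A).
  by rewrite -[X in measurable X]setTI; exact: measurable_tuple_cons.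
pose phi y := lebesgue_measure (ysection (@tuple_cons R d @^-1` A) y).
have mphi : measurable_fun setT phi by exact: measurable_fun_ysection.
have phi0 y : (0 <= phi y)%E by exact: measure_ge0.
rewrite /= /lebesgue_cons /pushforward /product_measure2.
transitivity (\int[lebesgue_tuple d]_y ((a^-1)%:E * phi (scalet a y)))%E.
  apply: eq_integral => y _ /=.
  rewrite /phi -lebesgue_measure_scale//; last exact: measurable_ysection.
  congr lebesgue_measure; apply/seteqP.
  have e z : scalet a (@tuple_cons R d (z, y)) = @tuple_cons R d (a * z, scalet a y).
    apply: eq_from_tnth => i; rewrite tnth_mktuple.
    by case: (unliftP ord0 i) => [j ->|->] //; rewrite !tnthS tnth_mktuple.
  by split=> z /=; rewrite /ysection/= !inE /= e.
rewrite ge0_integralZl//; last 2 first.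
- by apply: measurableT_comp => //; exact: measurable_scalet.
- by rewrite lee_fin invr_ge0 ltW.
have a0' : 0 <= a ^- d by rewrite invr_ge0 exprn_ge0// ltW.
have -> : (\int[lebesgue_tuple d]_y phi (scalet a y) = (a ^- d)%:E * \int[lebesgue_tuple d]_y phi y)%E.
  rewrite -(ge0_integral_mscale _ measurableT (NngNum a0'))//.
  have := @ge0_integral_pushforward _ _ _ _ R _ (@measurable_scalet d a) (lebesgue_tuple d)
    setT phi measurableT mphi (fun y _ => phi0 y).
  move=> /esym h; apply: (eq_trans h).
  apply: eq_measure_integral => [|mphi' B mB _]; first exact: measurable_scalet.
  by rewrite /= /pushforward /mscale/= IH.
by rewrite muleA -EFinM -invfM -exprS.
Qed.

Lemma ge0_integral_scalet d (a : R) (f : d.-tuple R -> \bar R) : 0 < a ->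
  measurable_fun setT f -> (forall x, 0 <= f x)%E ->
  (\int[lebesgue_tuple d]_x f (scalet a x) = (a ^- d)%:E * \int[lebesgue_tuple d]_x f x)%E.
Proof.
move=> a0 mf f0.
have a0' : 0 <= a ^- d by rewrite invr_ge0 exprn_ge0// ltW.
rewrite -(ge0_integral_mscale _ measurableT (NngNum a0'))//.
have := @ge0_integral_pushforward _ _ _ _ R _ (@measurable_scalet d a) (lebesgue_tuple d)
  setT f measurableT mf (fun y _ => f0 y).
move=> /esym h; apply: (eq_trans h).
apply: eq_measure_integral => [|mphi' B mB _]; first exact: measurable_scalet.
by rewrite /= /pushforward /mscale/= lebesgue_tuple_scale.
Qed.

Lemma enorm_ge0 d (x : d.-tuple R) : 0 <= enorm x.
Proof. exact: sqrtr_ge0. Qed.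

Lemma enorm_scalet d (a : R) (x : d.-tuple R) : 0 <= a -> enorm (scalet a x) = a * enorm x.
Proof.
move=> a0; rewrite /enorm /dotp.
rewrite (_ : \sum_(k < d) _ = a ^+ 2 * \sum_(k < d) tnth x k * tnth x k).
  by rewrite sqrtrM ?sqr_ge0// sqrtr_sqr ger0_norm.
by rewrite mulr_sumr; apply: eq_bigr => k _; rewrite !tnth_mktuple; ring.
Qed.

Lemma measurable_enorm d : measurable_fun setT (@enorm R d).
Proof.
apply: measurableT_comp; first by apply: continuous_measurable_fun; exact: sqrt_continuous.
apply: measurable_sum => k; apply: measurable_funM; exact: measurable_tnth.
Qed.

Lemma ge0_integral_enorm_scale d (a : R) (f : R -> R) : 0 < a ->
  measurable_fun setT f -> (forall r, 0 <= f r) ->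
  (\int[lebesgue_tuple d]_x (f (a * enorm x))%:E =
   (a ^- d)%:E * \int[lebesgue_tuple d]_x (f (enorm x))%:E)%E.
Proof.
move=> a0 mf f0.
rewrite -(@ge0_integral_scalet d a (fun x => (f (enorm x))%:E))//.
- by apply: eq_integral => x _; rewrite enorm_scalet// ltW.
- apply/measurable_EFinP; apply: measurableT_comp => //; exact: measurable_enorm.
- by move=> x; rewrite lee_fin.
Qed.

End radial_integrals.

Section radial_integrability.
Context {R : realType} (d : nat).
Notation mu := (@lebesgue_tuple R d).

Lemma tnth_le_enorm (x : d.-tuple R) k : `|tnth x k| <= enorm x.
Proof.
rewrite -sqrtr_sqr; apply: ler_wsqrtr; rewrite /dotp (bigD1 k)//= -expr2 lerDl.
by apply: sumr_ge0 => i _; rewrite -expr2 sqr_ge0.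
Qed.

Lemma lebesgue_cube (A : set R) (c : R) : measurable A -> lebesgue_measure A = c%:E ->
  mu [set z | forall k, A (tnth z k)] = (c ^+ d)%:E.
Proof.
move=> mA Ac; rewrite (@lebesgue_tuple_box R d (fun=> A))// (eq_bigr (fun=> c%:E))//.
by rewrite -(big_morph EFin (@EFinM R) erefl) prodr_const card_ord.
Qed.

Lemma integral_enorm_bounded_support (f : R -> R) (C L : R) : 0 <= L ->
  (forall r, 0 <= r -> 0 <= f r <= C) -> (forall r, L <= r -> f r = 0) ->
  measurable_fun setT f ->
  (\int[mu]_x (f (enorm x))%:E < +oo)%E.
Proof.
move=> L0 fC fL mf; have C0 : 0 <= C by have /andP[h1 h2] := fC 0 (lexx 0); exact: le_trans h2.
pose A := [set z : d.-tuple R | forall k, `[- L, L]%classic (tnth z k)].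
have mA : measurable A by apply: (@measurable_box R d (fun=> `[- L, L]%classic)) => k; exact: measurable_itv.
have muA : mu A = ((2 * L) ^+ d)%:E.
  apply: lebesgue_cube; first exact: measurable_itv.
  rewrite lebesgue_measure_itv/= lte_fin; case: ifPn => h.
    by rewrite -EFinD; congr EFin; ring.
  by have -> : L = 0; [move: h; rewrite -leNgt; lra|rewrite mulr0].
apply: (@le_lt_trans _ _ (\int[mu]_x (C%:E * (\1_A x)%:E))%E); last first.
  rewrite ge0_integralZl//; [|by apply/measurable_EFinP; exact: measurable_indic].
  by rewrite integral_indic// setIT muA -EFinM ltry.
apply: ge0_le_integral => //.
- by move=> x _; rewrite lee_fin; have /andP[] := fC _ (enorm_ge0 x).
- by apply/measurable_EFinP; apply: measurableT_comp => //; exact: measurable_enorm.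
- by apply/measurable_EFinP; apply: measurable_funM => //; exact: measurable_indic.
move=> x _; rewrite -EFinM lee_fin.
have [xL|xL] := leP L (enorm x); first by rewrite fL// mulr_ge0.
rewrite indicE mem_set ?mulr1; first by have /andP[] := fC _ (enorm_ge0 x).
move=> k /=; rewrite in_itv/= -ler_norml.
by apply: le_trans (tnth_le_enorm x k) _; exact: ltW.
Qed.

(* Scaling turns [F n.+1 r <= F 1 r + b * F n (a * r)] into
   [J n.+1 <= J 1 + b a^-d J n], a contraction. *)
Lemma integral_enorm_contraction (F : nat -> R -> R) (f : R -> R) (a b : R) :
  0 < a -> 0 <= b -> b * a ^- d < 1 ->
  (forall n, measurable_fun setT (F n)) -> (forall n r, 0 <= F n r) ->
  (forall r, F 0%N r = 0) -> (forall n r, F n.+1 r <= F 1%N r + b * F n (a * r)) ->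
  (forall n r, F n r <= F n.+1 r) ->
  (forall r, F n r @[n --> \oo] --> f r) ->
  (\int[mu]_x (F 1%N (enorm x))%:E < +oo)%E ->
  (\int[mu]_x (f (enorm x))%:E < +oo)%E.
Proof.
move=> a0 b0 ba1 mF F0 F00 Frec Fnd Fcvg J1.
have mFe n : measurable_fun setT (fun x : d.-tuple R => (F n (enorm x))%:E).
  by apply/measurable_EFinP; apply: measurableT_comp => //; exact: measurable_enorm.
set J := fun n => (\int[mu]_x (F n (enorm x))%:E)%E.
have J0 n : (0 <= J n)%E by apply: integral_ge0 => x _; rewrite lee_fin.
set c := b * a ^- d in ba1.
have c0 : 0 <= c by rewrite mulr_ge0// invr_ge0 exprn_ge0// ltW.
have Jrec n : (J n.+1 <= J 1%N + c%:E * J n)%E.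
  have -> : (c%:E * J n = \int[mu]_x (b * F n (a * enorm x))%:E)%E.
    under eq_integral do rewrite EFinM.
    rewrite ge0_integralZl//; first by rewrite ge0_integral_enorm_scale// muleA -EFinM.
    - apply/measurable_EFinP; apply: (measurableT_comp (f := fun r => F n (a * r))).
        by apply: measurableT_comp => //; exact: measurable_funM.
      exact: measurable_enorm.
    - by move=> x _; rewrite lee_fin.
  have mb : measurable_fun setT (fun x : d.-tuple R => (b * F n (a * enorm x))%:E).
    apply/measurable_EFinP; apply: measurable_funM => //.
    apply: (measurableT_comp (f := fun r => F n (a * r))).
      by apply: measurableT_comp => //; exact: measurable_funM.
    exact: measurable_enorm.
  rewrite -ge0_integralD//; last 2 first.
  - by move=> x _; rewrite lee_fin.
  - by move=> x _; rewrite lee_fin mulr_ge0.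
  apply: ge0_le_integral => //.
  - by move=> x _; rewrite lee_fin.
  - exact: emeasurable_funD.
  - by move=> x _; rewrite -EFinD lee_fin.
have J1f : J 1%N \is a fin_num by rewrite ge0_fin_numE.
(* The fixed point of the affine bound in [Jrec]; starting from [J 0 = 0], the sequence stays below
   it. *)
pose B := fine (J 1%N) / (1 - c).
have c1 : 0 < 1 - c by rewrite subr_gt0.
have B0 : 0 <= B by rewrite divr_ge0 ?(ltW c1)// fine_ge0.
have JB n : (J n <= B%:E)%E.
  elim: n => [|n IH].
    by rewrite /J (eq_integral (fun=> 0%E)) ?integral0 ?lee_fin// => x _; rewrite F00.
  apply: le_trans (Jrec n) _; apply: (@le_trans _ _ (J 1%N + c%:E * B%:E)%E).
    by rewrite leeD2l// lee_wpmul2l// lee_fin.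
  rewrite -(fineK J1f) -EFinM -EFinD lee_fin le_eqVlt; apply/orP; left; apply/eqP.
  by rewrite /B; field; rewrite gt_eqF.
have nd (x : d.-tuple R) : nondecreasing_seq (fun n => (F n (enorm x))%:E).
  by apply/nondecreasing_seqP => n; rewrite lee_fin.
have Fe0 n (x : d.-tuple R) : (0 <= (F n (enorm x))%:E)%E by rewrite lee_fin.
have h := @cvg_monotone_convergence _ _ R mu setT measurableT
  (fun n x => (F n (enorm x))%:E) mFe (fun n x _ => Fe0 n x) (fun x _ => nd x).
have e : (\int[mu]_x (f (enorm x))%:E = \int[mu]_x limn (fun n => (F n (enorm x))%:E))%E.
  apply: eq_integral => x _; apply/esym/cvg_lim => //.
  by apply: cvg_EFin; [exact: nearW|exact: Fcvg].
rewrite e; apply: (@le_lt_trans _ _ B%:E); last exact: ltry.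
rewrite -(cvg_lim _ h)//; apply: lime_le; first by apply/cvg_ex; eexists; exact: h.
by apply: nearW => n; exact: JB.
Qed.

End radial_integrability.

Section power_weights.
Context {R : realType}.

Lemma powR_lt0_nonincreasing (q x y : R) : q < 0 -> 0 < x -> x <= y -> y `^ q <= x `^ q.
Proof.
move=> q0 x0 xy; have y0 : 0 < y by exact: lt_le_trans xy.
rewrite -(opprK q) !(powRN _ (- q)) lef_pV2 ?posrE ?powR_gt0//.
by apply: ge0_ler_powR; rewrite ?nnegrE ?oppr_ge0// ltW.
Qed.

Lemma measurable_itv_indicator (i : interval R) :
  measurable_fun setT (fun r : R => (r \in i)%:R : R).
Proof.
have := @measurable_indic _ _ R setT [set` i] (measurable_itv i).
by apply: eq_measurable_fun => r _; rewrite indicE mem_setE.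
Qed.

(** Truncation at [2 ^+ n] and halving of the argument shift the dyadic shells by one. The
    contraction factor is [2] to the power [e], below 1 precisely because [e < 0]; this takes the
    place of polar coordinates. *)
Lemma integral_enorm_power_infty (d : nat) (e : R) : e < 0 ->
  (\int[@lebesgue_tuple R d]_x ((enorm x \in `[1, +oo[%R)%:R * enorm x `^ (e - d%:R))%:E < +oo)%E.
Proof.
move=> e0; pose q := e - d%:R.
have q0 : q < 0 by rewrite /q subr_lt0 (lt_le_trans e0).
pose F n (r : R) : R := (r \in `[1, 2 ^+ n[%R)%:R * r `^ q.
have F0 n r : 0 <= F n r by rewrite mulr_ge0 ?powR_ge0.
apply: (@integral_enorm_contraction _ d F (fun r => (r \in `[1, +oo[%R)%:R * r `^ q) 2^-1 (2 `^ q)) => //.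
- rewrite exprVn invrK /q powRB ?pnatr_eq0 ?implybT// powR_mulrn// divfK ?expf_neq0//.
  rewrite -(powRr0 2) -(opprK e) powRN powRr0 invf_lt1 ?powR_gt0//.
  by rewrite -[ltLHS](powRr0 2) /powR pnatr_eq0/= ltr_expR ltr_pM2r ?oppr_gt0// ln_gt0// ltr1n.
- move=> n; apply: measurable_funM; first exact: measurable_itv_indicator.
  exact: measurable_powR.
- move=> r; rewrite /F expr0 in_itv/=; by case: (leP 1 r) => _ /=; rewrite mul0r.
- move=> n r; rewrite /F !in_itv/= expr1.
  have [r1|r1] := leP 1 r; last by rewrite /= mul0r addr_ge0 ?mulr_ge0 ?powR_ge0.
  have [r2|r2] := ltP r 2.
    rewrite /= mul1r; apply: (@le_trans _ _ (r `^ q)).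
      by rewrite ler_piMl ?powR_ge0//; case: (_ < _).
    by rewrite lerDl !mulr_ge0 ?powR_ge0.
  rewrite /= mul0r add0r.
  have -> : 1 <= 2^-1 * r by rewrite mulrC ler_pdivlMr// mul1r.
  rewrite exprS -ltr_pdivrMl//; case: (_ < _); rewrite ?mul0r ?mulr0//= !mul1r.
  rewrite powRM//; last by rewrite (le_trans _ r1).
  by rewrite mulrA -powRM// divff// powR1 mul1r.
- move=> n r; rewrite /F ler_wpM2r ?powR_ge0// !in_itv/= ler_nat.
  case: (1 <= r) => //=; case: ltP => // h.
  by rewrite (lt_le_trans h)// exprS ler_peMl// ?exprn_ge0// ler1n.
- move=> r; apply: cvg_near_cst; apply: filterS (nbhs_infty_gtr r) => n rn.
  rewrite /F !in_itv/= andbT (lt_trans rn) ?andbT// -natrX ltr_nat.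
  exact: ltn_expl.
- apply: (@integral_enorm_bounded_support _ d _ 1 2) => //.
  + move=> r r0; rewrite F0/= /F in_itv/= expr1; case: (leP 1 r) => [r1|]/=; last by rewrite mul0r.
    case: (_ < _); rewrite ?mul0r// mul1r.
    by have := powR_lt0_nonincreasing q0 ltr01 r1; rewrite powR1.
  + by move=> r r2; rewrite /F in_itv/= expr1 [r < 2]ltNge r2 andbF mul0r.
  + apply: measurable_funM; first exact: measurable_itv_indicator.
    exact: measurable_powR.
Qed.

(** The same contraction towards the origin: the shells are shifted by doubling the argument, and
    the factor is [2] to the power [- e]. *)
Lemma integral_enorm_power_0 (d : nat) (e : R) : 0 < e -> e < d%:R ->
  (\int[@lebesgue_tuple R d]_x ((enorm x \in `]0, 1[%R)%:R * enorm x `^ (e - d%:R))%:E < +oo)%E.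
Proof.
move=> e0 ed; pose q := e - d%:R.
have q0 : q < 0 by rewrite /q subr_lt0.
pose F n (r : R) : R := (r \in `[2 ^- n, 1[%R)%:R * r `^ q.
have F0 n r : 0 <= F n r by rewrite mulr_ge0 ?powR_ge0.
have p0 n : 0 < 2 ^- n :> R by rewrite invr_gt0 exprn_gt0.
apply: (@integral_enorm_contraction _ d F (fun r => (r \in `]0, 1[%R)%:R * r `^ q) 2 (2 `^ (- q))) => //.
- rewrite /q opprB powRB ?pnatr_eq0 ?implybT// powR_mulrn// mulrAC divff ?expf_neq0// mul1r.
  rewrite invf_lt1 ?powR_gt0//.
  by rewrite -[ltLHS](powRr0 2) /powR pnatr_eq0/= ltr_expR ltr_pM2r// ln_gt0// ltr1n.
- move=> n; apply: measurable_funM; first exact: measurable_itv_indicator.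
  exact: measurable_powR.
- move=> r; rewrite /F expr0 invr1 in_itv/=; by case: (leP 1 r) => _ /=; rewrite mul0r.
- move=> n r; rewrite /F !in_itv/= expr1.
  have [r1|r1] := ltP r 1; last by rewrite andbF mul0r addr_ge0 ?mulr_ge0 ?powR_ge0.
  rewrite !andbT; have [r2|r2] := leP 2^-1 r.
    rewrite /= mul1r; apply: (@le_trans _ _ (r `^ q)).
      by rewrite ler_piMl ?powR_ge0//; case: (2 ^- n.+1 <= r).
    by rewrite lerDl !mulr_ge0 ?powR_ge0.
  rewrite /= mul0r add0r.
  have -> : 2 * r < 1 by rewrite mulrC -ltr_pdivlMr// mul1r.
  rewrite exprS invfM ler_pdivrMl// andbT.
  have [h|] := leP (2 ^- n) (2 * r); rewrite ?mul0r ?mulr0//= !mul1r.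
  have r0 : 0 <= r by have := lt_le_trans (p0 n) h; lra.
  by rewrite powRM// mulrA powRN mulVf ?mul1r// gt_eqF// powR_gt0.
- move=> n r; rewrite /F ler_wpM2r ?powR_ge0// !in_itv/= ler_nat.
  case: (r < 1); rewrite ?andbF// !andbT; case: leP => // h.
  by rewrite (le_trans _ h)// exprS invfM ler_piMl ?invr_ge0 ?exprn_ge0// invf_le1// ler1n.
- move=> r; apply: cvg_near_cst.
  have [r0|r0] := leP r 0.
    apply: nearW => n; rewrite /F !in_itv/= [0 < r]ltNge r0/= leNgt (le_lt_trans r0)//= !mul0r//.
  apply: filterS (nbhs_infty_gtr r^-1) => n rn.
  rewrite /F !in_itv/= r0; congr (_%:R * _); congr (nat_of_bool (_ && _)).
  rewrite -[r]invrK lef_pV2 ?posrE ?exprn_gt0 ?invr_gt0//.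
  rewrite ltW// (lt_trans rn)// -natrX ltr_nat; exact: ltn_expl.
- apply: (@integral_enorm_bounded_support _ d _ (2^-1 `^ q) 1) => //.
  + move=> r r0; rewrite F0/= /F in_itv/= expr1; case: (leP 2^-1 r) => [r1|]/=; last by rewrite mul0r powR_ge0.
    case: (_ < _); rewrite ?mul0r ?powR_ge0// mul1r.
    by apply: powR_lt0_nonincreasing => //; rewrite invr_gt0.
  + by move=> r r2; rewrite /F in_itv/= [r < 1]ltNge r2 andbF mul0r.
  + apply: measurable_funM; first exact: measurable_itv_indicator.
    exact: measurable_powR.
Qed.

End power_weights.

Section cosine_potential.
Context {R : realType} (d : nat) (beta : R).
Hypotheses (beta0 : 0 < beta) (beta2 : beta < 2) (betad : beta < d%:R).
Notation mu := (@lebesgue_tuple R d).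
Let q := beta - d%:R - 2.

Definition cos_weight (s : R) (x : d.-tuple R) : R :=
  (1 - cos (s * enorm x)) * enorm x `^ (beta - d%:R - 2).

(** In radial form this is, up to a constant, the Lévy-Khintchine exponent of a symmetric stable law
    of index [2 - beta], which is why it is proportional to the absolute value of [s] to that
    power. *)
Definition cos_potential (s : R) : R := \int[mu]_x cos_weight s x.

Let w (r : R) : R := (1 - cos r) * r `^ q.

Let w_ge0 r : 0 <= w r.
Proof. by rewrite mulr_ge0 ?powR_ge0// subr_ge0 cos_le1. Qed.

Let mw : measurable_fun setT w.
Proof.
apply: measurable_funM; last exact: measurable_powR.
apply: measurable_funB => //; apply: continuous_measurable_fun; exact: continuous_cos.
Qed.

Lemma cos_weight_ge0 s x : 0 <= cos_weight s x.
Proof. by rewrite mulr_ge0 ?powR_ge0// subr_ge0 cos_le1. Qed.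

Lemma measurable_cos_weight s : measurable_fun setT (cos_weight s).
Proof.
apply: (measurableT_comp (f := fun r => (1 - cos (s * r)) * r `^ q)); last exact: measurable_enorm.
apply: measurable_funM; last exact: measurable_powR.
apply: measurable_funB => //.
by apply: measurableT_comp; [apply: continuous_measurable_fun; exact: continuous_cos|exact: measurable_funM].
Qed.

Lemma cos_weightN s x : cos_weight (- s) x = cos_weight s x.
Proof. by rewrite /cos_weight mulNr cosN. Qed.

Lemma onem_cos_le (x : R) : 1 - cos x <= x ^+ 2.
Proof.
have := cos_taylor 2 0 x; rewrite big_ord_recl big_ord1 /bump/= !add0r addr0.
rewrite mul0r mul1r cos0 cos_pihalf fact0 expr0 divr1 mul0r mul0r mulr1 addr0.
rewrite (real_normK (num_real x)) ler_norml => /andP[h _]; have := sqr_ge0 x.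
rewrite (_ : 2`!%:R = 2 :> R) in h *; last by [].
lra.
Qed.

Let q_lt0 : q < 0. Proof. by have := betad; rewrite /q; lra. Qed.

Let w_le r : 0 <= r -> w r <= (r \in `]0, 1[%R)%:R * r `^ (beta - d%:R) +
   2 * ((r \in `[1, +oo[%R)%:R * r `^ (beta - 2 - d%:R)).
Proof.
move=> r0; rewrite !in_itv/= andbT.
have [->|rn0] := eqVneq r 0.
  rewrite /w cos0 subrr mul0r ltxx mul0r add0r.
  by rewrite !mulr_ge0 ?powR_ge0.
have rp : 0 < r by rewrite lt_neqAle eq_sym rn0.
rewrite rp/=; have [r1|r1] := ltP r 1.
  rewrite mul1r mul0r mulr0 addr0.
  apply: (@le_trans _ _ (r ^+ 2 * r `^ q)).
    by rewrite ler_wpM2r ?powR_ge0// onem_cos_le.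
  rewrite -powR_mulrn// -powRD ?rn0 ?implybT//.
  by rewrite le_eqVlt; apply/orP; left; apply/eqP; congr powR; rewrite /q; ring.
rewrite mul0r add0r mul1r (_ : beta - 2 - d%:R = q); last by rewrite /q; ring.
rewrite ler_wpM2r ?powR_ge0//; have := cos_geN1 r; lra.
Qed.

(** Near the origin [1 - cos r <= r ^+ 2] leaves the exponent [beta - d], integrable since
    [beta > 0]; at infinity the numerator is at most 2 and [beta < 2] suffices. *)
Let w_lty : (\int[mu]_x (w (enorm x))%:E < +oo)%E.
Proof.
have h1 := @integral_enorm_power_0 R d beta beta0 betad.
have h2 := @integral_enorm_power_infty R d (beta - 2) _.
have {}h2 := h2 (ltac:(rewrite subr_lt0//)).
pose f1 (x : d.-tuple R) := ((enorm x \in `]0, 1[%R)%:R * enorm x `^ (beta - d%:R))%:E.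
pose f2 (x : d.-tuple R) := ((enorm x \in `[1, +oo[%R)%:R * enorm x `^ (beta - 2 - d%:R))%:E.
have mf (i : interval R) e : measurable_fun setT (fun x : d.-tuple R =>
   ((enorm x \in i)%:R * enorm x `^ e)%:E).
  apply/measurable_EFinP.
  apply: (measurableT_comp (f := fun r => (r \in i)%:R * r `^ e)); last exact: measurable_enorm.
  by apply: measurable_funM; [exact: measurable_itv_indicator|exact: measurable_powR].
have f1_0 x : (0 <= f1 x)%E by rewrite lee_fin mulr_ge0 ?powR_ge0.
have f2_0 x : (0 <= f2 x)%E by rewrite lee_fin mulr_ge0 ?powR_ge0.
have mf2 : measurable_fun setT (fun x => (2%:E * f2 x)%E) by apply: measurable_funeM; exact: mf.
apply: (@le_lt_trans _ _ (\int[mu]_x (f1 x + 2%:E * f2 x))%E).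
  apply: ge0_le_integral => //.
  - by move=> x _; rewrite lee_fin.
  - by apply/measurable_EFinP; apply: measurableT_comp => //; exact: measurable_enorm.
  - by apply: emeasurable_funD => //; exact: mf.
  - by move=> x _; rewrite -EFinM -EFinD lee_fin w_le// enorm_ge0.
have f22_0 x : (0 <= 2%:E * f2 x)%E by rewrite mule_ge0.
rewrite (ge0_integralD mu measurableT (fun x _ => f1_0 x) (mf _ _) (fun x _ => f22_0 x) mf2).
rewrite (ge0_integralZl mu measurableT (mf _ _) (fun x _ => f2_0 x))//.
by rewrite lte_add_pinfty// lte_mul_pinfty.
Qed.

(** The substitution [x |-> s x]. The identity is stated in the extended reals because integrability
    for general [s] is deduced from it. *)
Lemma integral_cos_weight (s : R) : 0 < s ->
  (\int[mu]_x (cos_weight s x)%:E = (s `^ (2 - beta))%:E * \int[mu]_x (cos_weight 1 x)%:E)%E.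
Proof.
move=> s0.
have h := ge0_integral_enorm_scale d s0 mw w_ge0.
have e : (\int[mu]_x (w (s * enorm x))%:E = (s `^ q)%:E * \int[mu]_x (cos_weight s x)%:E)%E.
  rewrite -ge0_integralZl//.
  - apply: eq_integral => x _; rewrite -EFinM; congr EFin.
    by rewrite /w powRM ?(ltW s0) ?enorm_ge0// /cos_weight -/q mulrCA.
  - by apply/measurable_EFinP; exact: measurable_cos_weight.
  - by move=> x _; rewrite lee_fin cos_weight_ge0.
  - by rewrite lee_fin powR_ge0.
have e1 : (\int[mu]_x (w (enorm x))%:E = \int[mu]_x (cos_weight 1 x)%:E)%E.
  by apply: eq_integral => x _; rewrite /cos_weight mul1r.
move: h; rewrite e e1 => h.
have -> : (\int[mu]_x (cos_weight s x)%:E =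
    (s `^ (- q))%:E * ((s `^ q)%:E * \int[mu]_x (cos_weight s x)%:E))%E.
  by rewrite muleA -EFinM powRN mulVf ?mul1e// gt_eqF// powR_gt0.
rewrite h muleA -EFinM; congr (_%:E * _)%E.
rewrite -powR_invn ?(ltW s0)// -powRD ?(gt_eqF s0) ?implybT//.
by congr powR; rewrite /q; ring.
Qed.

Lemma integrable_cos_weight s : mu.-integrable setT (EFin \o cos_weight s).
Proof.
apply/integrableP; split; first by apply/measurable_EFinP; exact: measurable_cos_weight.
under eq_integral do rewrite /= ger0_norm ?cos_weight_ge0//.
have pos t : 0 < t -> (\int[mu]_x (cos_weight t x)%:E < +oo)%E.
  move=> t0; rewrite integral_cos_weight// lte_mul_pinfty ?lee_fin ?powR_ge0//.
  rewrite (eq_integral (fun x => (w (enorm x))%:E)) ?w_lty// => x _.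
  by rewrite /cos_weight mul1r.
have [s0|s0|<-] := ltgtP 0 s; first exact: pos.
  by under eq_integral do rewrite -cos_weightN; apply: pos; rewrite oppr_gt0.
rewrite (eq_integral (fun=> 0%E)) ?integral0// => x _.
by rewrite /cos_weight mul0r cos0 subrr mul0r.
Qed.

Lemma cos_potentialE s : cos_potential s = `|s| `^ (2 - beta) * cos_potential 1.
Proof.
have pos t : 0 < t -> cos_potential t = t `^ (2 - beta) * cos_potential 1.
  move=> t0; rewrite /cos_potential /Rintegral integral_cos_weight// fineM//.
  exact: integrable_fin_num (integrable_cos_weight 1).
have [s0|s0|<-] := ltgtP 0 s.
- by rewrite gtr0_norm// pos.
- rewrite ltr0_norm// -pos ?oppr_gt0//.
  by apply: eq_Rintegral => x _; rewrite cos_weightN.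
rewrite normr0 powR0 ?mul0r; last by rewrite gt_eqF// subr_gt0.
transitivity (\int[mu]_x (0 : R)); last by rewrite /Rintegral integral0.
by apply: eq_Rintegral => x _; rewrite /cos_weight mul0r cos0 subrr mul0r.
Qed.

Lemma cos_potential_gt0 : 0 < cos_potential 1.
Proof.
have d0 : (0 < d)%N by rewrite -(ltr0n R) (lt_trans beta0).
have dR : 0 < d%:R :> R by rewrite ltr0n.
(* A cube on which the integrand is bounded below: its points have norm at least [eta] through one
   coordinate, and at most 1 because [d * (2 * eta) ^+ 2 = 1 / d]. *)
pose eta : R := (2 * d%:R)^-1.
have eta0 : 0 < eta by rewrite invr_gt0 mulr_gt0.
have eta1 : eta <= 1 by rewrite invf_le1 ?mulr_gt0// -[leLHS]mul1r ler_pM// ?ler1n.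
pose A := [set z : d.-tuple R | forall k, `[eta, 2 * eta]%classic (tnth z k)].
have mA : measurable A by apply: (@measurable_box R d (fun=> `[eta, 2 * eta]%classic)) => k; exact: measurable_itv.
have muA : mu A = (eta ^+ d)%:E.
  apply: lebesgue_cube; first exact: measurable_itv.
  rewrite lebesgue_measure_itv/= lte_fin ifT; last by lra.
  by rewrite -EFinD; congr EFin; ring.
have hA x : A x -> eta <= enorm x <= 1.
  move=> Ax; apply/andP; split.
    have := Ax (Ordinal d0); rewrite /= in_itv/= => /andP[h _].
    apply: le_trans h _; apply: le_trans (ler_norm _) _; exact: tnth_le_enorm.
  rewrite -(@sqrtr1 R); apply: ler_wsqrtr; rewrite /dotp.
  apply: (@le_trans _ _ (\sum_(k < d) (2 * eta) ^+ 2)).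
    apply: ler_sum => k _; have := Ax k; rewrite /= in_itv/= => /andP[h1 h2].
    by rewrite expr2 ler_pM//; lra.
  rewrite sumr_const card_ord /eta -[_ *+ d]mulr_natl.
  have -> : d%:R * (2 * (2 * d%:R)^-1) ^+ 2 = d%:R^-1 :> R by field; rewrite gt_eqF.
  by rewrite invf_le1// ler1n.
pose c : R := 1 - cos eta.
have c0 : 0 < c.
  rewrite /c subr_gt0 -cos0 ltr_cos ?in_itv/= ?lexx ?pi_ge0 ?(ltW eta0)//.
  by apply: le_trans eta1 _; apply: le_trans (pi_ge2 R); lra.
have fA x : A x -> c <= cos_weight 1 x.
  move=> /hA/andP[h1 h2]; rewrite /cos_weight mul1r -[leLHS]mulr1.
  have p2 : 1 <= enorm x `^ q.
    have := powR_lt0_nonincreasing q_lt0 (lt_le_trans eta0 h1) h2.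
    by rewrite powR1.
  apply: ler_pM => //; first exact: ltW.
  have hin (r : R) : 0 <= r <= 1 -> r \in `[0, pi]%R.
    by rewrite in_itv/= => /andP[-> r1]; apply: le_trans r1 _; apply: le_trans (pi_ge2 R); lra.
  have e01 : 0 <= eta <= 1 by rewrite (ltW eta0).
  have x01 : 0 <= enorm x <= 1 by rewrite enorm_ge0.
  by rewrite /c lerD2l lerN2 leNgt ltr_cos ?hin// -leNgt.
have h : ((c * eta ^+ d)%:E <= \int[mu]_x (cos_weight 1 x)%:E)%E.
  have -> : ((c * eta ^+ d)%:E = \int[mu]_x (c%:E * (\1_A x)%:E))%E.
    rewrite ge0_integralZl//; last 2 first.
    - by apply/measurable_EFinP; exact: measurable_indic.
    - by rewrite lee_fin ltW.
    by rewrite integral_indic// setIT muA -EFinM.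
  apply: ge0_le_integral => //.
  - by move=> x _; rewrite mule_ge0 ?lee_fin// ltW.
  - by apply/measurable_EFinP; apply: measurable_funM => //; exact: measurable_indic.
  - by apply/measurable_EFinP; exact: measurable_cos_weight.
  move=> x _; rewrite -EFinM lee_fin indicE.
  have [xA|xA] := boolP (x \in A); last by rewrite mulr0 cos_weight_ge0.
  by rewrite mulr1 fA//; rewrite inE in xA.
apply: (@lt_le_trans _ _ (c * eta ^+ d)); first by rewrite mulr_gt0// exprn_gt0.
rewrite -lee_fin /cos_potential /Rintegral fineK//.
exact: integrable_fin_num (integrable_cos_weight 1).
Qed.

End cosine_potential.

(** * Integration of the covariance in time *)

Section absolute_powers.
Context {R : realType}.

Definition pw (a x : R) : R := `|x| `^ a.

Lemma pwN a x : pw a (- x) = pw a x.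
Proof. by rewrite /pw normrN. Qed.

Lemma pw_ge0 a x : 0 <= pw a x. Proof. exact: powR_ge0. Qed.

Lemma pwM a x y : pw a (x * y) = pw a x * pw a y.
Proof. by rewrite /pw normrM powRM. Qed.

Lemma pwS (a x : R) : 0 < a -> pw (a + 1) x = `|x| * pw a x.
Proof.
move=> a0; have [->|x0] := eqVneq x 0.
  by rewrite /pw normr0 mul0r powR0// gt_eqF// addr_gt0.
by rewrite /pw powRD ?normr_eq0 ?x0 ?implybT// powRr1// mulrC.
Qed.

Lemma is_derive_pw (a x : R) : 0 < x -> is_derive x 1 (pw a) (a * pw (a - 1) x).
Proof.
move=> x0; have dp := is_derive1_powR a x0.
rewrite {2}/pw (gtr0_norm x0); apply: near_eq_is_derive dp.
near=> y; rewrite /pw gtr0_norm//; near: y; exact: lt_nbhsr.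
Unshelve. all: by end_near. Qed.

Lemma continuous_pw (a : R) : 0 < a -> continuous (pw a).
Proof.
move=> a0 x; have [x0|x0] := eqVneq x 0.
  rewrite x0; apply/cvgrPdist_lt => e e0 /=.
  rewrite /pw normr0 powR0 ?gt_eqF//.
  have ea : 0 < e `^ a^-1 by rewrite powR_gt0.
  apply/nbhs_ballP; exists (e `^ a^-1) => //= y; rewrite /ball/= sub0r normrN => hy.
  rewrite sub0r normrN ger0_norm ?powR_ge0//.
  apply: lt_le_trans (_ : (e `^ a^-1) `^ a <= _).
    by apply: gt0_ltr_powR; rewrite ?nnegrE ?(ltW ea).
  by rewrite -powRrM mulVf ?gt_eqF// powRr1// ltW.
have xn : 0 < `|x| by rewrite normr_gt0.
have h : {for x, continuous ((fun y : R => y `^ a) \o (fun x : R => `|x|))}.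
  apply: continuous_comp; first exact: norm_continuous.
  apply/differentiable_continuous/derivable1_diffP.
  by case: (is_derive1_powR a xn).
exact: h.
Qed.

Lemma Rintegral_pw_affine (a c k tau : R) : 0 < a -> 0 <= tau -> 0 <= c - 2 * tau ->
  \int[lebesgue_measure]_(r in `[0, tau]) (pw a (c - 2 * r) - k) =
  (pw (a + 1) c - pw (a + 1) (c - 2 * tau)) / (2 * (a + 1)) - tau * k.
Proof.
move=> a0; rewrite le_eqVlt => /orP[/eqP<-|tau0] ct.
  by rewrite set_itv1 Rintegral_set1 mulr0 subr0 subrr mul0r mul0r subrr.
have a1 : 0 < a + 1 by rewrite addr_gt0.
pose F r := - (2 * (a + 1))^-1 * pw (a + 1) (c - 2 * r) - k * r.
pose f r := pw a (c - 2 * r) - k.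
have lin : continuous (fun r : R => c - 2 * r).
  by move=> z; apply: cvgB; [exact: cvg_cst|apply: cvgM; [exact: cvg_cst|exact: cvg_id]].
have cpw b : 0 < b -> continuous (fun r : R => pw b (c - 2 * r)).
  move=> b0 r; have h : {for r, continuous (pw b \o (fun r : R => c - 2 * r))}.
    by apply: continuous_comp; [exact: lin|exact: continuous_pw].
  exact: h.
have cf : continuous f by move=> r; apply: cvgB; [exact: cpw|exact: cvg_cst].
have cF : continuous F.
  move=> r; apply: cvgB; apply: cvgM; [exact: cvg_cst|exact: cpw|exact: cvg_cst|exact: cvg_id].
(* Only interior points need a derivative. There [c - 2 * r] is positive even if it vanishes at
   [tau], which happens for equal times. *)
have dF (r : R) : r \in `]0, tau[%R -> is_derive r 1 F (f r).
  rewrite in_itv/= => /andP[r0 rt].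
  have cr : 0 < c - 2 * r by lra.
  have dlin : is_derive r 1 (fun r : R => c - 2 * r) (- 2).
    have := is_deriveB (is_derive_cst c r 1) (is_deriveZ 2 (is_derive_id r 1)).
    by rewrite sub0r /GRing.scale/= mulr1.
  have h := @is_derive1_comp R (pw (a + 1)) (fun r => c - 2 * r) r _ _ (is_derive_pw (a + 1) cr) dlin.
  apply: (is_derive_eq (is_deriveB (is_deriveZ (- (2 * (a + 1))^-1) h) (is_deriveZ k (is_derive_id r 1)))).
  rewrite /f /GRing.scale/= (_ : a + 1 - 1 = a); last by ring.
  by field; rewrite gt_eqF.
rewrite /Rintegral (@continuous_FTC2 _ f F)//.
- by rewrite -EFinB /= /F !mulr0 !subr0; field; rewrite gt_eqF.
- exact: continuous_subspaceT.
- split.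
  + by move=> x /dF[].
  + exact/cvg_at_right_filter/cF.
  + exact/cvg_at_left_filter/cF.
- by move=> x /dF[_]; rewrite derive1E.
Qed.

End absolute_powers.

Section wave_covariance_formula.
Context {R : realType} (d : nat) (beta theta : R).
Hypotheses (beta0 : 0 < beta) (beta2 : beta < 2) (betad : beta < d%:R).
Hypothesis theta0 : 0 < theta.
Local Open Scope complex_scope.

Lemma Re_wave_covariance (t s : R) (x : d.-tuple R) :
  complex.Re (wave_covariance beta theta t s x x) =
  ((2 * pi) ^+ d)^-1 * \int[lebesgue_measure]_(r in `[0%R, Num.min t s])
     \int[lebesgue_tuple d]_xi (wave_kernel theta (t - r) xi * wave_kernel theta (s - r) xi *
       enorm xi `^ (beta - d%:R)).
Proof.
rewrite /wave_covariance /Cintegral /= mul0r subr0; congr (_ * _).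
apply: eq_Rintegral => r _; apply: eq_Rintegral => xi _.
rewrite (_ : dotp (subt x x) xi = 0) ?cos0 ?sin0 ?mul1r ?mul0r ?subr0//.
by rewrite /dotp big1// => k _; rewrite tnth_mktuple subrr mul0r.
Qed.

(** Product-to-sum for two sines. Passing from [cos] to [1 - cos] on both sides of the difference
    makes each of the two terms integrable by itself. *)
Lemma wave_kernel_mul (p q : R) (xi : d.-tuple R) :
  wave_kernel theta p xi * wave_kernel theta q xi * enorm xi `^ (beta - d%:R) =
  (2 * theta)^-1 * (cos_weight beta ((p + q) * Num.sqrt theta) xi -
    cos_weight beta ((p - q) * Num.sqrt theta) xi).
Proof.
have k0 : Num.sqrt theta != 0 by rewrite gt_eqF// sqrtr_gt0.
have t2 : theta = Num.sqrt theta ^+ 2 by rewrite sqr_sqrtr// ltW.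
rewrite /wave_kernel /cos_weight; set r := enorm xi.
move: (Num.sqrt theta) k0 t2 => k k0 ->.
(* At the origin the quotient defining the kernel takes the value 0, and so does [1 - cos]. *)
have [r0|r0] := eqVneq r 0.
  by rewrite r0 !(mulr0, sin0, cos0, subrr, mul0r).

have -> : r `^ (beta - d%:R) = r ^+ 2 * r `^ (beta - d%:R - 2).
  rewrite -powR_mulrn ?enorm_ge0// -powRD ?r0 ?implybT//.
  by congr powR; ring.
have -> : (p + q) * k * r = p * k * r + q * k * r by ring.
have -> : (p - q) * k * r = p * k * r - q * k * r by ring.
rewrite cosD cosB; field.
by rewrite k0 r0.
Qed.

Lemma integral_wave_kernel_mul (p q : R) : 0 <= p -> 0 <= q ->
  \int[lebesgue_tuple d]_xi (wave_kernel theta p xi * wave_kernel theta q xi *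
       enorm xi `^ (beta - d%:R)) =
  theta `^ (- (beta / 2)) / 2 * cos_potential d beta 1 *
   (pw (2 - beta) (p + q) - pw (2 - beta) (p - q)).
Proof.
move=> p0 q0.
have ic s := integrable_cos_weight beta0 beta2 betad s.
transitivity (\int[lebesgue_tuple d]_xi ((2 * theta)^-1 *
   (cos_weight beta ((p + q) * Num.sqrt theta) xi - cos_weight beta ((p - q) * Num.sqrt theta) xi))).
  by apply: eq_Rintegral => xi _; exact: wave_kernel_mul.
rewrite RintegralZl//; last first.
  have := integrableB measurableT (ic ((p + q) * Num.sqrt theta)) (ic ((p - q) * Num.sqrt theta)).
  by apply: eq_integrable.
rewrite RintegralB//.
rewrite -!/(cos_potential d beta _) (cos_potentialE beta0 beta2 betad (_ * Num.sqrt _)).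
rewrite (cos_potentialE beta0 beta2 betad ((p - q) * _)) -!/(pw _ _) !pwM.
have -> : pw (2 - beta) (Num.sqrt theta) = theta * theta `^ (- (beta / 2)).
  rewrite /pw ger0_norm ?sqrtr_ge0// -powR12_sqrt ?ltW// -powRrM.
  rewrite -{2}(powRr1 (ltW theta0)) -powRD ?(gt_eqF theta0) ?implybT//.
  by congr powR; field.
by field; rewrite gt_eqF.
Qed.

Definition wave_const : R :=
  ((2 * pi) ^+ d)^-1 * (theta `^ (- (beta / 2)) / 2 * cos_potential d beta 1).

(** With [p = t - r] and [q = s - r], the difference [p - q] does not depend on [r] and the sum is
    [t + s - 2 * r], which decreases to [|t - s|] at the end of the range. *)
Lemma Re_wave_covarianceE (t s : R) (x : d.-tuple R) : 0 <= t -> 0 <= s ->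
  complex.Re (wave_covariance beta theta t s x x) = wave_const *
  ((pw (3 - beta) (t + s) - pw (3 - beta) (t - s)) / (2 * (3 - beta)) -
     Num.min t s * pw (2 - beta) (t - s)).
Proof.
move=> t0 s0; rewrite Re_wave_covariance /wave_const -[RHS]mulrA; congr (_ * _).
set A := theta `^ _ / 2 * _; set m := Num.min t s.
have m0 : 0 <= m by rewrite le_min t0.
have mE : t + s - 2 * m = `|t - s|.
  rewrite /m; have [ts|ts] := leP t s.
    by rewrite distrC ger0_norm ?subr_ge0//; ring.
  by rewrite gtr0_norm ?subr_gt0//; ring.
have a0 : 0 < 2 - beta by rewrite subr_gt0.
transitivity (\int[lebesgue_measure]_(r in `[0%R, m]) (A * (pw (2 - beta) (t + s - 2 * r) - pw (2 - beta) (t - s)))).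
  apply: eq_Rintegral => r; rewrite inE/= in_itv/= => /andP[r0 rm].
  move: rm; rewrite le_min => /andP[rt rs].
  rewrite integral_wave_kernel_mul ?subr_ge0//; congr (_ * (pw _ _ - pw _ _)); ring.
rewrite RintegralZl//; last first.
  apply: continuous_compact_integrable; first exact: segment_compact.
  apply: continuous_subspaceT => r; apply: cvgB; last exact: cvg_cst.
  have h : {for r, continuous (pw (2 - beta) \o (fun r : R => t + s - 2 * r))}.
    apply: continuous_comp; last exact: continuous_pw.
    by apply: cvgB; [exact: cvg_cst|apply: cvgM; [exact: cvg_cst|exact: cvg_id]].
  exact: h.
rewrite Rintegral_pw_affine// ?mE//.
rewrite (_ : 2 - beta + 1 = 3 - beta); last by ring.
by rewrite (_ : pw (3 - beta) `|t - s| = pw (3 - beta) (t - s))// /pw normr_id.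
Qed.

End wave_covariance_formula.

(** * Covariance of the second differences *)

Section fourth_difference.
Context {R : realType}.

Definition diff4 (f : R -> R) (x : R) : R :=
  f (x + 2) - 4 * f (x + 1) + 6 * f x - 4 * f (x - 1) + f (x - 2).

Lemma diff4_pwN (a x : R) : diff4 (pw a) (- x) = diff4 (pw a) x.
Proof.
have e u v : u = - v -> pw a u = pw a v by move=> ->; exact: pwN.
rewrite /diff4 (e (- x + 2) (x - 2)) ?(e (- x + 1) (x - 1)) ?(e (- x) x); try ring.
rewrite (e (- x - 1) (x + 1)) ?(e (- x - 2) (x + 2)); by ring.
Qed.

(* Iterating the mean value theorem: the n-th forward difference of [pw a] is the
   n-th derivative at an intermediate point. *)
Lemma iter_diff_pw n (a x : R) : 0 < x ->
  exists2 z, x <= z & iter n (fun f y => f (y + 1) - f y) (pw a) x =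
    (\prod_(k < n) (a - k%:R)) * pw (a - n%:R) z.
Proof.
suff H : forall n a (c x : R), 0 < x ->
  exists2 z, x <= z & iter n (fun f y => f (y + 1) - f y) (fun y => c * pw a y) x =
    c * (\prod_(k < n) (a - k%:R)) * pw (a - n%:R) z.
  move=> x0; have [z xz h] := H n a 1 x x0; exists z => //.
  rewrite mul1r in h; rewrite -h; congr (iter _ _ _ _).
  by apply/funext => y; rewrite mul1r.
elim=> [|m IH] b c y y0.
  by exists y => //; rewrite big_ord0 mulr1 subr0.
have itd k (g : R -> R) (g' : R -> R) : (forall z : R, 0 < z -> is_derive z 1 g (g' z)) ->
    forall z : R, 0 < z -> is_derive z 1 (iter k (fun f y => f (y + 1) - f y) g)
      (iter k (fun f y => f (y + 1) - f y) g' z).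
  move=> dg; elim: k => [|k IHk] z z0 /=; first exact: dg.
  apply: is_deriveB; last exact: IHk.
  have d1 : is_derive z 1 (fun y : R => y + 1) 1.
    by have := is_deriveD (is_derive_id z 1) (is_derive_cst (1 : R) z 1); rewrite addr0.
  have z1 : 0 < z + 1 by rewrite addr_gt0.
  have := @is_derive1_comp R _ (fun y => y + 1) z _ _ (IHk _ z1) d1.
  by rewrite mulr1.
pose g := iter m (fun f y => f (y + 1) - f y) (fun y => c * pw b y).
have dpw (z : R) : 0 < z -> is_derive z 1 (fun y => c * pw b y) (c * b * pw (b - 1) z).
  move=> z0; apply: (is_derive_eq (is_deriveZ c (is_derive_pw b z0))).
  by rewrite /GRing.scale/= mulrA.
have dg := itd m _ _ dpw; rewrite -/g in dg.
have yy : y < y + 1 by rewrite ltrDl.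
have cg : {within `[y, y + 1], continuous g}.
  apply: derivable_within_continuous => z; rewrite in_itv/= => /andP[yz _].
  by case: (dg z (lt_le_trans y0 yz)).
have dg' (z : R) : z \in `]y, y + 1[%R -> is_derive z 1 g
    (iter m (fun f y => f (y + 1) - f y) (fun y => c * b * pw (b - 1) y) z).
  by rewrite in_itv/= => /andP[yz _]; apply: dg; exact: lt_trans yz.
have [z + hz] := MVT yy dg' cg.
rewrite in_itv/= => /andP[yz _].
have [z' zz' hz'] := IH (b - 1) (c * b) z (lt_trans y0 yz).
exists z'; first by apply: le_trans zz'; exact: ltW.
transitivity (g (y + 1) - g y); first by [].
rewrite hz addrAC subrr add0r mulr1 hz'.
rewrite big_ord_recl subr0 -!mulrA; congr (_ * (_ * (_ * _))).
  by apply: eq_bigr => k _; rewrite /bump/= -natr1; ring.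
by congr pw; rewrite -natr1; ring.
Qed.

Lemma diff4_pwE (a x : R) : 2 < x -> exists2 z, x - 2 <= z &
  diff4 (pw a) x = a * (a - 1) * (a - 2) * (a - 3) * pw (a - 4) z.
Proof.
move=> x2; have x0 : 0 < x - 2 by rewrite subr_gt0.
have [z xz h] := iter_diff_pw 4 a x0; exists z => //.
move: h; rewrite !big_ord_recl big_ord0 /= /bump/= subr0 mulr1 !mulrA => <-.
have e (u v : R) : u = v -> pw a u = pw a v by move=> ->.
rewrite /diff4 (e (x - 2 + 1 + 1 + 1 + 1) (x + 2)) ?(e (x - 2 + 1 + 1 + 1) (x + 1)); try ring.
rewrite (e (x - 2 + 1 + 1) x) ?(e (x - 2 + 1) (x - 1)); by ring.
Qed.

Lemma diff4_pw_le_small (a x : R) : 0 < a -> `|x| <= 2 -> `|diff4 (pw a) x| <= 16 * 4 `^ a.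
Proof.
move=> a0 x2.
have h y : `|y| <= 4 -> 0 <= pw a y <= 4 `^ a.
  move=> y4; rewrite pw_ge0/=; apply: ge0_ler_powR => //; rewrite ?nnegrE//; exact: ltW.
move: x2; rewrite ler_norml => /andP[x1 x2].
have := h (x + 2) ltac:(rewrite ler_norml; lra).
have := h (x + 1) ltac:(rewrite ler_norml; lra).
have := h x ltac:(rewrite ler_norml; lra).
have := h (x - 1) ltac:(rewrite ler_norml; lra).
have := h (x - 2) ltac:(rewrite ler_norml; lra).
move=> /andP[? ?] /andP[? ?] /andP[? ?] /andP[? ?] /andP[? ?].
by rewrite /diff4 ler_norml; apply/andP; split; lra.
Qed.

(** Integer points avoid the range between 2 and 3, so the intermediate point of the mean value
    formula is at least 1 and the negative power there is at most 1. The few points near the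
    singularity are bounded crudely. *)
Lemma diff4_pw_bounded (a : R) : 0 < a -> a < 3 ->
  exists C, forall n : int, `|diff4 (pw a) n%:~R| <= C.
Proof.
move=> a0 a3; pose K := `|a * (a - 1) * (a - 2) * (a - 3)|.
have K0 : 0 <= K by exact: normr_ge0.
exists (16 * 4 `^ a + K) => n.
have [n2|n2] := leP `|n%:~R : R| 2.
  by apply: le_trans (diff4_pw_le_small a0 n2) _; rewrite lerDl.
have pos (x : R) : 3 <= x -> `|diff4 (pw a) x| <= K.
  move=> x3; have x2 : 2 < x by lra.
  have [z xz ->] := diff4_pwE a x2; rewrite normrM ler_piMr//.
  have z1 : 1 <= z by lra.
  have a4 : a - 4 < 0 by lra.
  rewrite /pw ger0_norm ?powR_ge0// ger0_norm; last by lra.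
  by have := powR_lt0_nonincreasing a4 ltr01 z1; rewrite powR1.
apply: (@le_trans _ _ K); last by rewrite lerDr mulr_ge0 ?powR_ge0.
have {n2} : 3 <= `|n%:~R : R|.
  by move: n2; rewrite -intr_norm -[2]/((2 : int)%:~R) -[3]/((3 : int)%:~R) ltr_int ler_int -lezD1.
case: (leP 0 (n%:~R : R)) => [n0|n0]; first by rewrite ger0_norm//; exact: pos.
by rewrite ltr0_norm// -diff4_pwN; exact: pos.
Qed.

Lemma diff4_pw_decay (a : R) : 0 < a -> a < 2 ->
  exists2 C, 0 <= C & forall n : int, `|diff4 (pw a) n%:~R| <= C / (`|n%:~R| + 1) ^+ 2.
Proof.
move=> a0 a2; pose K := `|a * (a - 1) * (a - 2) * (a - 3)|.
have K0 : 0 <= K by exact: normr_ge0.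
have p0 : 0 <= 4 `^ a by exact: powR_ge0.
(* The 9 bounds [(|n| + 1) ^+ 2] for [|n| <= 2]; the second 16 is the square of the 4 in
   [x + 1 <= 4 * z], valid for [z >= x - 2] and [x >= 3]. *)
exists (9 * (16 * 4 `^ a) + 16 * K) => [|n]; first by rewrite addr_ge0// !mulr_ge0.
rewrite ler_pdivlMr ?exprn_gt0 ?ltr_wpDl//.
have [n2|n2] := leP `|n%:~R : R| 2.
  have := diff4_pw_le_small a0 n2; set D := `|diff4 _ _|; move: n2.
  set y := `|_|; have y0 : 0 <= y by exact: normr_ge0.
  move=> y2 hD.
  have y9 : (y + 1) ^+ 2 <= 9.
    by rewrite (_ : 9 = 3 ^+ 2); [apply: lerXn2r; rewrite ?nnegrE; lra|ring].
  have := ler_pM (normr_ge0 _ : 0 <= D) (sqr_ge0 (y + 1)) hD y9; lra.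
have pos (x : R) : 3 <= x -> `|diff4 (pw a) x| * (x + 1) ^+ 2 <= 16 * K.
  move=> x3; have x2 : 2 < x by lra.
  have [z xz ->] := diff4_pwE a x2; rewrite normrM -/K -mulrA [leRHS]mulrC ler_wpM2l//.
  have z1 : 1 <= z by lra.
  have z0 : 0 < z by lra.
  rewrite /pw ger0_norm ?powR_ge0// (gtr0_norm z0).
  have h : z `^ (a - 4) <= z ^- 2.
    by rewrite -powR_invn ?(ltW z0)//; apply: ler_powR => //; lra.
  apply: le_trans (_ : z ^- 2 * (x + 1) ^+ 2 <= _).
    by rewrite ler_wpM2r ?sqr_ge0.
  rewrite mulrC ler_pdivrMr ?exprn_gt0//.
  have -> : 16 * z ^+ 2 = (4 * z) ^+ 2 by ring.
  by apply: lerXn2r; rewrite ?nnegrE; lra.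
apply: (@le_trans _ _ (16 * K)); last by rewrite lerDr !mulr_ge0.
have {n2} : 3 <= `|n%:~R : R|.
  by move: n2; rewrite -intr_norm -[2]/((2 : int)%:~R) -[3]/((3 : int)%:~R) ltr_int ler_int -lezD1.
case: (leP 0 (n%:~R : R)) => [n0|n0]; first by rewrite ger0_norm//; exact: pos.
by rewrite ltr0_norm// -diff4_pwN; exact: pos.
Qed.

End fourth_difference.

Section fourier_coefficients.
Context {R : realType} (d : nat) (beta : R).
Hypotheses (beta0 : 0 < beta) (beta2 : beta < 2) (betad : beta < d%:R).
Notation mu := (@lebesgue_tuple R d).

Definition rho (s : R) : R := - (cos_potential d beta 1 / 16) * diff4 (pw (2 - beta)) s.

(** A second difference with unit step multiplies [cos (t * r)] by [- 2 * (1 - cos r)]; two of them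
    multiply it by 16 times the fourth power of the sine. Constants have zero fourth difference, so
    [cos] may become [1 - cos] with a change of sign. *)
Lemma sin4_cos (r s : R) : sin (r / 2) ^+ 4 * cos (r * s) =
  - 16^-1 * diff4 (fun t => 1 - cos (t * r)) s.
Proof.
have -> : sin (r / 2) ^+ 4 = (1 - cos r) ^+ 2 / 4.
  have -> : cos r = 1 - 2 * sin (r / 2) ^+ 2.
    rewrite [in LHS](_ : r = r / 2 + r / 2); last by field.
    by rewrite cosD -!expr2 cos2sin2; ring.
  by field.
rewrite /diff4.
have -> : (s + 2) * r = r * s + (r + r) by ring.
have -> : (s + 1) * r = r * s + r by ring.
have -> : (s - 1) * r = r * s - r by ring.
have -> : (s - 2) * r = r * s - (r + r) by ring.
have c2 : cos (r + r) = 2 * cos r ^+ 2 - 1.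
  by rewrite cosD -!expr2 sin2cos2; ring.
rewrite (mulrC s r) (cosD (r * s) r) (cosD (r * s) (r + r)).
rewrite (cosB (r * s) r) (cosB (r * s) (r + r)) c2.
by field.
Qed.

Lemma g_te_cos (s : R) (x : d.-tuple R) : g_te beta x * cos (enorm x * s) =
  - 16^-1 * diff4 (fun t => cos_weight beta t x) s.
Proof.
rewrite /g_te mulrAC sin4_cos /diff4 /cos_weight.
by ring.
Qed.

(** Thanks to the form [1 - cos], the five terms of the fourth difference are separately integrable,
    and each integral is a multiple of [cos_potential d beta 1]. *)
Lemma cos_transform_g_te (s : R) : cos_transform (@g_te R d beta) s = rho s.
Proof.
have ic t := integrable_cos_weight beta0 beta2 betad t.
have iZ c t : mu.-integrable setT (EFin \o (fun x => c * cos_weight beta t x)).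
  have := integrableZl measurableT c (ic t).
  by apply: eq_integrable.
have iD (f g : d.-tuple R -> R) : mu.-integrable setT (EFin \o f) -> mu.-integrable setT (EFin \o g) ->
    mu.-integrable setT (EFin \o (fun x => f x + g x)).
  by move=> fi gi; have := integrableD measurableT fi gi; apply: eq_integrable.
transitivity (\int[mu]_x (- 16^-1 * cos_weight beta (s + 2) x + (4 / 16 * cos_weight beta (s + 1) x +
   (- (6 / 16) * cos_weight beta s x + (4 / 16 * cos_weight beta (s - 1) x +
    (- 16^-1) * cos_weight beta (s - 2) x))))).
  by apply: eq_Rintegral => x _; rewrite g_te_cos /diff4; field.
do 3 (rewrite RintegralD//; last by do ?[exact: iZ | apply/iD]).
rewrite RintegralD//.
rewrite !RintegralZl//.
have e t : \int[mu]_x cos_weight beta t x = pw (2 - beta) t * cos_potential d beta 1.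
  exact: cos_potentialE.
by rewrite !e /rho /diff4; field.
Qed.

Lemma g_te_ge0 (x : d.-tuple R) : 0 <= g_te beta x.
Proof. by rewrite /g_te mulr_ge0 ?powR_ge0// exprn_even_ge0. Qed.

Lemma C_te_EE : C_te_E d beta = 4 / (2 * pi) ^+ d * rho 0.
Proof.
rewrite /C_te_E -cos_transform_g_te /cos_transform /Rintegral Lnorm1; congr (_ * fine _).
apply: eq_integral => x _ /=.
by rewrite ger0_norm ?g_te_ge0// mulr0 cos0 mulr1.
Qed.

(** At 0 the fourth difference equals twice [2] to the power [2 - beta], minus 8, which is negative
    because [beta > 0]. *)
Lemma rho0_gt0 : 0 < rho 0.
Proof.
have cp := cos_potential_gt0 beta0 beta2 betad.
have a2 : 2 - beta != 0 by rewrite gt_eqF// subr_gt0.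
rewrite /rho /diff4 !add0r !pwN (_ : pw _ 0 = 0); last by rewrite /pw normr0 powR0.
rewrite (_ : pw _ 1 = 1); last by rewrite /pw normr1 powR1.
have : pw (2 - beta) 2 < 4.
  rewrite /pw ger0_norm// (_ : 4 = 2 `^ 2); last by rewrite (powR_mulrn 2)//; ring.
  by rewrite /powR pnatr_eq0/= ltr_expR ltr_pM2r ?ln_gt0 ?ltr1n// ltrBlDr ltrDl.
nra.
Qed.

Lemma C_te_E_gt0 : 0 < C_te_E d beta.
Proof.
by rewrite C_te_EE mulr_gt0 ?rho0_gt0// divr_gt0// exprn_gt0// mulr_gt0// pi_gt0.
Qed.

Lemma rho_decay : exists2 C, 0 <= C & forall n : int, `|rho n%:~R| <= C / (`|n%:~R| + 1) ^+ 2.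
Proof.
have a0 : 0 < 2 - beta by rewrite subr_gt0.
have a2 : 2 - beta < 2 by rewrite ltrBlDr ltrDl.
have [C C0 hC] := diff4_pw_decay a0 a2.
exists (`|- (cos_potential d beta 1 / 16)| * C) => [|n]; first by rewrite mulr_ge0.
by rewrite /rho normrM -mulrA ler_wpM2l.
Qed.

Lemma rhoN s : rho (- s) = rho s.
Proof. by rewrite /rho diff4_pwN. Qed.

Lemma C_te_VE : C_te_V d beta = 128 / (3 * (2 * pi) ^+ (2 * d)) *
  fine (\esum_(j in [set: int]) ((rho j%:~R) ^+ 2)%:E)%E.
Proof.
rewrite /C_te_V; congr (_ * fine _); apply: eq_esum => j _.
by rewrite cos_transform_g_te.
Qed.

End fourier_coefficients.

Section second_difference_covariance.
Context {R : realType} (d : nat) (beta theta : R).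
Hypotheses (beta0 : 0 < beta) (beta2 : beta < 2) (betad : beta < d%:R) (theta0 : 0 < theta).

Definition rescaled_covariance (t s : R) : R :=
  wave_const d beta theta * ((pw (3 - beta) (t + s) - pw (3 - beta) (t - s)) / (2 * (3 - beta))
    - Num.min t s * pw (2 - beta) (t - s)).

Definition mixed_diff2 (K : R -> R -> R) (t s : R) : R :=
  let D s' := K (t + 1) s' + K (t - 1) s' - 2 * K t s' in
  D (s + 1) + D (s - 1) - 2 * D s.

(** The weight [t + s] passes through the differences: the corrections that it creates in [t] and in
    [s] have opposite signs on functions of [t - s] and cancel. *)
Lemma mixed_diff2E (a b c : R) (f g : R -> R) (t s : R) :
  mixed_diff2 (fun t s => a * f (t + s) + b * f (t - s) + c * (t + s) * g (t - s)) t s =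
  a * diff4 f (t + s) + b * diff4 f (t - s) + c * (t + s) * diff4 g (t - s).
Proof.
rewrite /mixed_diff2 /diff4.
have -> : t + 1 + (s + 1) = t + s + 2 by ring.
have -> : t + 1 + (s - 1) = t + s by ring.
have -> : t - 1 + (s + 1) = t + s by ring.
have -> : t - 1 + (s - 1) = t + s - 2 by ring.
have -> : t + 1 + s = t + s + 1 by ring.
have -> : t - 1 + s = t + s - 1 by ring.
have -> : t + (s + 1) = t + s + 1 by ring.
have -> : t + (s - 1) = t + s - 1 by ring.
have -> : t + 1 - (s + 1) = t - s by ring.
have -> : t + 1 - (s - 1) = t - s + 2 by ring.
have -> : t - 1 - (s + 1) = t - s - 2 by ring.
have -> : t - 1 - (s - 1) = t - s by ring.
have -> : t + 1 - s = t - s + 1 by ring.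
have -> : t - 1 - s = t - s - 1 by ring.
have -> : t - (s + 1) = t - s - 1 by ring.
have -> : t - (s - 1) = t - s + 1 by ring.
by ring.
Qed.

Definition kappa : R := 4 / (2 * pi) ^+ d * theta `^ (- (beta / 2)).

Definition gam (t s : R) : R := mixed_diff2 rescaled_covariance t s.

Definition gam_rest (t s : R) : R :=
  wave_const d beta theta * ((2 * (3 - beta))^-1 * diff4 (pw (3 - beta)) (t + s) +
    (2^-1 - (2 * (3 - beta))^-1) * diff4 (pw (3 - beta)) (t - s)).

(** The minimum is half of [t + s - |t - s|]; the factor [|t - s|] raises the exponent [2 - beta] to
    [3 - beta], which sends that part to [gam_rest]. The constant [kappa] satisfies [kappa *
    cos_potential d beta 1 = 8 * wave_const d beta theta]. *)
Lemma gamE t s : gam t s = kappa * (t + s) * rho d beta (t - s) + gam_rest t s.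
Proof.
pose w := wave_const d beta theta.
have b3 : 3 - beta != 0 by rewrite gt_eqF// subr_gt0 (lt_trans beta2)// ltr_nat.
have ek : kappa * cos_potential d beta 1 = 8 * w.
  by rewrite /kappa /w /wave_const; field; rewrite expf_neq0// mulf_neq0// gt_eqF ?pi_gt0.
rewrite /gam (_ : rescaled_covariance = fun t s => w * (2 * (3 - beta))^-1 * pw (3 - beta) (t + s) +
    w * (2^-1 - (2 * (3 - beta))^-1) * pw (3 - beta) (t - s) +
    (- w * 2^-1) * (t + s) * pw (2 - beta) (t - s)).
  rewrite mixed_diff2E /gam_rest /rho -/w.
  have -> : kappa * (t + s) * (- (cos_potential d beta 1 / 16) * diff4 (pw (2 - beta)) (t - s)) =
    - (kappa * cos_potential d beta 1) * (t + s) * diff4 (pw (2 - beta)) (t - s) / 16 by field.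
  by rewrite ek; field.
apply/funext => t'; apply/funext => s'; rewrite /rescaled_covariance -/w.
have a0 : 0 < 2 - beta by rewrite subr_gt0.
have -> : pw (3 - beta) (t' - s') = `|t' - s'| * pw (2 - beta) (t' - s').
  by rewrite -pwS//; congr pw; ring.
have -> : Num.min t' s' = (t' + s' - `|t' - s'|) / 2.
  have [ts|ts] := leP t' s'.
    by rewrite ler0_norm ?subr_le0//; field.
  by rewrite gtr0_norm ?subr_gt0//; field.
by field.
Qed.

Lemma gamC t s : gam t s = gam s t.
Proof.
rewrite !gamE /gam_rest (addrC s t) -(opprB t s) rhoN !diff4_pwN.
by [].
Qed.

Lemma rescaled_covariance_scale (delta t s : R) : 0 < delta ->
  rescaled_covariance (delta * t) (delta * s) = delta `^ (3 - beta) * rescaled_covariance t s.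
Proof.
move=> d0; rewrite /rescaled_covariance -mulrDr -mulrBr !pwM.
have -> : Num.min (delta * t) (delta * s) = delta * Num.min t s by rewrite minr_pMr// ltW.
have -> : pw (3 - beta) delta = delta `^ (3 - beta) by rewrite /pw gtr0_norm.
have e : delta `^ (3 - beta) = delta * pw (2 - beta) delta.
  have a0 : 0 < 2 - beta by rewrite subr_gt0.
  have := pwS delta a0; rewrite (gtr0_norm d0) => <-.
  by rewrite /pw gtr0_norm//; congr (_ `^ _); ring.
have -> : delta * Num.min t s * (pw (2 - beta) delta * pw (2 - beta) (t - s)) =
  delta `^ (3 - beta) * (Num.min t s * pw (2 - beta) (t - s)) by rewrite e; ring.
by ring.
Qed.

Lemma kappa_gt0 : 0 < kappa.
Proof.
by rewrite mulr_gt0 ?powR_gt0// divr_gt0// exprn_gt0// mulr_gt0// pi_gt0.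
Qed.

Lemma gam_rest_bounded : exists B, forall i j : nat, `|gam_rest i%:R j%:R| <= B.
Proof.
have a0 : 0 < 3 - beta by rewrite subr_gt0 (lt_trans beta2)// ltr_nat.
have a3 : 3 - beta < 3 by rewrite ltrBlDr ltrDl.
have [C hC] := diff4_pw_bounded a0 a3.
exists (`|wave_const d beta theta| * (`|(2 * (3 - beta))^-1| * C + `|2^-1 - (2 * (3 - beta))^-1| * C)).
move=> i j; rewrite normrM ler_wpM2l// (le_trans (ler_normD _ _))// !normrM.
have hp : (i%:R + j%:R : R) = (i%:Z + j%:Z)%:~R by rewrite rmorphD.
have hm : (i%:R - j%:R : R) = (i%:Z - j%:Z)%:~R by rewrite rmorphB.
by rewrite lerD// -?normrM ?normrM ler_wpM2l// ?hp ?hm hC.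
Qed.

End second_difference_covariance.

(** * Asymptotics of the covariance array *)

Section elementary_sums.
Context {R : realType}.

(** The bounded function [x / (|x| + 1)] has increments dominating half the inverse square. The
    excluded interval []-1, 0[] contains no integer. *)
Lemma inv_sqr_le_telescope (x : R) : 0 <= x \/ x <= - 1 ->
  (`|x| + 1) ^- 2 <= 2 * ((x + 1) / (`|x + 1| + 1) - x / (`|x| + 1)).
Proof.
move=> [x0|x1].
  rewrite (ger0_norm x0) ger0_norm ?addr_ge0//.
  rewrite -subr_ge0 (_ : _ - _ = x / ((x + 1) ^+ 2 * (x + 2))); last first.
    by field; rewrite !gt_eqF// ltr_wpDl.
  by rewrite divr_ge0// mulr_ge0 ?exprn_ge0// addr_ge0.
have x0 : x <= 0 by rewrite (le_trans x1)// oppr_le0.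
have x2 : x + 1 <= 0 by rewrite -lerBrDr sub0r.
rewrite (ler0_norm x0) ler0_norm//.
have xlt : x < 0 by rewrite (le_lt_trans x1)// oppr_lt0.
rewrite -subr_ge0 (_ : _ - _ = (2 - x) / (- x * (- x + 1) ^+ 2)); last first.
  have nx : - x != 0 by rewrite oppr_eq0 lt_eqF.
  have nx1 : - x + 1 != 0 by rewrite gt_eqF// ltr_wpDl// oppr_ge0.
  by field; rewrite nx1 -oppr_eq0 nx opprD subrK nx.
by rewrite divr_ge0// ?mulr_ge0 ?exprn_ge0// ?subr_ge0 ?oppr_ge0// ?(le_trans x0)// addr_ge0// oppr_ge0.
Qed.

Lemma sum_inv_sqr_dist_le (m i : nat) : \sum_(j < m) (`|i%:R - j%:R : R| + 1) ^- 2 <= 4.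
Proof.
pose phi (x : R) := x / (`|x| + 1).
have phi1 x : `|phi x| <= 1.
  rewrite /phi normrM normfV (@ger0_norm _ (`|x| + 1)) ?addr_ge0// ler_pdivrMr ?ltr_wpDl//.
  by rewrite mul1r lerDl.
apply: (@le_trans _ _ (2 * (phi (m%:R - i%:R) - phi (- i%:R)))); last first.
  rewrite (_ : 4 = 2 * (1 + 1)); last by ring.
  rewrite ler_wpM2l// lerD//; first by rewrite (le_trans (ler_norm _)).
  by rewrite (le_trans (ler_norm _))// normrN.
elim: m => [|m IH]; first by rewrite big_ord0 sub0r subrr mulr0.
rewrite big_ord_recr/= (distrC i%:R m%:R).
have := @inv_sqr_le_telescope (m%:R - i%:R).
have -> : (m%:R - i%:R + 1 : R) = m.+1%:R - i%:R by rewrite -natr1; ring.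
rewrite -/(phi _) -/(phi _) => h.
apply: le_trans (lerD IH (h _)) _.
  have [im|mi] := leqP i m; first by left; rewrite subr_ge0 ler_nat.
  by right; rewrite lerBlDr -lerBlDl opprK natr1 ler_nat.
by lra.
Qed.

Lemma cvg_inv_nat : (m.+1%:R^-1 : R) @[m --> \oo] --> (0 : R).
Proof. exact: cvg_harmonic. Qed.

Lemma cvg_arithmetic_mean (u : nat -> R) (l : R) : u m @[m --> \oo] --> l ->
  ((\sum_(i < m.+1) u i) / m.+1%:R) @[m --> \oo] --> l.
Proof.
move=> ul; have := cesaro ul.
rewrite /arithmetic_mean /series /=; under eq_fun do rewrite big_mkord mulrC.
by [].
Qed.

Lemma sum_sqr_nat (m : nat) :
  \sum_(i < m) (i.+1%:R : R) ^+ 2 = m%:R * (m%:R + 1) * (2 * m%:R + 1) / 6.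
Proof.
elim: m => [|m IH]; first by rewrite big_ord0 !mul0r.
by rewrite big_ord_recr/= IH -natr1; field.
Qed.

Lemma cvg_weighted_mean (u : nat -> R) (l : R) : u m @[m --> \oo] --> l ->
  ((\sum_(i < m.+1) i.+1%:R ^+ 2 * u i) / m.+1%:R ^+ 3) @[m --> \oo] --> l / 3.
Proof.
move=> ul.
have n0 (m : nat) : (m.+1%:R : R) != 0 by rewrite pnatr_eq0.
have e m : (\sum_(i < m.+1) i.+1%:R ^+ 2 * u i) / m.+1%:R ^+ 3 =
    (\sum_(i < m.+1) i.+1%:R ^+ 2 * (u i - l)) / m.+1%:R ^+ 3 +
    l / 6 * ((1 + m.+1%:R^-1) * (2 + m.+1%:R^-1)).
  have -> : \sum_(i < m.+1) i.+1%:R ^+ 2 * u i =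
      \sum_(i < m.+1) i.+1%:R ^+ 2 * (u i - l) + l * \sum_(i < m.+1) (i.+1%:R : R) ^+ 2.
    by rewrite mulr_sumr -big_split/=; apply: eq_bigr => i _; ring.
  rewrite sum_sqr_nat mulrDl; congr (_ + _).
  by have := n0 m; move: (m.+1%:R : R) => M M0; field.
under eq_fun do rewrite e.
have h2 : (l / 6 * ((1 + m.+1%:R^-1) * (2 + m.+1%:R^-1))) @[m --> \oo] --> l / 6 * ((1 + 0) * (2 + 0)).
  by apply: cvgM; [exact: cvg_cst|apply: cvgM; apply: cvgD; by [exact: cvg_cst|exact: cvg_inv_nat]].
rewrite (_ : l / 3 = 0 + l / 6 * ((1 + 0) * (2 + 0))); last by field.
apply: cvgD h2.
have hn : `|u m - l| @[m --> \oo] --> (0 : R).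
  have : (u m - l) @[m --> \oo] --> l - l by apply: cvgB => //; exact: cvg_cst.
  by rewrite subrr => /cvg_norm; rewrite normr0.
apply: norm_cvg0.
apply: (squeeze_cvgr _ (cvg_cst 0) (cvg_arithmetic_mean hn)).
near=> m; rewrite normr_ge0/= normrM normfV (ger0_norm (exprn_ge0 _ _))//.
(* Bounding every weight by the largest one, [m.+1 ^+ 2], reduces the error to an ordinary
   arithmetic mean of [|u i - l|]. *)
rewrite ler_pdivrMr ?exprn_gt0// (_ : _ / _ * _ = (\sum_(i < m.+1) `|u i - l|) * m.+1%:R ^+ 2); last first.
  by have := n0 m; move: (m.+1%:R : R) => M M0; field.
apply: le_trans (ler_norm_sum _ _ _) _.
rewrite mulr_suml ler_sum// => i _.
rewrite normrM mulrC ler_wpM2l// ger0_norm ?exprn_ge0// lerXn2r ?nnegrE// ler_nat.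
exact: ltn_ord.
Unshelve. all: by end_near. Qed.

End elementary_sums.

Section two_sided_sum.
Context {R : realType}.

Lemma esum_int_even (u : nat -> R) (S : R) : (forall n, 0 <= u n) ->
  (\sum_(i < m) u i) @[m --> \oo] --> S ->
  (\esum_(j in [set: int]) (u `|j|%N)%:E)%E = (2 * S - u 0)%:E.
Proof.
move=> u0 uS.
have e0 (v : nat -> R) (l : R) : (forall n, 0 <= v n) ->
    (\sum_(i < m) v i) @[m --> \oo] --> l -> (\esum_(j in [set: nat]) (v j)%:E)%E = l%:E.
  move=> v0 vl; rewrite -nneseries_esumT; last by move=> n; rewrite lee_fin.
  apply: cvg_lim => //; under eq_fun do rewrite sumEFin big_mkord.
  by apply: cvg_EFin; [exact: nearW|exact: vl].
rewrite (esumID [set Posz n | n in setT]); last by move=> j _; rewrite lee_fin.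
rewrite setTI esum_image; last by move=> a b _ _ [].
rewrite (e0 u S)//.
have -> : [set: int] `&` ~` [set Posz n | n in setT] = [set Negz n | n in setT].
  apply/seteqP; split => [[n [_ []]|n _]|j [n _ <-]].
  - by exists n.
  - by exists n.
  - by split => // -[].
rewrite esum_image; last by move=> a b _ _ [].
rewrite (e0 (fun n => u n.+1) (S - u 0))//.
  by rewrite -EFinD; congr EFin; ring.
have -> : (fun m => \sum_(i < m) u i.+1) = (fun m => \sum_(i < m.+1) u i - u 0).
  by apply/funext => m; rewrite big_ord_recl addrAC subrr add0r.
apply: cvgB; last exact: cvg_cst.
by rewrite (cvg_shiftS (fun m => \sum_(i < m) u i)).
Qed.

End two_sided_sum.

Section covariance_array.
Context {R : realType} (g e : nat -> nat -> R) (rho : R -> R) (k0 B C : R).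
Hypotheses (k0_ge0 : 0 <= k0) (C0 : 0 <= C).
Hypothesis gC : forall i j, g i j = g j i.
Hypothesis gE : forall i j, g i j = k0 * (i.+1%:R + j.+1%:R) * rho (i%:R - j%:R) + e i j.
Hypothesis eB : forall i j, `|e i j| <= B.
Hypothesis rhoC : forall i j : nat, `|rho (i%:R - j%:R)| <= C * (`|i%:R - j%:R| + 1) ^- 2.

Let B0 : 0 <= B. Proof. exact: le_trans (eB 0 0). Qed.

Let rhoC1 (k : nat) : `|rho k%:R| <= C * k.+1%:R ^- 2.
Proof. by have := rhoC k 0; rewrite subr0 normr_nat -natr1. Qed.

Let sum_inv_sqr m : \sum_(k < m) (k.+1%:R : R) ^- 2 <= 4.
Proof.
apply: le_trans (sum_inv_sqr_dist_le m 0); rewrite le_eqVlt; apply/orP; left; apply/eqP.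
by apply: eq_bigr => k _; rewrite sub0r normrN normr_nat natr1.
Qed.

(** The weight is at most [2 * m] and the inverse squares sum to at most 4, whence the 8. *)
Lemma row_sum_le m i : (i < m)%N -> \sum_(j < m) `|g i j| <= (8 * k0 * C + B) * m%:R.
Proof.
move=> im; apply: (@le_trans _ _ (\sum_(j < m) (k0 * (2 * m%:R) * C * (`|i%:R - j%:R| + 1) ^- 2 + B))).
  apply: ler_sum => j _; rewrite gE (le_trans (ler_normD _ _))// lerD//.
  rewrite !normrM (ger0_norm k0_ge0) -mulrA -[leRHS]mulrA -[leRHS]mulrA ler_wpM2l//.
  rewrite ler_pM// ger0_norm// mulr_natl mulr2n lerD// ler_nat//.
rewrite big_split/= sumr_const card_ord -mulr_sumr [leRHS]mulrDl lerD//; last by rewrite mulr_natr.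
rewrite (_ : 8 * k0 * C * m%:R = k0 * (2 * m%:R) * C * 4); last by ring.
by rewrite ler_wpM2l ?sum_inv_sqr_dist_le// !mulr_ge0.
Qed.

(** On the diagonal the weights [2 * i.+1] add up to [m ^+ 2 + m]. *)
Lemma trace_le m : `|\sum_(i < m) g i i - k0 * rho 0 * m%:R ^+ 2| <= (`|k0 * rho 0| + B) * m%:R.
Proof.
have -> : \sum_(i < m) g i i - k0 * rho 0 * m%:R ^+ 2 = k0 * rho 0 * m%:R + \sum_(i < m) e i i.
  elim: m => [|m IH]; first by rewrite !big_ord0; ring.
  rewrite !big_ord_recr/= gE subrr -natr1.
  move: IH; move: (\sum_(i < m) g i i) => G IH.
  have -> : G = k0 * rho 0 * m%:R + \sum_(i < m) e i i + k0 * rho 0 * m%:R ^+ 2.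
    by rewrite -IH subrK.
  by ring.
rewrite (le_trans (ler_normD _ _))// mulrDl lerD//; first by rewrite normrM normr_nat.
rewrite (le_trans (ler_norm_sum _ _ _))// mulr_natr -[X in _ *+ X](card_ord m) -sumr_const.
exact: ler_sum.
Qed.

Lemma cvg_sum_rho_sqr : cvg ((\sum_(k < m) rho k%:R ^+ 2) @[m --> \oo]).
Proof.
apply: nondecreasing_is_cvgn.
  apply/nondecreasing_seqP => n; rewrite big_ord_recr/= lerDl; exact: sqr_ge0.
exists (C ^+ 2 * 4) => _ [m _ <-].
apply: (@le_trans _ _ (C ^+ 2 * \sum_(k < m) k.+1%:R ^- 2)); last first.
  by rewrite ler_wpM2l// sqr_ge0.
rewrite mulr_sumr ler_sum// => k _.
rewrite -real_normK ?num_real//.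
have k1 : 0 <= k.+1%:R ^- 2 :> R by rewrite invr_ge0 exprn_ge0.
apply: (@le_trans _ _ ((C * k.+1%:R ^- 2) ^+ 2)); first by rewrite lerXn2r ?nnegrE// mulr_ge0.
rewrite exprMn ler_wpM2l ?sqr_ge0// expr2 ler_piMl//.
by rewrite invf_le1 ?exprn_gt0// exprn_ege1// ler1n.
Qed.

(** The border added when the matrix grows by one row and one column, indexed by the distance [k] to
    the diagonal; the corner is counted twice and subtracted once. *)
Let b m := 2 * (\sum_(k < m.+1) g m (m - k)%N ^+ 2) - g m m ^+ 2.

Let frobenius m : \sum_(i < m) \sum_(j < m) g i j ^+ 2 = \sum_(i < m) b i.
Proof.
elim: m => [|m IH]; first by rewrite !big_ord0.
rewrite big_ord_recr/= [RHS]big_ord_recr/= -IH /b.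
under eq_bigr do rewrite big_ord_recr/=.
rewrite big_split/= -addrA; congr (_ + _).
have -> : \sum_(k < m.+1) g m (m - k)%N ^+ 2 = \sum_(j < m.+1) g m j ^+ 2.
  rewrite [RHS](reindex_inj rev_ord_inj)/=; apply: eq_bigr => k _.
  by rewrite subSS.
under eq_bigr do rewrite gC.
by rewrite big_ord_recr/=; ring.
Qed.

Let D := k0 * C + B.
Let a (k : nat) := 2 * k0 * rho k%:R.

(** At distance [k] from the corner the weight is [2 * m.+1 - k], so the rescaled entry tends to
    [a k]. The deviation is at most [D / m.+1], because [k * rho k] is bounded by [C]. *)
Let approx m (k : nat) : (k <= m)%N ->
  `|(g m (m - k)%N / m.+1%:R) ^+ 2 - a k ^+ 2| <= (2 * D * (2 * k0 * C) * k.+1%:R ^- 2 + D ^+ 2 / m.+1%:R) / m.+1%:R.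
Proof.
move=> km; set M : R := m.+1%:R.
have M0 : 0 < M by rewrite ltr0n.
have M1 : 1 <= M by rewrite ler1n.
pose h := (- k0 * (k%:R * rho k%:R) + e m (m - k)%N) / M.
have -> : g m (m - k)%N / M = a k + h.
  have ek : (m - k).+1%:R = M - k%:R by rewrite /M -natr1 natrB// -natr1; ring.
  rewrite gE natrB// opprB addrCA subrr addr0 ek -/M /h /a.
  by field; rewrite gt_eqF.
have D0 : 0 <= D by rewrite addr_ge0// mulr_ge0.
have hD : `|h| <= D / M.
  rewrite /h normrM normfV (gtr0_norm M0) ler_wpM2r ?invr_ge0 ?(ltW M0)//.
  rewrite (le_trans (ler_normD _ _))// lerD// !normrM normrN (ger0_norm k0_ge0) ler_wpM2l//.
  rewrite normr_nat (le_trans (ler_wpM2l _ (rhoC1 k)))//.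
  rewrite mulrCA ler_piMr// ler_pdivrMr ?exprn_gt0// mul1r.
  apply: (@le_trans _ _ k.+1%:R); first by rewrite ler_nat.
  by rewrite expr2 ler_peMl// ler1n.
have aC : `|a k| <= 2 * k0 * C * k.+1%:R ^- 2.
  by rewrite /a normrM ger0_norm ?mulr_ge0// -[leRHS]mulrA ler_wpM2l// mulr_ge0.
have -> : (a k + h) ^+ 2 - a k ^+ 2 = 2 * (a k * h) + h ^+ 2 by ring.
rewrite (le_trans (ler_normD _ _))// [leRHS]mulrDl lerD//.
  rewrite normrM (@ger0_norm _ 2)// normrM.
  rewrite (_ : 2 * D * (2 * k0 * C) * _ / M = 2 * (2 * k0 * C * k.+1%:R ^- 2 * (D / M))); last by ring.
  by rewrite ler_wpM2l// ler_pM.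
rewrite normrX (_ : _ / M / M = (D / M) ^+ 2); last by field; rewrite gt_eqF.
by rewrite lerXn2r ?nnegrE// divr_ge0// ltW.
Qed.

Lemma cvg_frobenius (S : R) : (\sum_(k < m) rho k%:R ^+ 2) @[m --> \oo] --> S ->
  ((\sum_(i < m.+1) \sum_(j < m.+1) g i j ^+ 2) / m.+1%:R ^+ 3) @[m --> \oo] -->
    4 / 3 * k0 ^+ 2 * (2 * S - rho 0 ^+ 2).
Proof.
move=> hS; under eq_fun do rewrite frobenius.
have -> : 4 / 3 * k0 ^+ 2 * (2 * S - rho 0 ^+ 2) = (4 * k0 ^+ 2 * (2 * S - rho 0 ^+ 2)) / 3.
  by field.
pose u m := b m / m.+1%:R ^+ 2.
have bu m : b m = m.+1%:R ^+ 2 * u m.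
  by rewrite /u mulrC divfK// expf_neq0// pnatr_eq0.
under eq_fun do under eq_bigr do rewrite bu.
apply: cvg_weighted_mean.
pose v m := 2 * (\sum_(k < m.+1) a k ^+ 2) - a 0 ^+ 2.
have va : v m @[m --> \oo] --> 4 * k0 ^+ 2 * (2 * S - rho 0 ^+ 2).
  have -> : v = fun m => 4 * k0 ^+ 2 * (2 * (\sum_(k < m.+1) rho k%:R ^+ 2) - rho 0 ^+ 2).
    apply/funext => m; rewrite /v /a.
    under eq_bigr do rewrite exprMn.
    by rewrite -mulr_sumr; ring.
  apply: cvgM; first exact: cvg_cst.
  apply: cvgB; last exact: cvg_cst.
  apply: cvgM; first exact: cvg_cst.
  by rewrite (cvg_shiftS (fun m => \sum_(k < m) rho k%:R ^+ 2)).
(* Two thirds for the doubled border sum, one third for the corner. *)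
pose K := 3 * (2 * D * (2 * k0 * C) * 4 + D ^+ 2).
have D0 : 0 <= D by rewrite addr_ge0// mulr_ge0.
have DC0 : 0 <= 2 * D * (2 * k0 * C) by rewrite !mulr_ge0.
have uv m : `|u m - v m| <= K * m.+1%:R^-1.
  have M0 : 0 < m.+1%:R :> R by rewrite ltr0n.
  have -> : u m - v m = 2 * (\sum_(k < m.+1) ((g m (m - k)%N / m.+1%:R) ^+ 2 - a k ^+ 2))
      - ((g m (m - 0)%N / m.+1%:R) ^+ 2 - a 0 ^+ 2).
    rewrite sumrB /u /v /b subn0.
    have -> : \sum_(k < m.+1) (g m (m - k)%N / m.+1%:R) ^+ 2 =
        (\sum_(k < m.+1) g m (m - k)%N ^+ 2) / m.+1%:R ^+ 2.
      by rewrite mulr_suml; apply: eq_bigr => k _; rewrite exprMn exprVn.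
    by rewrite expr_div_n; ring.
  have bnd : \sum_(k < m.+1) `|(g m (m - k)%N / m.+1%:R) ^+ 2 - a k ^+ 2| <= K / 3 * m.+1%:R^-1.
    apply: (@le_trans _ _ (\sum_(k < m.+1) (2 * D * (2 * k0 * C) * k.+1%:R ^- 2 + D ^+ 2 / m.+1%:R) / m.+1%:R)).
      by apply: ler_sum => k _; apply: approx; rewrite -ltnS.
    rewrite -mulr_suml ler_wpM2r ?invr_ge0//.
    rewrite big_split/= sumr_const card_ord -mulr_sumr -[X in _ + X]mulr_natr divfK ?gt_eqF//.
    rewrite (_ : K / 3 = 2 * D * (2 * k0 * C) * 4 + D ^+ 2); last by rewrite /K; field.
    by rewrite lerD2r ler_wpM2l// sum_inv_sqr.
  have bnd0 : `|(g m (m - 0)%N / m.+1%:R) ^+ 2 - a 0 ^+ 2| <= K / 3 * m.+1%:R^-1.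
    apply: le_trans bnd; rewrite big_ord_recl lerDl.
    exact: sumr_ge0.
  rewrite (le_trans (ler_normB _ _))// normrM ger0_norm//.
  rewrite (_ : K * m.+1%:R^-1 = 2 * (K / 3 * m.+1%:R^-1) + K / 3 * m.+1%:R^-1); last by field.
  rewrite lerD// ler_wpM2l// (le_trans _ bnd)//.
  exact: ler_norm_sum.
have uv0 : (u m - v m) @[m --> \oo] --> (0 : R).
  apply: norm_cvg0.
  have K0 : (K * m.+1%:R^-1) @[m --> \oo] --> (0 : R).
    by rewrite -[0](mulr0 K); apply: cvgM; [exact: cvg_cst|exact: cvg_inv_nat].
  apply: (squeeze_cvgr _ (cvg_cst 0) K0).
  by apply: nearW => m; rewrite normr_ge0/=.
have -> : u = (fun m => (u m - v m) + v m) by apply/funext => m; rewrite subrK.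
by rewrite -[X in _ --> X]add0r; apply: cvgD.
Qed.

End covariance_array.

(** * The estimator *)

Section law.
Context {d} {T : measurableType d} {R : realType} (P : probability T R).
Variables (G : probability (measurableTypeR R) R) (Y : T -> R).
Hypotheses (mY : measurable_fun setT Y)
  (lawY : forall A : set R, measurable A -> pushforward P Y A = G A).

Let integralG (f : R -> \bar R) :
  (\int[pushforward P (Y : T -> measurableTypeR R)]_x f x = \int[G]_x f x)%E.
Proof.
have mY' : measurable_fun setT (Y : T -> measurableTypeR R) by [].
by apply: (@eq_measure_integral _ _ _ _ G) => A mA _; exact: lawY.
Qed.

Lemma has_moments_law (h : R -> R) : has_moments G h -> has_moments P (h \o Y).
Proof.
move=> [mh ih]; split; first exact: measurableT_comp.
have mY' : measurable_fun setT (Y : T -> measurableTypeR R) by [].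
move=> n; have /integrableP[mhn] := ih n.
rewrite -integralG ge0_integral_pushforward//; last first.
  exact: measurableT_comp.
move=> fin; apply/integrableP; split=> //.
apply/measurable_EFinP/measurable_funX; apply: measurableT_comp => //.
exact: measurableT_comp.
Qed.

Lemma mean_law (h : R -> R) : has_moments G h ->
  Rintegral P setT (h \o Y) = Rintegral G setT h.
Proof.
move=> mh; rewrite /Rintegral -integralG.
have mY' : measurable_fun setT (Y : T -> measurableTypeR R) by [].
rewrite integral_pushforward//.
  by apply/measurable_EFinP; case: mh.
exact: has_moments_integrable (has_moments_law mh).
Qed.

End law.

Section linear_span.
Context {d} {T : measurableType d} {R : realType} (P : probability T R).
Context (I : Type) (X : I -> {RV P >-> R}).

Definition lin_span : set (T -> R) := [set Y | exists n (i : 'I_n -> I) (c : 'I_n -> R),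
  Y = fun w => \sum_(k < n) c k * X (i k) w].

Lemma lin_span1 i : lin_span (X i).
Proof.
exists 1%N, (fun=> i), (fun=> 1); apply/funext => w.
by rewrite big_ord1 mul1r.
Qed.

Lemma lin_span_comb a Y Z : lin_span Y -> lin_span Z -> lin_span (fun w => Y w + a * Z w).
Proof.
move=> [n [i [c ->]]] [m [j [b ->]]].
exists (n + m)%N, (fun k => match fintype.split k with inl l => i l | inr l => j l end),
  (fun k => match fintype.split k with inl l => c l | inr l => a * b l end).
apply/funext => w; rewrite big_split_ord/=; congr (_ + _).
  by apply: eq_bigr => k _; rewrite (unsplitK (inl k)).
by rewrite mulr_sumr; apply: eq_bigr => k _; rewrite (unsplitK (inr k)) mulrA.
Qed.

Let law_moments Y : gaussian_process X -> lin_span Y ->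
  exists m v, has_moments P Y /\ Rintegral P setT Y = m /\
   forall n, Rintegral P setT (fun w => (Y w - m) ^+ n.+1) =
     n%:R * v * Rintegral P setT (fun w => (Y w - m) ^+ n.-1).
Proof.
move=> GX [n [i [c ->]]]; have [m [v [v0 law]]] := GX n i c.
set Y' := fun w => _ in law *.
have mY : measurable_fun setT Y'.
  by apply: measurable_sum => k; apply: measurable_funM.
have [mG recG] := gaussian_prob_moments m v0.
have e k : Rintegral P setT (fun w => (Y' w - m) ^+ k) = \int[gaussian_prob m v]_x (x - m) ^+ k.
  exact: mean_law mY law _ (has_momentsX k mG).
have mYm : has_moments P (fun w => Y' w - m) by exact: has_moments_law mY law _ mG.
have mY' : has_moments P Y'.
  rewrite (_ : Y' = fun w => (Y' w - m) + m); last by apply/funext => w; rewrite subrK.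
  by apply: has_momentsD => //; exact: has_moments_cst.
exists m, v; split=> //; split; last by move=> k; rewrite !e recG.
(* The recursion at order 0 says that [Y' - m] has mean 0, which identifies [m] as the mean. *)
have := e 1%N; rewrite recG mul0r mul0r.
rewrite (_ : (fun w => _) = (fun w => Y' w - m)); last by apply/funext => w; rewrite expr1.
rewrite meanB//; last exact: has_moments_cst.
by rewrite mean_cst => /eqP; rewrite subr_eq0 => /eqP.
Qed.

Lemma centred_gaussian_space : centred_gaussian_process X -> gaussian_space P lin_span.
Proof.
move=> [GX X0]; split; first exact: lin_span_comb.
have mX i : has_moments P (X i).
  by have [m [v [mX _]]] := law_moments GX (lin_span1 i).
have EX i : Rintegral P setT (X i) = 0 by rewrite /Rintegral -expectation_def X0.
move=> Y LY; have [m [v [mY [EY recY]]]] := law_moments GX LY; split=> // n.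
have m0 : m = 0.
  rewrite -EY; case: LY => k [i [c ->]].
  rewrite mean_sum; last by move=> l _; exact: has_momentsZ.
  by rewrite big1// => l _; rewrite meanZ// EX mulr0.
have recY0 k : Rintegral P setT (fun w => Y w ^+ k.+1) = k%:R * v * Rintegral P setT (fun w => Y w ^+ k.-1).
  by have := recY k; rewrite m0; under eq_Rintegral do rewrite subr0; under [in X in _ = X -> _]eq_Rintegral do rewrite subr0.
rewrite [LHS]recY0; congr (_ * _ * _).
rewrite recY0 mul1r; under eq_Rintegral do rewrite expr0.
by rewrite mean_cst mulr1.
Qed.

End linear_span.

Section normal_limit.
Context {R : realType}.

Lemma gaussian_moments (v : R) (mu := fun p => \int[gaussian_prob 0 v]_x x ^+ p) : 0 <= v ->
  [/\ has_moments (gaussian_prob 0 v) (fun x => x), mu 0%N = 1 &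
    forall p, mu p.+1 = p%:R * v * mu p.-1].
Proof.
move=> v0; have [mG recG] := gaussian_prob_moments 0 v0.
have e (p : nat) : (fun x : measurableTypeR R => ((x : R) - 0) ^+ p) = (fun x => x ^+ p).
  by apply/funext => x; rewrite subr0.
split.
- by rewrite (_ : (fun x => x) = (fun x : measurableTypeR R => (x : R) - 0))//; apply/funext => x; rewrite subr0.
- by rewrite /mu -[RHS](mean_cst (gaussian_prob 0 v)); apply: eq_Rintegral => x _; rewrite expr0.
- by move=> p; rewrite /mu; have := recG p; rewrite !e.
Qed.

(** The recursion gives [(2n - 1)!!] times [v ^+ n] for the moment of order [2n], so the sequence
    consists of the terms of the exponential series at [t ^+ 2 * v / 2]. *)
Lemma normal_growth (mu : nat -> R) (v t : R) : mu 0%N = 1 ->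
  (forall p, mu p.+1 = p%:R * v * mu p.-1) ->
  t ^+ n.*2 / n.*2`!%:R * mu n.*2 @[n --> \oo] --> 0.
Proof.
move=> mu0 muS.
have e n : t ^+ n.*2 / n.*2`!%:R * mu n.*2 = exp_coeff (t ^+ 2 * v / 2) n.
  elim: n => [|n IH]; first by rewrite /exp_coeff /= double0 mu0 mulr1 !expr0.
  have -> : exp_coeff (t ^+ 2 * v / 2) n.+1 = t ^+ 2 * v / 2 / n.+1%:R * exp_coeff (t ^+ 2 * v / 2) n.
    by rewrite /exp_coeff/= exprS factS natrM invfM; ring.
  rewrite -IH doubleS muS/= !exprS !factS !natrM !invfM.
  have -> : n.*2.+2%:R = 2 * n.+1%:R :> R by rewrite -natrM mul2n.
  have h : n.*2.+1%:R != 0 :> R by rewrite pnatr_eq0.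
  have h' : n.+1%:R != 0 :> R by rewrite pnatr_eq0.
  move: (n.*2.+1%:R : R) (n.+1%:R : R) (n.*2`!%:R^-1 : R) h h' => x y z x0 y0.
  by field; rewrite x0 y0.
under eq_fun do rewrite e.
exact: cvg_series_cvg_0 (is_cvg_series_exp_coeff _).
Qed.

End normal_limit.

Section wave_increments.
Context {d' : measure_display} {T : measurableType d'} {R : realType} (P : probability T R).
Variables (d : nat) (beta theta : R) (u : {nonneg R} -> d.-tuple R -> {RV P >-> R}).
Hypotheses (beta0 : 0 < beta) (beta2 : beta < 2) (betad : beta < d%:R) (theta0 : 0 < theta).
Hypothesis wu : wave_solution beta theta u.
Variable x : d.-tuple R.
Local Notation E f := (Rintegral P setT f).

Definition solution_span := lin_span (fun p : {nonneg R} * d.-tuple R => u p.1 p.2).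

Lemma solution_span_gaussian : gaussian_space P solution_span.
Proof. exact: centred_gaussian_space wu.1. Qed.

Let L1 (t : {nonneg R}) : solution_span (u t x).
Proof. exact: (lin_span1 (fun p : {nonneg R} * d.-tuple R => u p.1 p.2) (t, x)). Qed.

Let has_moments_solution t : has_moments P (u t x).
Proof. exact: (solution_span_gaussian.2 _ (L1 t)).1. Qed.

Lemma I_te_span delta i : solution_span (I_te u x delta i).
Proof.
have := lin_span_comb (- 2) (lin_span_comb 1 (L1 (obs_time delta i.+1)) (L1 (obs_time delta i.-1)))
  (L1 (obs_time delta i)).
rewrite (_ : (fun w => _) = I_te u x delta i)//.
by apply/funext => w; rewrite /I_te; ring.
Qed.

Lemma has_moments_I_te delta i : has_moments P (I_te u x delta i).
Proof. exact: (solution_span_gaussian.2 _ (I_te_span delta i)).1. Qed.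

Lemma mean_solution (t s : {nonneg R}) :
  E (fun w => u t x w * u s x w) = rescaled_covariance d beta theta t%:num s%:num.
Proof.
have := congr1 (@complex.Re R) (wu.2 t s x x).
rewrite Re_wave_covarianceE// -/(rescaled_covariance d beta theta t%:num s%:num) => <-.
by rewrite /Rintegral unlock.
Qed.

Lemma mean_I_te (delta : {posnum R}) i j : E (fun w => I_te u x delta i.+1 w * I_te u x delta j.+1 w) =
  delta%:num `^ (3 - beta) * gam d beta theta i.+1%:R j.+1%:R.
Proof.
have obs a b : E (fun w => u (obs_time delta a) x w * u (obs_time delta b) x w) =
    delta%:num `^ (3 - beta) * rescaled_covariance d beta theta a%:R b%:R.
  by rewrite mean_solution /= rescaled_covariance_scale.
have mI := has_moments_I_te delta j.+1.
have lin a (Z := u (obs_time delta a) x) : E (fun w => Z w * I_te u x delta j.+1 w) =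
    delta%:num `^ (3 - beta) * (rescaled_covariance d beta theta a%:R j.+2%:R +
      rescaled_covariance d beta theta a%:R j%:R - 2 * rescaled_covariance d beta theta a%:R j.+1%:R).
  have mZ b : has_moments P (fun w => Z w * u (obs_time delta b) x w).
    by apply: has_momentsM; exact: has_moments_solution.
  transitivity (E (fun w => Z w * u (obs_time delta j.+2) x w + Z w * u (obs_time delta j) x w -
      2 * (Z w * u (obs_time delta j.+1) x w))).
    by apply: eq_Rintegral => w _; rewrite /I_te/=; ring.
  rewrite meanB; [|exact: has_momentsD|exact: has_momentsZ].
  by rewrite meanD// meanZ// !obs; ring.
transitivity (E (fun w => u (obs_time delta i.+2) x w * I_te u x delta j.+1 w +
    u (obs_time delta i) x w * I_te u x delta j.+1 w -
      2 * (u (obs_time delta i.+1) x w * I_te u x delta j.+1 w))).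
  by apply: eq_Rintegral => w _; rewrite {1}/I_te/=; ring.
have mZ b : has_moments P (fun w => u (obs_time delta b) x w * I_te u x delta j.+1 w).
  by apply: has_momentsM => //; exact: has_moments_solution.
rewrite meanB; [|exact: has_momentsD|exact: has_momentsZ].
rewrite meanD// meanZ// !lin /gam /mixed_diff2.
have e1 (k : nat) : k.+1%:R + 1 = k.+2%:R :> R by rewrite natr1.
have e2 (k : nat) : k.+1%:R - 1 = k%:R :> R by rewrite -natr1 addrK.
by rewrite !e1 !e2; ring.
Qed.

Variable delta : nat -> {posnum R}.

Definition scaled_increment m (i : 'I_m) w :=
  (delta m)%:num `^ ((beta - 3) / 2) * I_te u x (delta m) i.+1 w.

Lemma scaled_increment_span m i : solution_span (@scaled_increment m i).
Proof.
have L0 : solution_span (fun=> 0).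
  by exists 0%N, (fun=> (0%:nng, x)), (fun=> 0); apply/funext => w; rewrite big_ord0.
have := lin_span_comb ((delta m)%:num `^ ((beta - 3) / 2)) L0 (I_te_span (delta m) i.+1).
rewrite (_ : (fun w => _) = @scaled_increment m i)//.
by apply/funext => w; rewrite add0r.
Qed.

Let scale2 m : (delta m)%:num `^ ((beta - 3) / 2) ^+ 2 = (delta m)%:num `^ (beta - 3).
Proof. by rewrite -powR_mulrn ?powR_ge0// -powRrM; congr (_ `^ _); field. Qed.

Lemma cov_scaled_increment m (i j : 'I_m) :
  cov P (@scaled_increment m) i j = gam d beta theta i.+1%:R j.+1%:R.
Proof.
have mI k := has_moments_I_te (delta m) k.
transitivity (E (fun w => (delta m)%:num `^ (beta - 3) *
    (I_te u x (delta m) i.+1 w * I_te u x (delta m) j.+1 w))).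
  by apply: eq_Rintegral => w _; rewrite -scale2 /scaled_increment; ring.
rewrite meanZ; last exact: has_momentsM.
rewrite mean_I_te mulrA -powRD; last by rewrite (gt_eqF [gt0 of (delta m)%:num]) implybT.
have -> : beta - 3 + (3 - beta) = 0 by ring.
by rewrite powRr0 mul1r.
Qed.

Lemma sqnorm_scaled_increment m w :
  sqnorm (@scaled_increment m) w = (delta m)%:num `^ (beta - 3) * V_te u x (delta m) m w.
Proof.
rewrite /sqnorm /V_te big_add1/= big_mkord mulr_sumr; apply: eq_bigr => i _.
by rewrite -scale2 exprMn.
Qed.

(** This is [m] to the power [- 3 / 2], with value 0 at [m = 0]. In this form the rescaled
    fluctuation is [Num.sqrt m] times the deviation of [sqnorm / m ^+ 2] from [mean_limit]. *)
Definition var_scale (m : nat) : R := Num.sqrt m%:R / m%:R ^+ 2.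

Definition var_limit : R := C_te_V d beta * theta `^ (- beta).

Definition mean_limit : R := kappa d beta theta * rho d beta 0.

Let g i j := gam d beta theta i.+1%:R j.+1%:R.

Lemma cvg_moments (mu : nat -> R) : mu 0%N = 1 ->
  (forall p, mu p.+1 = p%:R * var_limit * mu p.-1) ->
  forall p, E (fun w => (var_scale m * (sqnorm (@scaled_increment m) w - mean_limit * m%:R ^+ 2)) ^+ p)
    @[m --> \oo] --> mu p.
Proof.
move=> mu0 muS.
have [B hB] := gam_rest_bounded d theta beta0 beta2.
have [C C0 hC] := rho_decay d beta0 beta2.
have k0 : 0 <= kappa d beta theta by rewrite ltW// kappa_gt0.
pose e i j := gam_rest d beta theta i.+1%:R j.+1%:R.
have gC i j : g i j = g j i by rewrite /g gamC.
have gE i j : g i j = kappa d beta theta * (i.+1%:R + j.+1%:R) * rho d beta (i%:R - j%:R) + e i j.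
  rewrite /g gamE//; congr (_ * _ + _); congr rho.
  by rewrite -(natr1 i) -(natr1 j); ring.
have eB i j : `|e i j| <= B by exact: hB.
have rhoC (i j : nat) : `|rho d beta (i%:R - j%:R)| <= C * (`|i%:R - j%:R| + 1) ^- 2.
  have -> : (i%:R - j%:R : R) = (i%:Z - j%:Z)%:~R by rewrite rmorphB.
  exact: hC.
have B0 : 0 <= B := le_trans (normr_ge0 _) (eB 0%N 0%N).
have [S hS] : exists S : R, (\sum_(k < m) rho d beta k%:R ^+ 2) @[m --> \oo] --> S.
  by exists (limn (fun m => \sum_(k < m) rho d beta k%:R ^+ 2)); exact: (cvg_sum_rho_sqr C0 rhoC).
have ms m : var_scale m * m%:R = Num.sqrt (m%:R^-1).
  rewrite sqrtrV// /var_scale; have [->|m0] := eqVneq m 0%N; first by rewrite sqrtr0 invr0 !mul0r.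
  have sm : Num.sqrt m%:R != 0 :> R by rewrite sqrtr_eq0 -ltNge ltr0n lt0n.
  have -> : m%:R = Num.sqrt m%:R ^+ 2 :> R by rewrite sqr_sqrtr.
  by rewrite sqrtr_sqr ger0_norm ?sqrtr_ge0//; field.
have ms2 m : var_scale m ^+ 2 = m%:R ^- 3.
  rewrite /var_scale expr_div_n sqr_sqrtr//; have [->|m0] := eqVneq m 0%N.
    by rewrite mul0r expr0n/= invr0.
  by field; rewrite pnatr_eq0.
have ms0 : var_scale m * m%:R @[m --> \oo] --> (0 : R).
  under eq_fun do rewrite ms.
  have h : Num.sqrt (m%:R^-1 : R) @[m --> \oo] --> Num.sqrt (0 : R).
    apply: continuous_cvg; first exact: sqrt_continuous.
    by rewrite -(cvg_shiftS (fun m => m%:R^-1 : R)); exact: cvg_inv_nat.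
  by rewrite sqrtr0 in h.
have s0 m : 0 <= var_scale m by rewrite divr_ge0 ?sqrtr_ge0 ?exprn_ge0.
pose C1 := 8 * kappa d beta theta * C + B.
have C10 : 0 <= C1 by rewrite addr_ge0// mulr_ge0// mulr_ge0.
have y0 : 0 <= mean_limit by rewrite mulr_ge0// (ltW (rho0_gt0 beta0 beta2 betad)).
apply: (@moments_cvg _ _ _ P _ solution_span_gaussian (fun m => m) scaled_increment
  scaled_increment_span var_scale (fun m => mean_limit * m%:R ^+ 2) (fun m => C1 * m%:R)
  var_limit (C1 * mean_limit)) => //.
- by move=> m; rewrite mulr_ge0.
- move=> m i; under eq_bigr do rewrite cov_scaled_increment.
  exact: (row_sum_le k0 C0 gE eB rhoC (ltn_ord i)).
- apply: norm_cvg0.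
  have h : (`|mean_limit| + B) * (var_scale m * m%:R) @[m --> \oo] --> (0 : R).
    by rewrite -[X in _ --> X](mulr0 (`|mean_limit| + B)); apply: cvgM => //; exact: cvg_cst.
  apply: (squeeze_cvgr _ (cvg_cst 0) h).
  apply: nearW => m; rewrite normr_ge0/= normrM (ger0_norm (s0 m)) [leRHS]mulrCA ler_wpM2l//.
  under eq_bigr do rewrite cov_scaled_increment.
  exact: (trace_le gE eB).
- have h := cvg_frobenius k0 C0 gC gE eB rhoC hS.
  rewrite -cvg_shiftS.
  (* The factor [128 / 3] is assembled here as [2 * (4 / 3) * 16], the last factor being the square
     of the 4 in [kappa]. *)
  have -> : var_limit = 2 * (4 / 3 * kappa d beta theta ^+ 2 * (2 * S - rho d beta 0 ^+ 2)).
    rewrite /var_limit C_te_VE//.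
    rewrite (_ : (\esum_(j in _) _)%E = (2 * S - rho d beta 0 ^+ 2)%:E); last first.
      rewrite -(esum_int_even (u := fun n => rho d beta n%:R ^+ 2) _ hS); last by move=> n; exact: sqr_ge0.
      apply: eq_esum => j _; congr EFin; congr (_ ^+ 2).
      by case: j => n //=; rewrite NegzE mulrNz rhoN.
    have -> : kappa d beta theta ^+ 2 = (4 / (2 * pi) ^+ d) ^+ 2 * theta `^ (- beta).
      rewrite /kappa exprMn; congr (_ * _); rewrite -powR_mulrn ?powR_ge0// -powRrM.
      by congr (_ `^ _); field.
    rewrite mulnC exprM; have : (2 * pi) ^+ d != 0 :> R by rewrite expf_neq0// mulf_neq0// gt_eqF ?pi_gt0.
    by move: ((2 * pi) ^+ d : R) => z z0; rewrite [fine _]/=; field.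
  have -> : (fun m => 2 * var_scale m.+1 ^+ 2 * \sum_i \sum_j cov P (@scaled_increment m.+1) i j ^+ 2) =
      (fun m => 2 * ((\sum_(i < m.+1) \sum_(j < m.+1) g i j ^+ 2) / m.+1%:R ^+ 3)).
    apply/funext => m; rewrite ms2 -mulrA (mulrC (_ ^- _)); congr (_ * (_ / _)).
    by apply: eq_bigr => i _; apply: eq_bigr => j _; rewrite cov_scaled_increment.
  by apply: cvgM => //; exact: cvg_cst.
- have -> : (fun m => var_scale m * (C1 * m%:R)) = (fun m => C1 * (var_scale m * m%:R)).
    by apply/funext => m; ring.
  by rewrite -[X in _ --> X](mulr0 C1); apply: cvgM => //; exact: cvg_cst.
(* The powers [m ^- 3], [m] and [m ^+ 2] cancel, so equality holds for [m > 0]. *)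
- move=> m; rewrite ms2; have [->|m0] := eqVneq m 0%N; first by rewrite mulr0 mulr0 mul0r mulr_ge0.
  rewrite le_eqVlt; apply/orP; left; apply/eqP.
  by field; rewrite pnatr_eq0.
Qed.

End wave_increments.

(** * Slutsky's argument and the delta method *)

Section slutsky.
Context {d} {T : measurableType d} {R : realType} (P : probability T R).
Local Notation E f := (Rintegral P setT f).
Variables (W A : nat -> T -> R) (c K : R).
Hypotheses (mW : forall m, has_moments P (W m)) (mA : forall m, measurable_fun setT (A m)).
Hypothesis W2 : forall m, E (fun w => W m w ^+ 2) <= K.
Hypothesis AW : forall b e : R, 0 < e ->
  \forall m \near \oo, forall w, `|W m w| <= b -> `|A m w - c * W m w| <= e.

(** [A m] is uniformly close to [c * W m] only where [W m] is bounded; the uniform second moment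
    makes the remaining event negligible, and [f] is uniformly continuous on the bounded range. *)
Lemma cvg_mean_near_linear (f : R -> R) (l : R) : continuous f ->
  (exists M, forall y, `|f y| <= M) ->
  E (fun w => f (c * W m w)) @[m --> \oo] --> l -> E (fun w => f (A m w)) @[m --> \oo] --> l.
Proof.
move=> cf [M fM] fl; have M0 : 0 <= M by apply: le_trans (fM 0).
have K0 : 0 <= K by apply: le_trans (W2 0); apply: mean_ge0 => w; exact: sqr_ge0.
have mf (Y : T -> R) : measurable_fun setT Y -> has_moments P (fun w => f (Y w)).
  move=> mY; apply: (@has_moments_bounded _ _ _ _ _ M) => [|w]; last exact: fM.
  by apply: measurableT_comp => //; exact: continuous_measurable_fun.
have mcW m : measurable_fun setT (fun w => c * W m w).
  by apply: measurable_funM => //; case: (mW m).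
have diff0 : E (fun w => f (A m w)) - E (fun w => f (c * W m w)) @[m --> \oo] --> (0 : R).
  apply/cvgrPdist_le => e e0.
  have e2 : 0 < e / 2 by rewrite divr_gt0.
  (* Outside the event [|W m| <= b], Chebyshev's inequality applies. *)
  pose b := 1 + 4 * M * K / e.
  have b1 : 1 <= b by rewrite lerDl divr_ge0 ?mulr_ge0// ltW.
  have b0 : 0 < b by rewrite (lt_le_trans ltr01).
  have [dl dl0 hd] := segment_unif_continuous (- (`|c| * b)) (`|c| * b) cf e2.
  have dl20 : 0 < dl / 2 by rewrite divr_gt0.
  near=> m.
  have hA : forall w, `|W m w| <= b -> `|A m w - c * W m w| <= dl / 2.
    by near: m; exact: AW.
  rewrite sub0r normrN -meanB; [|exact: mf|exact: mf].
  have mD : has_moments P (fun w => f (A m w) - f (c * W m w)) by apply: has_momentsB; exact: mf.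
  apply: le_trans (le_norm_mean mD) _.
  have mW2 : has_moments P (fun w => W m w ^+ 2) by exact: has_momentsX.
  apply: (@le_trans _ _ (E (fun w => e / 2 + 2 * M / b ^+ 2 * W m w ^+ 2))).
    apply: le_mean => [||w]; [exact: has_moments_norm| |].
      by apply: has_momentsD; [exact: has_moments_cst|exact: has_momentsZ].
    have [Wb|Wb] := leP `|W m w| b.
      have : `|f (c * W m w) - f (A m w)| < e / 2.
        apply: hd; first by rewrite -ler_norml normrM ler_wpM2l.
        by rewrite distrC (le_lt_trans (hA _ Wb))// ltr_pdivrMr// ltr_pMr// ltr1n.
      rewrite distrC => /ltW/le_trans; apply; rewrite lerDl.
      by rewrite mulr_ge0 ?sqr_ge0// divr_ge0 ?exprn_ge0 ?mulr_ge0// ltW.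
    apply: (@le_trans _ _ (2 * M)).
      by rewrite mulr_natl mulr2n (le_trans (ler_normB _ _))// lerD.
    apply: (@le_trans _ _ (2 * M / b ^+ 2 * W m w ^+ 2)); last by rewrite lerDr ltW.
    rewrite mulrAC ler_pdivlMr ?exprn_gt0// ler_wpM2l ?mulr_ge0//.
    by rewrite -[leRHS]real_normK ?num_real// lerXn2r ?nnegrE ?(ltW b0)// ltW.
  rewrite meanD; [|exact: has_moments_cst|exact: has_momentsZ].
  rewrite mean_cst meanZ// [leRHS](_ : e = e / 2 + e / 2); last by field.
  rewrite lerD2l; apply: (@le_trans _ _ (2 * M / b ^+ 2 * K)).
    by rewrite ler_wpM2l ?W2// divr_ge0 ?exprn_ge0 ?mulr_ge0// ltW.
  rewrite mulrAC ler_pdivrMr ?exprn_gt0//.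
  apply: (@le_trans _ _ (e / 2 * b)).
    rewrite /b mulrDr mulr1 (_ : e / 2 * (4 * M * K / e) = 2 * M * K); last by field; rewrite gt_eqF.
    by rewrite lerDr ltW.
  by rewrite ler_wpM2l ?(ltW e2)// expr2 ler_peMl// ltW.
rewrite (_ : (fun m => E (fun w => f (A m w))) =
  (fun m => (E (fun w => f (A m w)) - E (fun w => f (c * W m w))) + E (fun w => f (c * W m w)))); last first.
  by apply/funext => m; rewrite subrK.
by rewrite -[l]add0r; exact: cvgD.
Unshelve. all: by end_near. Qed.

End slutsky.

(** Kept deterministic and uniform over [|z| <= b]: randomness enters only when [z] is replaced by
    [W m w] in the Slutsky argument. *)
Lemma delta_method {R : realType} (h : R -> R) (y0 c b e : R) : is_derive y0 1 h c -> 0 < e ->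
  \forall m \near \oo, forall z, `|z| <= b ->
    `|Num.sqrt m%:R * (h (y0 + z / Num.sqrt m%:R) - h y0) - c * z| <= e.
Proof.
move=> [dh hc] e0; pose b' := `|b| + 1.
have b'0 : 0 < b' by rewrite ltr_wpDl.
have eb : 0 < e / b' by rewrite divr_gt0.
have : (h (y0 + k) - h y0) / k @[k --> 0^'] --> c.
  have : k^-1 *: (h (k *: 1 + y0) - h y0) @[k --> 0^'] --> c by rewrite -hc; exact: dh.
  apply: cvg_trans; apply: near_eq_cvg; apply: nearW => k.
  by rewrite /GRing.scale/= mulr1 mulrC (addrC k).
move=> /cvgrPdist_le /(_ _ eb) [r /= r0 hr].
near=> m.
have m0 : (0 < m)%N by near: m; exact: nbhs_infty_gt.
have sm : 0 < Num.sqrt m%:R :> R by rewrite sqrtr_gt0 ltr0n.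
have mr : b' / Num.sqrt m%:R < r.
  rewrite ltr_pdivrMr// mulrC -ltr_pdivrMr//.
  have -> : b' / r = Num.sqrt ((b' / r) ^+ 2) by rewrite sqrtr_sqr ger0_norm// divr_ge0 ?ltW.
  rewrite ltr_sqrt ?ltr0n//; near: m; exact: nbhs_infty_gtr.
move=> z zb; have zb' : `|z| <= b' by rewrite (le_trans zb)// (le_trans (ler_norm b))// lerDl.
have [->|z0] := eqVneq z 0; first by rewrite mul0r addr0 subrr !mulr0 subrr normr0 ltW.
pose k := z / Num.sqrt m%:R.
have k0 : k != 0 by rewrite mulf_neq0// invr_eq0 gt_eqF.
have kr : `|k| < r.
  rewrite /k normrM normfV (gtr0_norm sm) (le_lt_trans _ mr)// ler_wpM2r// invr_ge0 (ltW sm).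
have := hr k; rewrite /= sub0r normrN => /(_ kr k0) hk.
have -> : Num.sqrt m%:R * (h (y0 + k) - h y0) - c * z = - z * (c - (h (y0 + k) - h y0) / k).
  have zk : z = k * Num.sqrt m%:R by rewrite /k divfK// gt_eqF.
  by rewrite zk; move: (h (y0 + k)) => y; field.
rewrite normrM normrN (le_trans (ler_pM _ _ zb' hk))// mulrC divfK// gt_eqF.
Unshelve. all: by end_near. Qed.

Lemma measurable_funV {d} {T : measurableType d} {R : realType} (f : T -> R) :
  measurable_fun setT f -> measurable_fun setT (fun w => (f w)^-1).
Proof.
move=> mf; rewrite (_ : (fun w => _) = fun w => f w * (f w ^+ 2) `^ (-1)).
  apply: measurable_funM => //; apply: (measurableT_comp (measurable_powR (-1))).
  exact: measurable_funX.
apply/funext => w; rewrite powR_inv1 ?sqr_ge0//; have [->|f0] := eqVneq (f w) 0.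
  by rewrite invr0 mul0r.
by field.
Qed.

(** Dividing by [c ^+ p] converts the moments for the variance [c ^+ 2 * v] into those for [v], so a
    single limit law serves for [W m] and for [c * W m]. *)
Lemma normal_moments_scale {R : fieldType} (mu : nat -> R) (c v : R) : c != 0 ->
  (forall p, mu p.+1 = p%:R * (c ^+ 2 * v) * mu p.-1) ->
  forall p, mu p.+1 / c ^+ p.+1 = p%:R * v * (mu p.-1 / c ^+ p.-1).
Proof.
move=> c0 muS [|k]; first by rewrite muS !mul0r.
by rewrite muS/= !exprS; field; rewrite c0 expf_neq0.
Qed.

Section delta_parameters.
Context {R : realType} (d : nat) (beta theta : R).
Hypotheses (beta0 : 0 < beta) (beta2 : beta < 2) (betad : beta < d%:R) (theta0 : 0 < theta).

Definition inverse_mean (y : R) : R := (C_te_E d beta / y) `^ (2 / beta).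

Lemma mean_limitE : mean_limit d beta theta = C_te_E d beta * theta `^ (- (beta / 2)).
Proof. by rewrite /mean_limit /kappa C_te_EE//; ring. Qed.

Lemma mean_limit_gt0 : 0 < mean_limit d beta theta.
Proof. by rewrite mean_limitE mulr_gt0 ?powR_gt0 ?C_te_E_gt0. Qed.

Lemma inverse_mean_limit : inverse_mean (mean_limit d beta theta) = theta.
Proof.
have C0 : C_te_E d beta != 0 by rewrite gt_eqF// C_te_E_gt0.
rewrite /inverse_mean mean_limitE powRN invfM invrK mulrA divff// mul1r -powRrM.
by rewrite (_ : beta / 2 * (2 / beta) = 1) ?powRr1 ?ltW//; field; rewrite gt_eqF.
Qed.

Definition delta_slope : R := - (2 / beta * theta / mean_limit d beta theta).

(** Near the limit [inverse_mean] is a multiple of the power [- 2 / beta], so its slope is that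
    exponent times value over argument, and the value is [theta]. *)
Lemma is_derive_inverse_mean : is_derive (mean_limit d beta theta) 1 inverse_mean delta_slope.
Proof.
have y0 := mean_limit_gt0; set y := mean_limit d beta theta in y0 *.
have C0 := C_te_E_gt0 beta0 beta2 betad.
have ey (z : R) : 0 < z -> inverse_mean z = C_te_E d beta `^ (2 / beta) * z `^ (- (2 / beta)).
  move=> z0; rewrite /inverse_mean powRM ?invr_ge0 ?ltW//; congr (_ * _).
  by rewrite -powR_inv1 ?ltW// -powRrM mulN1r.
have dp := is_deriveZ (C_te_E d beta `^ (2 / beta)) (is_derive1_powR (- (2 / beta)) y0).
have -> : delta_slope = C_te_E d beta `^ (2 / beta) *: (- (2 / beta) * y `^ (- (2 / beta) - 1)).
  rewrite /delta_slope -/y -[in LHS]inverse_mean_limit -/y ey// /GRing.scale/=.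
  rewrite powRB ?powRr1 ?ltW//; last by rewrite (gt_eqF y0) implybT.
  by field; rewrite !gt_eqF.
apply: near_eq_is_derive dp; near=> z; rewrite ey//.
by near: z; exact: lt_nbhsr.
Unshelve. all: by end_near. Qed.

Lemma delta_slope_neq0 : delta_slope != 0.
Proof.
by rewrite oppr_eq0 !mulf_neq0// ?invr_eq0 ?gt_eqF// mean_limit_gt0.
Qed.

Lemma delta_variance : delta_slope ^+ 2 * var_limit d beta theta =
  theta ^+ 2 * (4 * C_te_V d beta / (beta ^+ 2 * C_te_E d beta ^+ 2)).
Proof.
rewrite /delta_slope /var_limit mean_limitE.
have -> : theta `^ (- beta) = theta `^ (- (beta / 2)) ^+ 2.
  by rewrite -powR_mulrn ?powR_ge0// -powRrM; congr (_ `^ _); field.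
have : theta `^ (- (beta / 2)) != 0 by rewrite gt_eqF// powR_gt0.
move: (theta `^ (- (beta / 2)) : R) => z z0.
have C0 : C_te_E d beta != 0 by rewrite gt_eqF// C_te_E_gt0.
by field; rewrite z0 C0 gt_eqF.
Qed.

Lemma var_limit_ge0 : 0 <= var_limit d beta theta.
Proof.
rewrite mulr_ge0 ?powR_ge0// mulr_ge0 ?fine_ge0//.
  by rewrite divr_ge0// mulr_ge0// exprn_ge0// mulr_ge0// pi_ge0.
by apply: esum_ge0 => j _; rewrite lee_fin sqr_ge0.
Qed.

End delta_parameters.

Theorem corollary4p10 (R : realType) (d : nat) (beta theta : R)
    (dT : measure_display) (T : measurableType dT) (P : probability T R)
    (u : {nonneg R} -> d.-tuple R -> {RV P >-> R})
    (x : d.-tuple R) (delta : nat -> {posnum R}) :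
  0 < beta -> beta < Num.min 2 d%:R -> 0 < theta ->
  wave_solution beta theta u ->
  cvg_in_distribution P
    (fun m w => Num.sqrt m%:R * (theta_hat_te beta u x (delta m) m w - theta))
    (gaussian_prob 0
       (theta ^+ 2 *
        (4 * C_te_V d beta / (beta ^+ 2 * C_te_E d beta ^+ 2)))).
Proof.
move=> beta0; rewrite lt_min => /andP[beta2 betad] theta0 wu.
rewrite -delta_variance//.
set c := delta_slope d beta theta; set v := var_limit d beta theta; set y := mean_limit d beta theta.
set A := fun m w => _.
pose W m w := var_scale m * (sqnorm (@scaled_increment _ _ _ P d beta u x delta m) w - y * m%:R ^+ 2).
have GL := solution_span_gaussian wu.
have mW m : has_moments P (W m).
  apply: has_momentsZ; apply: has_momentsB; last exact: has_moments_cst.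
  by apply: (has_moments_sqnorm GL) => i; exact: scaled_increment_span.
have mA m : measurable_fun setT (A m).
  apply: measurable_funM => //; apply: measurable_funB => //.
  apply: (measurableT_comp (measurable_powR (2 / beta))).
  apply: measurable_funM => //; apply: measurable_funV.
  apply: measurable_funM => //; apply: measurable_sum => i.
  exact: (has_momentsX 2 (has_moments_I_te wu x (delta m) i)).1.
split=> // f cf bf.
have c0 : c != 0 := delta_slope_neq0 beta0 beta2 betad theta0.
have v0 : 0 <= c ^+ 2 * v by rewrite mulr_ge0 ?sqr_ge0// var_limit_ge0.
pose nu := gaussian_prob 0 (c ^+ 2 * v).
have [mnu nu0 nuS] := gaussian_moments v0.
pose mu p := \int[nu]_z z ^+ p.
have cvgW : forall p, Rintegral P setT (fun w => W m w ^+ p) @[m --> \oo] --> mu p / c ^+ p.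
  apply: (@cvg_moments _ _ _ P d beta theta u beta0 beta2 betad theta0 wu x delta
    (fun p => mu p / c ^+ p)); first by rewrite /mu nu0 expr0 divr1.
  exact: (@normal_moments_scale _ mu c v c0 nuS).
have [K hK] := cvgn_norm_ub (@cvgW 2).
apply: (@cvg_mean_near_linear _ _ _ P W A c K) => //.
- by move=> m; rewrite (le_trans (ler_norm _)).
- move=> b e e0.
  have := delta_method b (is_derive_inverse_mean beta0 beta2 betad theta0) e0.
  apply: filterS2 (nbhs_infty_gt 0) => m m0 h w Wb.
  have := h _ Wb; rewrite inverse_mean_limit//.
  (* The perturbed argument is exactly the denominator of the estimator, so [inverse_mean] there is
     the estimator itself and no approximation is made before the delta method. *)
  suff -> : y + W m w / Num.sqrt m%:R = m%:R ^- 2 * (delta m)%:num `^ (beta - 3) * V_te u x (delta m) m w.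
    by [].
  rewrite /W sqnorm_scaled_increment /var_scale -mulrA.
  have s0 : Num.sqrt m%:R != 0 :> R by rewrite sqrtr_eq0 -ltNge ltr0n.
  have mn : m%:R != 0 :> R by rewrite pnatr_eq0 -lt0n.
  move: (_ `^ _ : R) (V_te _ _ _ _ _) => D V.
  move: (m%:R : R) (Num.sqrt m%:R : R) s0 mn => n s s0 n0.
  by field; rewrite s0 n0.
apply: (@weak_cvg_of_moments _ _ _ P nu (fun m w => c * W m w)) => //.
- by move=> m; exact: has_momentsZ.
- move=> p; rewrite -/(mu p); have -> : mu p = c ^+ p * (mu p / c ^+ p).
    by rewrite mulrC divfK// expf_neq0.
  rewrite (_ : (fun m => _) = (fun m => c ^+ p * Rintegral P setT (fun w => W m w ^+ p))).
    by apply: cvgM; [exact: cvg_cst|exact: cvgW].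
  apply/funext => m; rewrite -meanZ; last exact: has_momentsX.
  by apply: eq_Rintegral => w _; rewrite exprMn.
- by move=> t; exact: (@normal_growth _ mu (c ^+ 2 * v) t nu0 nuS).
Qed.
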